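(* Let $\mathcal G$ be a metric graph, let $\mathbf H_0$ be its minimal Kirchhoff Laplacian, and let $\widetilde{\mathbf H}$ be a self-adjoint lower semi-bounded extension of $\mathbf H_0$ in $L^2(\mathcal G)$. Assume that $z$ belongs to its resolvent set $\rho(\widetilde{\mathbf H})$. Then the following assertions hold. (i) If the form domain of $\widetilde{\mathbf H}$ is contained in $H^1(\mathcal G)$, then the resolvent $\mathcal R(z,\widetilde{\mathbf H})=(\widetilde{\mathbf H}-z)^{-1}$ is an integral operator whose kernel $\mathcal K_z$ is both of class $L^\infty(\mathcal G\times\mathcal G)$ and jointly Hölder continuous of exponent $\beta=1/2$ (with respect to the natural path metric). (ii) If additionally $\mathcal G$ has finite total volume, then $\mathcal R(z,\widetilde{\mathbf H})$ is of trace class.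
   Context: Metric graphs. Let $\mathcal G_d=(\mathcal V,\mathcal E)$ be an unoriented graph with countably infinite vertex and edge sets which is locally finite (each vertex $v$ has finite degree), connected and simple (no loops or multiple edges). Given edge lengths $|e|\in(0,\infty)$, $e\in\mathcal E$, the metric graph $\mathcal G=(\mathcal G_d,|\cdot|)$ is the topological space obtained by identifying each edge $e$ with the interval $[0,|e|]$ and gluing together endpoints corresponding to the same vertex. It carries the natural path metric $\varrho$ (the infimum of lengths of paths connecting two points) and the Lebesgue measure on its edges; its total volume is $\mathrm{vol}(\mathcal G)=\sum_{e\in\mathcal E}|e|$. $\mathcal E_v$ is the set of edges incident to $v$; a function $f$ on $\mathcal G$ has edge components $f_e=f|_e$; $f_e'(v)$ denotes the derivative of $f_e$ at the vertex $v$ of $e$ taken in the direction pointing from $v$ into $e$. $L^2(\mathcal G)=\bigoplus_{e}L^2(e)$. Operators. The maximal Kirchhoff Laplacian $\mathbf H$ in $L^2(\mathcal G)$ acts by $f\mapsto -f''$ edgewise on the domain of all $f\in L^2(\mathcal G)$ with $f_e\in H^2(e)$ for all $e$, $f''\in L^2(\mathcal G)$, and satisfying at every vertex $v$ the Kirchhoff conditions: $f$ is continuous at $v$ and $\sum_{e\in\mathcal E_v}f_e'(v)=0$. $\mathbf H_0^0$ is its restriction to functions that are non-zero only on finitely many edges, and the minimal Kirchhoff Laplacian $\mathbf H_0$ is the closure of $\mathbf H_0^0$; it is symmetric and non-negative, and $\mathbf H_0^*=\mathbf H$. $H^1(\mathcal G)$ is the space of continuous $f\in L^2(\mathcal G)$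 with $f_e\in H^1(e)$ for all $e$ and $\|f'\|_{L^2(\mathcal G)}^2=\sum_e\|f_e'\|^2_{L^2(e)}<\infty$. Joint Hölder continuity of exponent $1/2$ of a kernel $\mathcal K$ on $\mathcal G\times\mathcal G$ means that there is $C>0$ with $|\mathcal K(x,y)-\mathcal K(x',y')|\le C\big(\varrho(x,x')^{1/2}+\varrho(y,y')^{1/2}\big)$ for all $x,x',y,y'\in\mathcal G$. *)

(* Defs.v *)
From HB Require Import structures.
From Stdlib Require Import Relation_Operators.
From mathcomp Require Import all_boot all_order all_algebra.
From mathcomp Require Import complex.
From mathcomp Require Import all_classical all_reals all_analysis.

Set Implicit Arguments.
Unset Strict Implicit.
Unset Printing Implicit Defensive.
Import Order.TTheory GRing.Theory Num.Theory.
Import numFieldNormedType.Exports.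

Local Open Scope classical_set_scope.
Local Open Scope ring_scope.

(** * Complex-valued functions on a subset [D] of a measure space

    [R[i]] carries no measurable structure in the library: measurability and
    integration are taken on real and imaginary parts. *)

Section ComplexL2.
Context {d : measure_display} {T : measurableType d} {R : realType}.
Implicit Types (D : set T) (f g u v : T -> R[i]).

Definition cmeasurable D f :=
  measurable_fun D (fun x => complex.Re (f x)) /\
  measurable_fun D (fun x => complex.Im (f x)).

Variable m : {measure set T -> \bar R}.

Definition cintegrable D f :=
  m.-integrable D (fun x => (complex.Re (f x))%:E) /\
  m.-integrable D (fun x => (complex.Im (f x))%:E).

Definition cintegral D f : R[i] :=
  Complex (\int[m]_(x in D) complex.Re (f x))
          (\int[m]_(x in D) complex.Im (f x)).

(** Elements of [L^2(D)] are represented by functions [f : T -> R[i]] with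
    [L2 D f], two representatives being identified when [ae_eq m D f g]; the
    values of [f] outside [D] are irrelevant. *)
Definition L2 D f :=
  cmeasurable D f /\
  (\int[m]_(x in D) ((Normc.normc (f x)) ^+ 2)%:E < +oo)%E.

Definition l2inner D f g : R[i] := cintegral D (fun x => f x * conjc (g x)).

Definition l2norm D f : R :=
  Num.sqrt (\int[m]_(x in D) (Normc.normc (f x)) ^+ 2).

Definition orthonormal_basis D (e : nat -> T -> R[i]) :=
  [/\ forall n, L2 D (e n),
      forall n k, l2inner D (e n) (e k) = (n == k)%:R
    & forall f, L2 D f -> (forall n, l2inner D f (e n) = 0) ->
        ae_eq m D f (fun=> 0)].

End ComplexL2.

(** * Unbounded operators in [L^2(D)]

    An operator is given by its graph: [A f g] means that [f] belongs to the
    domain of [A] and [g] represents [A f]. *)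

Section Operators.
Context {d : measure_display} {T : measurableType d} {R : realType}.
Variables (m : {sigma_finite_measure set T -> \bar R}) (D : set T).
Local Notation fn := (T -> R[i]).
Local Notation ip := (l2inner m D).
Local Notation norm2 := (l2norm m D).
Implicit Types (A B : fn -> fn -> Prop) (f g u v : fn).

Record linear_operator A : Prop := {
  linop_L2 : forall f g, A f g -> L2 m D f /\ L2 m D g ;
  linop_ae : forall f f' g g', A f g -> L2 m D f' -> L2 m D g' ->
    ae_eq m D f f' -> ae_eq m D g g' -> A f' g' ;
  linop_functional : forall f f' g g', A f g -> A f' g' ->
    ae_eq m D f f' -> ae_eq m D g g' ;
  linop_zero : A (fun=> 0) (fun=> 0) ;
  linop_linear : forall (a : R[i]) f f' g g', A f g -> A f' g' ->
    A (fun x => f x + a * f' x) (fun x => g x + a * g' x)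
}.

Definition densely_defined A :=
  forall u, L2 m D u -> forall eps : R, 0 < eps ->
    exists f g, A f g /\ norm2 (fun x => u x - f x) < eps.

Definition bounded_operator B :=
  [/\ linear_operator B,
      forall f, L2 m D f -> exists g, B f g
    & exists c : R, forall f g, B f g -> norm2 g <= c * norm2 f].

Definition adjoint A u v :=
  [/\ L2 m D u, L2 m D v & forall f g, A f g -> ip g u = ip f v].

Definition op_closure A u v :=
  [/\ L2 m D u, L2 m D v
    & forall eps : R, 0 < eps -> exists f g,
        [/\ A f g, norm2 (fun x => u x - f x) < eps
          & norm2 (fun x => v x - g x) < eps]].

Definition extends A B := forall f g, B f g -> A f g.

Definition self_adjoint A :=
  [/\ linear_operator A, densely_defined A
    & forall u v, A u v <-> adjoint A u v].

(** The order of [R[i]] is such that [x <= y] forces [y - x] to be real. *)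
Definition lower_semibounded A :=
  exists c : R, forall f g, A f g ->
    (c * norm2 f ^+ 2)%:C%C <= ip g f.

(** Domain of the closure of the form [f |-> <A f, f>]. *)
Definition form_domain A f :=
  L2 m D f /\ exists u v : nat -> fn,
    [/\ forall n, A (u n) (v n),
        (fun n => norm2 (fun x => u n x - f x)) @ \oo --> (0 : R)
      & forall eps : R, 0 < eps -> exists N : nat,
          forall n k, (N <= n)%N -> (N <= k)%N ->
            Normc.normc (ip (fun x => v n x - v k x)
                            (fun x => u n x - u k x)) < eps].

(** [resolvent A z] is the graph of [(A - z)^-1]. *)
Definition resolvent A (z : R[i]) g f := A f (fun x => g x + z * f x).

Definition resolvent_set A (z : R[i]) := bounded_operator (resolvent A z).

Definition integral_operator B (K : T -> T -> R[i]) :=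
  forall f g, B f g ->
    {ae m, forall x, D x ->
      cintegrable m D (fun y => K x y * f y) /\
      g x = cintegral m D (fun y => K x y * f y)}.

Definition Linfty_kernel (K : T -> T -> R[i]) :=
  cmeasurable (D `*` D) (fun p => K p.1 p.2) /\
  exists c : R, {ae (m \x m)%E, forall p, (D `*` D) p ->
    Normc.normc (K p.1 p.2) <= c}.

Definition op_comp B A f h := exists g, A f g /\ B g h.

(** [abs_operator B S] says that [S] is [|B|], the non-negative square root of
    [B^* B]. *)
Definition abs_operator B S :=
  [/\ bounded_operator S, forall f g, S f g -> 0 <= ip g f
    & forall f h, op_comp S S f h <-> op_comp (adjoint B) B f h].

(** The trace of [|B|] does not depend on the orthonormal basis. Bases are
    indexed by [nat], so this is meant for separable infinite-dimensional
    [L^2(D)]; on a metric graph it always is. *)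
Definition trace_class B :=
  bounded_operator B /\
  exists S, abs_operator B S /\
    forall e s, orthonormal_basis m D e -> (forall n, S (e n) (s n)) ->
      (\sum_(0 <= n <oo) (complex.Re (ip (s n) (e n)))%:E < +oo)%E.

End Operators.

(** * Metric graphs

    The orientation of the edges serves only to identify an edge [e] with
    [[0, len e]]: [src e] is at [0] and [tgt e] is at [len e]. *)

Definition joined (V E : Type) (s t : E -> V) (v w : V) (e : E) :=
  (s e = v /\ t e = w) \/ (s e = w /\ t e = v).

Record metric_graph (R : realType) := MetricGraph {
  vertex : Type ;
  edge : Type ;
  src : edge -> vertex ;
  tgt : edge -> vertex ;
  len : edge -> R ;
  vertex_countable : countable [set: vertex] ;
  vertex_infinite : infinite_set [set: vertex] ;
  edge_countable : countable [set: edge] ;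
  edge_infinite : infinite_set [set: edge] ;
  no_loop : forall e, src e <> tgt e ;
  no_multi_edge : forall v w e e',
    joined src tgt v w e -> joined src tgt v w e' -> e = e' ;
  locally_finite : forall v, finite_set [set e | src e = v \/ tgt e = v] ;
  graph_connected : forall v w,
    clos_refl_trans _ (fun v w => exists e, joined src tgt v w e) v w ;
  len_gt0 : forall e, 0 < len e
}.

Section EdgeStructure.
Context {R : realType}.
Implicit Type G : metric_graph R.

Lemma edge_inhabited G : exists e : edge G, True.
Proof.
apply: contrapT => ne; apply: (@edge_infinite R G).
suff -> : [set: edge G] = set0 by exact: finite_set0.
by apply/seteqP; split => // e _; apply: ne; exists e.
Qed.

HB.instance Definition _ G := gen_eqMixin (vertex G).
HB.instance Definition _ G := gen_eqMixin (edge G).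
HB.instance Definition _ G := gen_choiceMixin (edge G).
HB.instance Definition _ G :=
  isPointed.Build (edge G) (projT1 (cid (edge_inhabited G))).
HB.instance Definition _ G :=
  @isMeasurable.Build default_measure_display (edge G)
    (@discrete_measurable (edge G)) (@discrete_measurable0 (edge G))
    (@discrete_measurableC (edge G)) (@discrete_measurableU (edge G)).

End EdgeStructure.

Section MetricGraph.
Context {R : realType}.
Variable G : metric_graph R.
(** [measurableTypeR R] is [R] with the Borel structure on which
    [lebesgue_measure] is defined. *)
Local Notation point := (edge G * measurableTypeR R)%type.

Definition incident (v : vertex G) : set (edge G) :=
  [set e | src e = v \/ tgt e = v].

(** The point at distance [t] from [src e] on the edge [e] is represented by
    [(e, t)]. The points of the metric graph are the elements of [points],
    those representing the same vertex being identified; functions on the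
    metric graph are given on [point], with irrelevant values outside
    [points]. *)
Definition points : set point := [set x | 0 <= x.2 <= len x.1].

Definition at_vertex (x : point) (v : vertex G) :=
  (x.2 = 0 /\ src x.1 = v) \/ (x.2 = len x.1 /\ tgt x.1 = v).

Definition glued (x y : point) :=
  exists v, at_vertex x v /\ at_vertex y v.

(** [path_length x y l]: some path from [x] to [y], made of finitely many
    straight pieces inside edges, has length [l]. *)
Inductive path_length : point -> point -> R -> Prop :=
| path_nil x : points x -> path_length x x 0
| path_glue x x' y l : glued x x' -> path_length x' y l -> path_length x y l
| path_edge e s t y l : points (e, s) -> points (e, t) ->
    path_length (e, t) y l -> path_length (e, s) y (`|s - t| + l).

Definition path_metric (x y : point) : R :=
  inf [set l | path_length x y l].

Definition edge_counting : set (edge G) -> \bar R := @counting (edge G) R.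

HB.instance Definition _ := Measure.on edge_counting.

Lemma edge_counting_sigma_finite : sigma_finite [set: edge G] edge_counting.
Proof.
have /pcard_injP[f fi] := edge_countable G.
have finj : injective f by move=> x y; apply: fi; rewrite inE.
exists (fun n => [set e | (f e <= n)%N]).
  by apply/seteqP; split => // e _; exists (f e) => //=.
move=> n; split => //; rewrite /edge_counting /counting asboolT ?ltry//.
have -> : [set e | (f e <= n)%N] = f @^-1` `I_n.+1.
  by apply/seteqP; split => e /=; rewrite ltnS.
by apply: finite_preimage (finite_II _) => x y _ _; exact: finj.
Qed.

HB.instance Definition _ := Measure_isSigmaFinite.Build _ _ _ edge_counting
  edge_counting_sigma_finite.

(** Restricted to [points], this is the Lebesgue measure on the edges. *)
Definition graph_measure : set point -> \bar R :=
  (edge_counting \x @lebesgue_measure R)%E.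

HB.instance Definition _ := Measure.on graph_measure.

Lemma graph_measure_sigma_finite : sigma_finite [set: point] graph_measure.
Proof.
have /sigma_finiteP[A [TA ndA Aoo]] := sigma_finiteT edge_counting.
have /sigma_finiteP[B [TB ndB Boo]] := sigma_finiteT (@lebesgue_measure R).
exists (fun n => A n `*` B n).
  apply/seteqP; split => // -[x y] _.
  have : [set: edge G] x by [].
  have : [set: measurableTypeR R] y by [].
  rewrite TA TB => -[k _ Bky] [n _ Anx]; exists (maxn n k) => //; split.
    by move: x Anx; exact/subsetPset/ndA/leq_maxl.
  by move: y Bky; exact/subsetPset/ndB/leq_maxr.
move=> k; have [? ?] := Aoo k; have [? ?] := Boo k.
split; first exact: measurableX.
by rewrite /graph_measure product_measure1E// lte_mul_pinfty// ge0_fin_numE.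
Qed.

HB.instance Definition _ := Measure_isSigmaFinite.Build _ _ _ graph_measure
  graph_measure_sigma_finite.

Definition total_volume : \bar R := \esum_(e in [set: edge G]) (len e)%:E.

(** For every edge [e], [f_e] is absolutely continuous with
    [f_e' = g_e] in [L^2(e)]. *)
Definition edge_derivative (f g : point -> R[i]) :=
  forall e, L2 (@lebesgue_measure R) `[0, len e] (fun t => g (e, t)) /\
    forall t, 0 <= t <= len e ->
      f (e, t) = f (e, 0) +
        cintegral (@lebesgue_measure R) `[0, t] (fun s => g (e, s)).

Definition continuous_at_vertices (f : point -> R[i]) :=
  forall x y, glued x y -> f x = f y.

Definition continuous_on_graph (f : point -> R[i]) :=
  continuous_at_vertices f /\
  forall e, {within `[0, len e], continuous (fun t => complex.Re (f (e, t)))} /\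
            {within `[0, len e], continuous (fun t => complex.Im (f (e, t)))}.

Definition H1 (f : point -> R[i]) :=
  [/\ L2 graph_measure points f, continuous_on_graph f
    & exists f', edge_derivative f f' /\ L2 graph_measure points f'].

(** [outer_derivative f' v e] is the derivative at [v] in the direction
    pointing from [v] into the incident edge [e]. *)
Definition outer_derivative (f' : point -> R[i]) (v : vertex G)
    (e : edge G) : R[i] :=
  if src e == v then f' (e, 0) else - f' (e, len e).

Definition kirchhoff (f f' : point -> R[i]) :=
  continuous_at_vertices f /\
  forall v, \sum_(e \in incident v) outer_derivative f' v e = 0.

(** [u] and [w] are arbitrary representatives; the pointwise conditions bear
    on the representative [f] of [u] that is continuously differentiable on
    each edge, [f'] being its derivative and [f'' = - w]. *)
Definition maximal_laplacian (u w : point -> R[i]) :=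
  [/\ L2 graph_measure points u, L2 graph_measure points w
    & exists f f' f'',
      [/\ ae_eq graph_measure points u f,
          ae_eq graph_measure points w (fun x => - f'' x),
          edge_derivative f f', edge_derivative f' f''
        & kirchhoff f f']].

Definition preminimal_laplacian (u w : point -> R[i]) :=
  maximal_laplacian u w /\
  finite_set [set e | ~ ae_eq (@lebesgue_measure R) [set` `[0, len e]]
                          (fun t => u (e, t)) (fun=> 0)].

Definition minimal_laplacian :=
  op_closure graph_measure points preminimal_laplacian.

Definition holder_half_kernel (K : point -> point -> R[i]) :=
  exists2 c : R, 0 < c & forall x x' y y',
    points x -> points x' -> points y -> points y' ->
    Normc.normc (K x y - K x' y') <=
      c * (Num.sqrt (path_metric x x') + Num.sqrt (path_metric y y')).

End MetricGraph.

Arguments points {R} G _.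
Arguments graph_measure {R} G _.
Arguments path_metric {R} G _ _.
Arguments minimal_laplacian {R} G _ _.

(* Main.v *)
Require Import Defs.
From HB Require Import structures.
From mathcomp Require Import all_boot all_order all_algebra.
From mathcomp Require Import complex ring lra.
From mathcomp Require Import all_classical all_reals all_analysis.
From mathcomp Require Import measurable_realfun.

Set Implicit Arguments.
Unset Strict Implicit.
Unset Printing Implicit Defensive.
Import Order.TTheory GRing.Theory Num.Theory.
Import numFieldNormedType.Exports.

Local Open Scope classical_set_scope.
Local Open Scope ring_scope.

(** Let [P >= 0] be the resolvent of [A] at a real point far below its spectrum
    and [Q] its square root. The range of [Q] lies in the form domain, hence in
    H^1, so for every [u] the continuous representative of [Q u] is bounded and
    Hoelder continuous of exponent 1/2; the bounds depend on [u]. Applying the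
    uniform boundedness principle to the averages of [Q u] over small intervals
    makes them uniform: evaluation of [Q u] at [x] is the scalar product with a
    vector [s x], where [s] is bounded and Hoelder continuous of exponent 1/2
    for the path metric. As [Q] commutes with the bounded operator
    [W = 1 + (z - l) (A - z)^-1], the resolvent factors as [Q W Q], and its
    kernel is [<W (s y), s x>]. Its absolute value is [Q |W| Q], whose trace is at
    most [|W|] times the squared Hilbert-Schmidt norm of [Q], which by Bessel's
    inequality is at most the integral of [|s x|^2], hence finite when the
    graph has finite volume. *)

(** * Hilbert spaces *)

(** The inclusion of the form domain in H^1 is an inclusion of sets and carries no estimate, and
    point values mean nothing on classes of L^2 functions. Averages remove both obstacles: each is a
    scalar product with an L^2 function, and the H^1 bounds on a single [Q u] keep its averages, as
    well as their differences divided by the square root of the distance, bounded for that [u],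
    which is all that uniform boundedness asks. Half a power of the resolvent is the right amount:
    [Q] already lands in the form domain, and one factor on each side of [W] gives the regularity of
    the kernel in each variable. The factorization itself is the resolvent identity (A - z)^-1 = P W
    with one [Q] moved across [W]. On the graph, the constants must not depend on edge lengths,
    which need not be bounded below, nor on the distance to a base point. Errors are therefore
    measured by the share of the H^1 norm carried by each edge and summed along walks that repeat no
    edge, so that every edge is charged at most once. *)

Section ComplexFacts.
Context {R : realType}.
Implicit Types (a b : R[i]) (r : R).
Local Notation normc := (@Normc.normc R).
Local Notation Re := complex.Re.
Local Notation Im := complex.Im.

Lemma ReD a b : Re (a + b) = Re a + Re b.
Proof. by case: a b => ? ? [? ?]. Qed.

Lemma ImD a b : Im (a + b) = Im a + Im b.
Proof. by case: a b => ? ? [? ?]. Qed.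

Lemma ReN a : Re (- a) = - Re a. Proof. by case: a. Qed.

Lemma ImN a : Im (- a) = - Im a. Proof. by case: a. Qed.

Lemma ReB a b : Re (a - b) = Re a - Re b.
Proof. by rewrite ReD ReN. Qed.

Lemma ImB a b : Im (a - b) = Im a - Im b.
Proof. by rewrite ImD ImN. Qed.

Lemma ReM a b : Re (a * b) = Re a * Re b - Im a * Im b.
Proof. by case: a b => ? ? [? ?]. Qed.

Lemma ImM a b : Im (a * b) = Re a * Im b + Im a * Re b.
Proof. by case: a b => ? ? [? ?]. Qed.

Lemma Re_conjc a : Re (conjc a) = Re a. Proof. by case: a. Qed.

Lemma Im_conjc a : Im (conjc a) = - Im a. Proof. by case: a. Qed.

Lemma conjcD a b : conjc (a + b) = conjc a + conjc b.
Proof. exact: rmorphD. Qed.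

Lemma conjcM a b : conjc (a * b) = conjc a * conjc b.
Proof. exact: rmorphM. Qed.

Lemma conjcN a : conjc (- a) = - conjc a.
Proof. exact: rmorphN. Qed.

Lemma complexP a b : Re a = Re b -> Im a = Im b -> a = b.
Proof. by case: a b => ? ? [? ?] /= -> ->. Qed.

Lemma sqr_normc_ReIm a : normc a ^+ 2 = Re a ^+ 2 + Im a ^+ 2.
Proof. by case: a => x y /=; rewrite sqr_sqrtr// addr_ge0// sqr_ge0. Qed.

Lemma normc_ge0 a : 0 <= normc a.
Proof. by case: a => x y; rewrite sqrtr_ge0. Qed.

Lemma normc_conjc a : normc (conjc a) = normc a.
Proof. by case: a => x y /=; rewrite sqrrN. Qed.

Lemma normcR r : normc r%:C%C = `|r|.
Proof. by rewrite /= expr0n addr0 sqrtr_sqr. Qed.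

Lemma normcNr a : normc (- a) = normc a.
Proof. by case: a => x y /=; rewrite !sqrrN. Qed.

Lemma normcBC a b : normc (a - b) = normc (b - a).
Proof. by rewrite -normcNr opprB. Qed.

Lemma normc_triangle a b : normc (a + b) <= normc a + normc b.
Proof. exact: le_normcD. Qed.

Lemma normc_triangleB a b : normc (a - b) <= normc a + normc b.
Proof. by rewrite (le_trans (normc_triangle _ _))// normcNr. Qed.

Lemma Re_le_normc a : `|Re a| <= normc a.
Proof.
rewrite -sqrtr_sqr -[leRHS]ger0_norm ?normc_ge0// -[leRHS]sqrtr_sqr.
by rewrite ler_wsqrtr// sqr_normc_ReIm lerDl sqr_ge0.
Qed.

Lemma Im_le_normc a : `|Im a| <= normc a.
Proof.
rewrite -sqrtr_sqr -[leRHS]ger0_norm ?normc_ge0// -[leRHS]sqrtr_sqr.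
by rewrite ler_wsqrtr// sqr_normc_ReIm lerDr sqr_ge0.
Qed.

Lemma normc_eq0 a : (normc a == 0) = (a == 0).
Proof. by apply/eqP/eqP => [/Normc.eq0_normc//|->]; rewrite Normc.normc0. Qed.

Lemma mul_conjc a : a * conjc a = (normc a ^+ 2)%:C%C.
Proof.
by apply: complexP; rewrite ?ReM ?ImM Re_conjc Im_conjc ?sqr_normc_ReIm/=; ring.
Qed.

End ComplexFacts.

(** Positivity, definiteness and completeness are stated through the real part of <u, u>, a number
    of [R]; the norm [hn] is defined from it afterwards. *)
HB.mixin Record isHilbert (R : realType) H of GRing.Lmodule R[i] H := {
  ip : H -> H -> R[i] ;
  ipDl : forall u v w, ip (u + v) w = ip u w + ip v w ;
  ipZl : forall a u v, ip (a *: u) v = a * ip u v ;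
  ipC : forall u v, ip u v = conjc (ip v u) ;
  Re_ip_ge0 : forall u, 0 <= complex.Re (ip u u) ;
  Re_ip_eq0 : forall u, complex.Re (ip u u) = 0 -> u = 0 ;
  hilbert_complete : forall x : nat -> H,
    (forall e : R, 0 < e -> exists N, forall n k, (N <= n)%N -> (N <= k)%N ->
       complex.Re (ip (x n - x k) (x n - x k)) < e) ->
    exists l, (fun n => complex.Re (ip (x n - l) (x n - l))) @ \oo --> (0 : R)
}.

#[short(type="hilbertType")]
HB.structure Definition Hilbert (R : realType) :=
  { H of isHilbert R H & GRing.Lmodule R[i] H }.

Section HilbertBasics.
Context {R : realType} {H : hilbertType R}.
Implicit Types (u v w : H) (a : R[i]) (r : R).
Local Notation normc := (@Normc.normc R).
Local Notation Re := complex.Re.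
Local Notation Im := complex.Im.

Lemma ipDr u v w : ip u (v + w) = ip u v + ip u w.
Proof. by rewrite ipC ipDl conjcD -!(ipC u). Qed.

Lemma ipZr a u v : ip u (a *: v) = conjc a * ip u v.
Proof. by rewrite ipC ipZl conjcM -(ipC u). Qed.

Lemma ip0l u : ip 0 u = 0. Proof. by rewrite -(scale0r 0) ipZl mul0r. Qed.

Lemma ip0r u : ip u 0 = 0. Proof. by rewrite ipC ip0l conjc0. Qed.

Lemma ipNl u v : ip (- u) v = - ip u v.
Proof. by rewrite -scaleN1r ipZl mulN1r. Qed.

Lemma ipNr u v : ip u (- v) = - ip u v.
Proof. by rewrite ipC ipNl conjcN -ipC. Qed.

Lemma ipBl u v w : ip (u - v) w = ip u w - ip v w.
Proof. by rewrite ipDl ipNl. Qed.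

Lemma ipBr u v w : ip u (v - w) = ip u v - ip u w.
Proof. by rewrite ipDr ipNr. Qed.

Lemma Im_ip u : Im (ip u u) = 0.
Proof.
have : Im (ip u u) = - Im (ip u u) by rewrite {1}ipC Im_conjc.
lra.
Qed.

Definition hn u : R := Num.sqrt (Re (ip u u)).

Lemma hn_ge0 u : 0 <= hn u. Proof. exact: sqrtr_ge0. Qed.

Lemma sqr_hn u : hn u ^+ 2 = Re (ip u u).
Proof. by rewrite sqr_sqrtr// Re_ip_ge0. Qed.

Lemma ip_hn u : ip u u = (hn u ^+ 2)%:C%C.
Proof. by apply: complexP; rewrite ?Im_ip//= sqr_hn. Qed.

Lemma hn0 : hn (0 : H) = 0. Proof. by rewrite /hn ip0l sqrtr0. Qed.

Lemma hn_eq0 u : hn u = 0 -> u = 0.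
Proof.
move=> u0; apply: Re_ip_eq0; apply/eqP.
by rewrite -sqr_hn u0 expr0n.
Qed.

Lemma hnZ a u : hn (a *: u) = normc a * hn u.
Proof.
rewrite /hn ipZl ipZr mulrA mul_conjc ip_hn -rmorphM/=.
by rewrite sqrtrM ?sqr_ge0// !sqrtr_sqr !ger0_norm ?normc_ge0 ?hn_ge0.
Qed.

Lemma hnN u : hn (- u) = hn u. Proof. by rewrite /hn ipNl ipNr opprK. Qed.

Lemma hnBC u v : hn (u - v) = hn (v - u). Proof. by rewrite -hnN opprB. Qed.

Definition symop (T : H -> H) := forall u v, ip (T u) v = ip u (T v).

Definition posop (T : H -> H) := forall u, 0 <= Re (ip (T u) u).

Definition bop (T : H -> H) := exists2 c, 0 <= c & forall u, hn (T u) <= c * hn u.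

(** Evaluate at t = 1/q. For q = 0 the expression is affine in t, and its staying nonnegative forces
    s = 0. The factor [s] shared by the last two terms is the shape met below, where [s] is the
    squared modulus of a scalar product. *)
Lemma quadratic_ge0 (p q s : R) : 0 <= q -> 0 <= s ->
  (forall t, 0 <= p - 2 * t * s + t ^+ 2 * s * q) -> s <= p * q.
Proof.
move=> q0 s0 h; have [q1|q1] := eqVneq q 0.
  have := h 0; have := h ((p + 1) / (2 * s)); rewrite q1.
  have [->|s1] := eqVneq s 0; first by rewrite !mulr0; lra.
  have -> : 2 * ((p + 1) / (2 * s)) * s = p + 1 by field.
  by rewrite !mulr0; lra.
have := h q^-1; have -> : q^-1 ^+ 2 * s * q = s / q by field.
have -> : p - 2 / q * s + s / q = (p * q - s) / q by field.
rewrite pmulr_lge0 ?subr_ge0// invr_gt0; lra.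
Qed.

(* Positivity on [u - t <Tu,v> v] for every real [t]. *)
Lemma posop_CS (T : {linear H -> H}) u v : symop T -> posop T ->
  normc (ip (T u) v) ^+ 2 <= Re (ip (T u) u) * Re (ip (T v) v).
Proof.
move=> Ts Tp; apply: quadratic_ge0 => [//||t]; first exact: sqr_ge0.
have := Tp (u - (t%:C%C * ip (T u) v) *: v).
rewrite linearB linearZ ipBl !ipBr !ipZl !ipZr conjcM conjc_real.
rewrite (Ts v u) (ipC v (T u)).
have -> (a c d : R[i]) : a - t%:C%C * conjc c * c - (t%:C%C * c * conjc c -
   t%:C%C * c * (t%:C%C * conjc c * d)) =
   a - t%:C%C *+ 2 * (c * conjc c) + t%:C%C ^+ 2 * (c * conjc c) * d by ring.
rewrite mul_conjc ReD ReB.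
have -> (x y : R) (d : R[i]) : Re (x%:C%C ^+ 2 * y%:C%C * d) = x ^+ 2 * y * Re d.
  by rewrite -rmorphXn -rmorphM ReM/= mul0r subr0.
have -> (x y : R) : Re (x%:C%C *+ 2 * y%:C%C) = 2 * x * y.
  by rewrite -rmorphMn -rmorphM/= mulr2n; ring.
by [].
Qed.

Lemma CS u v : normc (ip u v) <= hn u * hn v.
Proof.
rewrite -ler_sqr ?nnegrE ?mulr_ge0 ?normc_ge0 ?hn_ge0//.
rewrite exprMn !sqr_hn.
exact: (@posop_CS idfun u v (fun _ _ => erefl) (@Re_ip_ge0 _ _)).
Qed.

Lemma Re_CS u v : Re (ip u v) <= hn u * hn v.
Proof. by rewrite (le_trans (ler_norm _))// (le_trans (Re_le_normc _))// CS. Qed.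

Lemma Re_ipC u v : Re (ip u v) = Re (ip v u).
Proof. by rewrite ipC Re_conjc. Qed.

Lemma sqr_hnD u v : hn (u + v) ^+ 2 = hn u ^+ 2 + 2 * Re (ip u v) + hn v ^+ 2.
Proof.
by rewrite !sqr_hn ipDl !ipDr !ReD (Re_ipC v u); ring.
Qed.

Lemma sqr_hnB u v : hn (u - v) ^+ 2 = hn u ^+ 2 - 2 * Re (ip u v) + hn v ^+ 2.
Proof. by rewrite sqr_hnD ipNr ReN hnN mulrN. Qed.

Lemma hnD u v : hn (u + v) <= hn u + hn v.
Proof.
rewrite -ler_sqr ?nnegrE ?addr_ge0 ?hn_ge0// sqr_hnD.
by have := Re_CS u v; nra.
Qed.

Lemma hnB u v : hn (u - v) <= hn u + hn v.
Proof. by rewrite (le_trans (hnD _ _))// hnN. Qed.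

Lemma hn_dist u v w : hn (u - w) <= hn (u - v) + hn (v - w).
Proof. by rewrite (le_trans _ (hnD _ _))// addrA subrK. Qed.

Lemma eq_ip u v : (forall w, ip u w = ip v w) -> u = v.
Proof.
move=> uv; apply/subr0_eq/hn_eq0/eqP.
by rewrite -sqrf_eq0 sqr_hn ipBl uv subrr.
Qed.

Definition hlim (x : nat -> H) l := (fun n => hn (x n - l)) @ \oo --> (0 : R).

Lemma hlim_squeeze (x : nat -> H) l (e : nat -> R) :
  (forall n, hn (x n - l) <= e n) -> e @ \oo --> 0 -> hlim x l.
Proof.
move=> xe e0; apply: (squeeze_cvgr _ (cvg_cst 0) e0).
by near=> n; rewrite hn_ge0 xe.
Unshelve. all: end_near. Qed.

Lemma hlim_cst u : hlim (fun=> u) u.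
Proof. by rewrite /hlim subrr hn0; exact: cvg_cst. Qed.

Lemma hlimD x y l k : hlim x l -> hlim y k -> hlim (fun n => x n + y n) (l + k).
Proof.
move=> xl yk; apply: (@hlim_squeeze _ _ (fun n => hn (x n - l) + hn (y n - k))).
  by move=> n; rewrite (le_trans _ (hnD _ _))// opprD addrACA.
by rewrite -[X in _ --> X]addr0; exact: cvgD.
Qed.

Lemma hlim_op (T : {linear H -> H}) x l : bop T -> hlim x l ->
  hlim (fun n => T (x n)) (T l).
Proof.
move=> [c c0 Tc] xl; apply: (@hlim_squeeze _ _ (fun n => c * hn (x n - l))).
  by move=> n; rewrite -linearB.
by rewrite -[X in _ --> X](mulr0 c); apply: cvgM => //; exact: cvg_cst.
Qed.

Lemma hlimZ a x l : hlim x l -> hlim (fun n => a *: x n) (a *: l).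
Proof.
move=> xl; apply: (@hlim_squeeze _ _ (fun n => normc a * hn (x n - l))).
  by move=> n; rewrite -scalerBr hnZ.
by rewrite -[X in _ --> X](mulr0 (normc a)); apply: cvgM => //; exact: cvg_cst.
Qed.

Lemma hlimB x y l k : hlim x l -> hlim y k -> hlim (fun n => x n - y n) (l - k).
Proof.
move=> xl yk; rewrite -scaleN1r.
by under eq_fun do rewrite -scaleN1r; exact/hlimD/hlimZ.
Qed.

Lemma hlim_hn x l : hlim x l -> (fun n => hn (x n)) @ \oo --> hn l.
Proof.
move=> xl; apply/subr_cvg0; apply: norm_cvg0.
apply: (squeeze_cvgr _ (cvg_cst 0) xl); near=> n; rewrite normr_ge0/=.
rewrite ler_norml; apply/andP; split.
  by rewrite lerNl opprB lerBlDr hnBC (le_trans _ (hnD _ _))// subrK.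
by rewrite lerBlDr (le_trans _ (hnD _ _))// subrK.
Unshelve. all: end_near. Qed.

Lemma hlim_uniq x l k : hlim x l -> hlim x k -> l = k.
Proof.
move=> xl xk; apply/subr0_eq/hn_eq0.
have := hlim_hn (hlimB xl xk); under eq_fun do rewrite subrr hn0.
by move=> h; apply: (norm_cvg_unique h); exact: cvg_cst.
Qed.

(** Polarization reduces the claim to the convergence of norms. *)
Lemma hlim_Re_ip x y l k : hlim x l -> hlim y k ->
  (fun n => Re (ip (x n) (y n))) @ \oo --> Re (ip l k).
Proof.
move=> xl yk.
have Re4 u v : Re (ip u v) = (hn (u + v) ^+ 2 - hn (u - v) ^+ 2) / 4.
  by rewrite sqr_hnD sqr_hnB; field.
rewrite Re4; under eq_fun do rewrite Re4.
apply: cvgM; last exact: cvg_cst.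
apply: cvgB; under eq_fun do rewrite expr2; rewrite expr2.
  by apply: cvgM; apply: hlim_hn; exact: hlimD.
by apply: cvgM; apply: hlim_hn; exact: hlimB.
Qed.

Lemma hlim_Im_ip x y l k : hlim x l -> hlim y k ->
  (fun n => Im (ip (x n) (y n))) @ \oo --> Im (ip l k).
Proof.
move=> xl yk; have ImRe u v : Im (ip u v) = Re (ip u ('i%C *: v)).
  by rewrite ipZr ReM/=; ring.
rewrite ImRe; under eq_fun do rewrite ImRe.
by apply: hlim_Re_ip => //; exact: hlimZ.
Qed.

Definition hcauchy (x : nat -> H) := forall e : R, 0 < e -> exists N,
  forall n k, (N <= n)%N -> (N <= k)%N -> hn (x n - x k) < e.

Lemma hcauchy_lim x : hcauchy x -> exists l, hlim x l.
Proof.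
move=> xc; have [|l xl] := @hilbert_complete _ H x.
  move=> e e0; have [|N xN] := xc (Num.sqrt e); first by rewrite sqrtr_gt0.
  exists N => n k Nn Nk; have := xN _ _ Nn Nk.
  by rewrite /hn ltr_sqrt.
exists l; rewrite /hlim /hn -sqrtr0.
by apply: cvg_comp xl _; exact: sqrt_continuous.
Qed.

End HilbertBasics.

(** * Orthogonal projection and the uniform boundedness principle *)

Section Projection.
Context {R : realType} {H : hilbertType R}.
Implicit Types (u v w : H) (a : R[i]).
Local Notation normc := (@Normc.normc R).
Local Notation Re := complex.Re.
Local Notation Im := complex.Im.

Lemma exists_invS_lt (e : R) : 0 < e -> exists N, forall n, (N <= n)%N ->
  n.+1%:R^-1 < e.
Proof.
move=> e0; have [N Ne] := ltr_add_invr e0; exists N => n Nn.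
rewrite add0r in Ne; apply: le_lt_trans Ne.
by rewrite lef_pV2 ?posrE// ler_nat.
Qed.

Lemma parallelogram u v :
  hn (u - v) ^+ 2 + hn (u + v) ^+ 2 = 2 * hn u ^+ 2 + 2 * hn v ^+ 2.
Proof. by rewrite sqr_hnB sqr_hnD; ring. Qed.

Lemma orthogonal_projection (M : set H) : M 0 ->
  (forall a u v, M u -> M v -> M (u + a *: v)) ->
  (forall x l, (forall n, M (x n)) -> hlim x l -> M l) ->
  forall u, exists2 m, M m & forall k, M k -> ip (u - m) k = 0.
Proof.
move=> M0 ML Mcl u; pose S := [set hn (u - m) ^+ 2 | m in M].
have S_inf : has_inf S.
  split; first by exists (hn (u - 0) ^+ 2), 0.
  by exists 0 => _ [m _ <-]; rewrite sqr_ge0.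
have dS m : M m -> inf S <= hn (u - m) ^+ 2.
  by move=> Mm; apply: ge_inf; [case: S_inf|exists m].
have /choice[m Mm] n : exists m, M m /\ hn (u - m) ^+ 2 < inf S + n.+1%:R^-1.
  have [|_ [m Mm <-] md] := @inf_adherent _ S n.+1%:R^-1 _ S_inf.
    by rewrite invr_gt0.
  by exists m.
have [l ml] : exists l, hlim m l.
  apply: hcauchy_lim => e e0.
  (* The parallelogram law bounds |m n - m k|^2 by twice the sum of the two excesses over the
     infimum, hence e^2/4 for each. *)
  have [|N Ne] := @exists_invS_lt (e ^+ 2 / 4); first by rewrite divr_gt0// exprn_gt0.
  exists N => n k /Ne ne /Ne ke.
  rewrite -ltr_sqr ?nnegrE ?hn_ge0 ?(ltW e0)//.
  have := parallelogram (u - m k) (u - m n).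
  have -> : u - m k - (u - m n) = m n - m k by rewrite opprB addrC addrA subrK.
  have -> : u - m k + (u - m n) = 2%:R%:C%C *: (u - 2^-1%:C%C *: (m k + m n)).
    rewrite scalerBr scalerA -rmorphM/= mulfV ?pnatr_eq0//.
    by rewrite rmorph_nat rmorph1 scale1r scaler_nat mulr2n opprD addrACA.
  rewrite hnZ normcR ger0_norm// exprMn.
  have /dS : M (2^-1%:C%C *: (m k + m n)).
    rewrite -[_ *: _]add0r; apply: (ML) => //; rewrite -[m n]scale1r.
    by apply: ML; have [] := Mm k; have [] := Mm n.
  have [_] := Mm k; have [_] := Mm n; move: ne ke.
  by move: (n.+1%:R^-1) (k.+1%:R^-1) => p q; lra.
have Ml : M l by apply: Mcl ml => n; have [] := Mm n.
have ld : hn (u - l) ^+ 2 <= inf S.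
  have ul : (fun n => hn (u - m n) ^+ 2) @ \oo --> hn (u - l) ^+ 2.
    under eq_fun do rewrite expr2; rewrite expr2.
    by apply: cvgM; apply: hlim_hn; apply: hlimB ml; exact: hlim_cst.
  have dl : (fun n => inf S + n.+1%:R^-1) @ \oo --> inf S.
    by rewrite -[X in _ --> X]addr0; apply: cvgD; [exact: cvg_cst|exact: cvg_harmonic].
  apply: ler_cvg_to ul dl _; near=> n; have [_ /ltW//] := Mm n.
exists l => // k Mk; apply/eqP; rewrite -normc_eq0 -sqrf_eq0 eq_le sqr_ge0 andbT.
rewrite -[leRHS](mul0r (hn k ^+ 2)).
apply: quadratic_ge0 => [//||t]; rewrite ?sqr_ge0//.
have /dS/(le_trans ld) : M (l + (t%:C%C * ip (u - l) k) *: k) by exact: ML.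
rewrite opprD addrA [leRHS]sqr_hnB hnZ Normc.normcM normcR exprMn.
rewrite ipZr conjcM conjc_real -mulrA [X in t%:C%C * X]mulrC mul_conjc -rmorphM/=.
by rewrite exprMn real_normK ?num_real//; lra.
Unshelve. all: end_near. Qed.

(** Linear growth is enough to make the humps below unbounded: each step adds (4/3)^n / 3, which is
    at least 1/3. *)
Lemma lt_exp4_3 (n : nat) : n%:R / 3 < (4 / 3) ^+ n :> R.
Proof.
elim: n => [|n ih]; first by rewrite expr0 mul0r.
have h : 1 <= (4 / 3) ^+ n :> R by rewrite exprn_ege1//; lra.
by rewrite exprS -natr1; lra.
Qed.

(* Sokal's gliding hump: the partial sums of [sum_n +/- 3^-n h_n/|h_n|], with
   signs such that [h_n] is large on the [n]-th one and [|h_n| >= 4^n]. *)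
Lemma uniform_boundedness (F : set H) :
  (forall u, exists M : R, forall h, F h -> normc (ip u h) <= M) ->
  exists2 C : R, 0 <= C & forall h, F h -> hn h <= C.
Proof.
move=> FB; apply: contrapT => noC.
have /choice[h hP] (n : nat) : exists h, F h /\ 4 ^+ n < hn h.
  apply: contrapT => nh; apply: noC; exists (4 ^+ n); first exact: exprn_ge0.
  by move=> h Fh; rewrite leNgt; apply/negP => hh; apply: nh; exists h.
have h0 n : 0 < hn (h n) by case: (hP n) => _; apply: lt_trans; exact: exprn_gt0.
pose t n := 3 ^- n / hn (h n).
have t0 n : 0 < t n by rewrite divr_gt0// invr_gt0 exprn_gt0.
pose step n x := if 3 ^- n * hn (h n) <= normc (ip (x + (t n)%:C%C *: h n) (h n))
  then x + (t n)%:C%C *: h n else x - (t n)%:C%C *: h n.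
pose x := fix x n := if n is k.+1 then step k (x k) else 0.
have tn n : normc (ip ((t n)%:C%C *: h n) (h n)) = 3 ^- n * hn (h n).
  rewrite ipZl ip_hn Normc.normcM !normcR !ger0_norm ?sqr_ge0//; last exact: ltW.
  by rewrite /t; field; rewrite expf_neq0//= gt_eqF.
(* The two candidates for [x n.+1] differ by 2 t_n h_n, whose product with h_n has modulus 2 * 3^-n
   |h_n|; they cannot both fall below half of that. *)
have xlarge n : 3 ^- n * hn (h n) <= normc (ip (x n.+1) (h n)).
  rewrite /= /step; case: ifPn => //; rewrite -ltNge ipBl ipDl => xn.
  have := normc_triangleB (ip (x n) (h n) + ip ((t n)%:C%C *: h n) (h n))
    (ip (x n) (h n) - ip ((t n)%:C%C *: h n) (h n)).
  have -> (a b : R[i]) : a + b - (a - b) = 2%:R%:C%C * b by rewrite rmorph_nat; ring.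
  rewrite Normc.normcM normcR ger0_norm// tn; lra.
have xstep n : hn (x n.+1 - x n) = 3 ^- n.
  have tnn : hn ((t n)%:C%C *: h n) = 3 ^- n.
    by rewrite hnZ normcR gtr0_norm// /t mulfVK// gt_eqF.
  rewrite /= /step; case: ifPn => _.
    by rewrite addrAC subrr add0r.
  by rewrite addrAC subrr add0r hnN.
(* The right-hand side is the exact geometric sum of the steps n, ..., n + j - 1. *)
have xdist n j : hn (x (n + j)%N - x n) <= 3 / 2 * (3 ^- n - 3 ^- (n + j)).
  elim: j => [|j ih]; first by rewrite addn0 !subrr hn0 mulr0.
  rewrite addnS; apply: le_trans (hn_dist _ (x (n + j)%N) _) _.
  rewrite xstep (_ : 3 ^- (n + j).+1 = 3 ^- (n + j) / 3); first by lra.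
  by rewrite exprS invfM mulrC.
have xdist1 n k : (n <= k)%N -> hn (x k - x n) <= 3 / 2 * 3 ^- n.
  move=> /subnKC <-; apply: le_trans (xdist _ _) _.
  by have : 0 <= 3 ^- (n + (k - n)) :> R; [rewrite invr_ge0 exprn_ge0|lra].
have [l xl] : exists l, hlim x l.
  apply: hcauchy_lim => e e0.
  have : (fun n => 3 ^- n) @ \oo --> (0:R).
    under eq_fun do rewrite -exprVn.
    apply: cvg_expr; rewrite ger0_norm; lra.
  move=> /cvgrPdist_lt/(_ (e / 3)); rewrite divr_gt0// => /(_ isT)[N _ Ne].
  exists N => n k Nn Nk; have := Ne N (leqnn N).
  rewrite /= sub0r normrN ger0_norm ?invr_ge0 ?exprn_ge0// => {}Ne.
  rewrite (le_lt_trans (hn_dist _ (x N) _))// (hnBC _ (x k)).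
  have := xdist1 _ _ Nn; have := xdist1 _ _ Nk; lra.
(* All later steps together move by at most (3/2) 3^-(n+1) = (1/2) 3^-n, so half of the value
   reached at step n survives in the limit, and |h_n| >= 4^n. *)
have llarge n : 2^-1 * (4 / 3) ^+ n <= normc (ip l (h n)).
  have lx : hn (x n.+1 - l) <= 3 / 2 * 3 ^- n.+1.
    have cv : (fun k => hn (x n.+1 - x k)) @ \oo --> hn (x n.+1 - l).
      by apply: hlim_hn; apply: hlimB xl; exact: hlim_cst.
    apply: ler_cvg_to cv (cvg_cst _) _.
    by exists n.+1 => // k nk; rewrite /= hnBC; exact: (xdist1 n.+1).
  have := CS (x n.+1 - l) (h n); rewrite ipBl => lxh.
  have := normc_triangle (ip (x n.+1) (h n) - ip l (h n)) (ip l (h n)).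
  rewrite subrK => tri; have xln := xlarge n.
  have E3 : 3 ^- n.+1 = 3 ^- n / 3 :> R by rewrite exprS invfM mulrC.
  have : 4 ^+ n / 3 ^+ n <= 3 ^- n * hn (h n).
    rewrite mulrC ler_pM2l ?invr_gt0 ?exprn_gt0// ltW//.
    by case: (hP n).
  rewrite exprMn exprVn => h43.
  have : hn (x n.+1 - l) * hn (h n) <= 2^-1 * (3 ^- n * hn (h n)).
    rewrite mulrA ler_wpM2r ?hn_ge0//; lra.
  lra.
have [M lM] := FB l.
(* By [lt_exp4_3], this N makes (1/2) (4/3)^N exceed N/6 > |M|. *)
have [N NM] : exists N : nat, 6 * `|M| < N%:R.
  by exists (Num.truncn (6 * `|M|)).+1; rewrite truncnS_gt.
have := lM _ (hP N).1; have := llarge N; have := lt_exp4_3 N.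
have := ler_norm M; lra.
Qed.

End Projection.

(** * Square roots of positive operators *)

Section SquareRoot.
Context {R : realType} {H : hilbertType R}.
Implicit Types (u v w : H) (a : R[i]).
Local Notation normc := (@Normc.normc R).
Local Notation Re := complex.Re.
Local Notation Im := complex.Im.

Definition mklin (f : H -> H) (lf : linear f) : {linear H -> H} :=
  HB.pack f (GRing.isLinear.Build _ _ _ _ f lf).

(** Cauchy-Schwarz for the form <T u, v> at v = T u gives |T u|^4 <= <T u, u> <T T u, T u>, and the
    last factor is at most |T u|^2. *)
Lemma posop_contraction (T : {linear H -> H}) : symop T -> posop T ->
  (forall u, Re (ip (T u) u) <= hn u ^+ 2) ->
  forall u, hn (T u) ^+ 2 <= Re (ip (T u) u).
Proof.
move=> Ts Tp T1 u; have := posop_CS u (T u) Ts Tp.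
rewrite ip_hn normcR ger0_norm ?sqr_ge0// => h.
have {}h := le_trans h (ler_wpM2l (Tp u) (T1 (T u))).
have := sqr_ge0 (hn (T u)); rewrite le_eqVlt => /predU1P[<-//|n0].
by rewrite expr2 ler_pM2r in h.
Qed.

Lemma hn_contraction (T : {linear H -> H}) : symop T -> posop T ->
  (forall u, Re (ip (T u) u) <= hn u ^+ 2) -> forall u, hn (T u) <= hn u.
Proof.
move=> Ts Tp T1 u; rewrite -ler_sqr ?nnegrE ?hn_ge0//.
exact: le_trans (posop_contraction Ts Tp T1 u) (T1 u).
Qed.

(** The polynomials in [X] with nonnegative real coefficients. The root iterates and their
    differences belong to this class, where positivity follows from that of the powers of [X]; no
    general result on products of commuting positive operators is called for. *)
Inductive nonneg_poly (X : H -> H) : (H -> H) -> Prop :=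
| nonneg_poly_iter n : nonneg_poly X (iter n X)
| nonneg_polyD P Q : nonneg_poly X P -> nonneg_poly X Q ->
    nonneg_poly X (fun u => P u + Q u)
| nonneg_polyZ (r : R) P : 0 <= r -> nonneg_poly X P ->
    nonneg_poly X (fun u => r%:C%C *: P u).

Lemma nonneg_poly_linear (X : {linear H -> H}) P : nonneg_poly X P -> linear P.
Proof.
elim=> {P} [n|P Q _ Pl _ Ql|r P _ _ Pl] a u v.
- by elim: n => //= n ->; rewrite linearP.
- by rewrite Pl Ql scalerDr addrACA.
- by rewrite Pl scalerDr !scalerA mulrC.
Qed.

Lemma nonneg_poly_comp (X : {linear H -> H}) P Q :
  nonneg_poly X P -> nonneg_poly X Q -> nonneg_poly X (P \o Q).
Proof.
move=> + XQ; elim=> {P} [n|P P' _ XP _ XP'|r P r0 _ XP].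
- elim: XQ => {Q} [k|Q Q' _ XQ _ XQ'|r Q r0 _ XQ].
  + rewrite (_ : _ \o _ = iter (n + k) X); first exact: nonneg_poly_iter.
    by apply/funext => u; rewrite /= iterD.
  + rewrite (_ : _ \o _ = fun u => (iter n X \o Q) u + (iter n X \o Q') u).
      exact: nonneg_polyD.
    apply/funext => u /=; have Xl := nonneg_poly_linear (nonneg_poly_iter X n).
    exact: (linearD (mklin Xl)).
  + rewrite (_ : _ \o _ = fun u => r%:C%C *: (iter n X \o Q) u).
      exact: nonneg_polyZ.
    apply/funext => u /=; have Xl := nonneg_poly_linear (nonneg_poly_iter X n).
    exact: (linearZZ (mklin Xl)).
- exact: nonneg_polyD XP XP'.
- exact: nonneg_polyZ r0 XP.
Qed.

Lemma nonneg_poly_sym (X : {linear H -> H}) P :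
  symop X -> nonneg_poly X P -> symop P.
Proof.
move=> Xs; elim=> {P} [n|P Q _ Ps _ Qs|r P _ _ Ps] u v.
- by elim: n u v => //= n ih u v; rewrite Xs ih -iterSr.
- by rewrite ipDl ipDr Ps Qs.
- by rewrite ipZl ipZr conjc_real Ps.
Qed.

(** With k = n/2 rounded down, X^n = X^k X^(odd n) X^k; moving one X^k across the scalar product
    leaves <v, v> or <X v, v> at v = X^k u. *)
Lemma nonneg_poly_pos (X : {linear H -> H}) P :
  symop X -> posop X -> nonneg_poly X P -> posop P.
Proof.
move=> Xs Xp; elim=> {P} [n|P Q _ Pp _ Qp|r P r0 _ Pp] u.
- have Xns := nonneg_poly_sym Xs (nonneg_poly_iter X n./2).
  have nE : n = (n./2 + (odd n + n./2))%N.
    by rewrite addnCA addnn odd_double_half.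
  rewrite [in X in iter X]nE iterD Xns iterD.
  by case: (odd n) => /=; [exact: Xp|exact: Re_ip_ge0].
- by rewrite ipDl ReD addr_ge0.
- rewrite ipZl. by rewrite ReM/= mul0r subr0 mulr_ge0.
Qed.

Lemma nonneg_poly_comm (X B : {linear H -> H}) P : (forall u, X (B u) = B (X u)) ->
  nonneg_poly X P -> forall u, P (B u) = B (P u).
Proof.
move=> XB; elim=> {P} [n|P Q _ Pc _ Qc|r P r0 _ Pc] u.
- by elim: n => //= n ->.
- by rewrite linearD Pc Qc.
- by rewrite linearZ Pc.
Qed.

Section UnitRoot.
Variable X : {linear H -> H}.
Hypotheses (X_sym : symop X) (X_pos : posop X)
  (X_le1 : forall u, Re (ip (X u) u) <= hn u ^+ 2).

(* Iteration for [1 - sqrt (1 - X)]. *)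
Fixpoint root_iter n u : H :=
  if n is k.+1 then 2^-1%:C%C *: (X u + root_iter k (root_iter k u)) else 0.

Lemma root_iterS n u :
  root_iter n.+1 u = 2^-1%:C%C *: (X u + root_iter n (root_iter n u)).
Proof. by []. Qed.

Let half_ge0 : 0 <= 2^-1 :> R. Proof. by rewrite invr_ge0. Qed.

Let nonneg_poly_X : nonneg_poly X X.
Proof. exact: (nonneg_poly_iter X 1). Qed.

Lemma root_iter_nonneg n : nonneg_poly X (root_iter n).
Proof.
elim: n => [|n ih].
  rewrite (_ : root_iter 0 = fun u => 0%:C%C *: iter 0 X u).
    by apply: nonneg_polyZ => //; exact: nonneg_poly_iter.
  by apply/funext => u; rewrite rmorph0 scale0r.
by apply: nonneg_polyZ => //; apply: nonneg_polyD => //; exact: nonneg_poly_comp.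
Qed.

Let Y n : {linear H -> H} := mklin (nonneg_poly_linear (root_iter_nonneg n)).

(** If Y_(n+1) = Y_n + P, the next increment is (P Y_n + Y_n P + P^2) / 2, which again has
    nonnegative coefficients. The iterates are thus increasing as operators. *)
Lemma root_iter_incr n : exists2 P, nonneg_poly X P &
  forall u, root_iter n.+1 u = root_iter n u + P u.
Proof.
elim: n => [|n [P XP PE]].
  exists (fun u => 2^-1%:C%C *: X u); first exact: nonneg_polyZ.
  by move=> u; rewrite /= addr0 add0r.
exists (fun u => 2^-1%:C%C *: ((P \o root_iter n) u +
    ((root_iter n \o P) u + (P \o P) u))).
  apply: nonneg_polyZ => //; have Xn := root_iter_nonneg n.
  apply: nonneg_polyD; first exact: nonneg_poly_comp.
  by apply: nonneg_polyD; exact: nonneg_poly_comp.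
move=> u; rewrite root_iterS [in RHS]root_iterS !PE -scalerDr.
congr (_ *: _); rewrite -[RHS]addrA; congr (_ + _).
have YD v w : root_iter n (v + w) = root_iter n v + root_iter n w.
  exact: (linearD (Y n)).
have PD v w : P (v + w) = P v + P w.
  exact: (linearD (mklin (nonneg_poly_linear XP))).
by rewrite YD PD /= -!addrA; congr (_ + _); rewrite addrCA.
Qed.

Lemma root_iter_le n k : (n <= k)%N -> exists2 P, nonneg_poly X P &
  forall u, root_iter k u - root_iter n u = P u.
Proof.
move=> /subnKC <-; elim: (k - n)%N => [|j [P XP PE]].
  exists (fun u => 0%:C%C *: iter 0 X u).
    by apply: nonneg_polyZ => //; exact: nonneg_poly_iter.
  by move=> u; rewrite addn0 subrr rmorph0 scale0r.
have [Q XQ QE] := root_iter_incr (n + j).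
exists (fun u => Q u + P u); first exact: nonneg_polyD.
by move=> u; rewrite addnS QE -PE addrCA addrA.
Qed.

Lemma root_iter_contraction n u : hn (root_iter n u) <= hn u.
Proof.
elim: n u => [|n ih] u; first by rewrite hn0 hn_ge0.
rewrite hnZ normcR ger0_norm// ler_pdivrMl// mulr_natl mulr2n.
rewrite (le_trans (hnD _ _))// lerD//.
  exact: hn_contraction.
exact: le_trans (ih _) (ih _).
Qed.

Lemma root_iter_Re_le n u : Re (ip (root_iter n u) u) <= hn u ^+ 2.
Proof.
by rewrite (le_trans (Re_CS _ _))// expr2 ler_wpM2r ?hn_ge0// root_iter_contraction.
Qed.

(** The numbers <Y_n u, u> increase and are bounded, hence Cauchy. The difference P of two iterates
    satisfies 0 <= P <= 1, so |P u|^2 <= <P u, u> turns this into strong convergence. *)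
Lemma root_iter_cvg u : exists l, hlim (fun n => root_iter n u) l.
Proof.
pose a n := Re (ip (root_iter n u) u).
have a_dist n k : (n <= k)%N -> hn (root_iter k u - root_iter n u) ^+ 2 <= a k - a n.
  move=> nk; have [P XP PE] := root_iter_le nk.
  pose Pl := mklin (nonneg_poly_linear XP).
  have Ps := nonneg_poly_sym X_sym XP; have Pp := nonneg_poly_pos X_sym X_pos XP.
  have Pc : hn (P u) ^+ 2 <= Re (ip (P u) u).
    apply: (@posop_contraction Pl Ps Pp) => v /=.
    rewrite -PE ipBl ReB; have := root_iter_Re_le k v.
    have := nonneg_poly_pos X_sym X_pos (root_iter_nonneg n) v; lra.
  by rewrite PE (le_trans Pc)// -PE ipBl ReB.
have a_cvg : cvgn a.
  apply: nondecreasing_is_cvgn.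
    by move=> n k /a_dist; have := sqr_ge0 (hn (root_iter k u - root_iter n u)); lra.
  by exists (hn u ^+ 2) => _ [n _ <-]; exact: root_iter_Re_le.
apply: hcauchy_lim => e e0.
have /cvgrPdist_lt/(_ (e ^+ 2 / 2)) := a_cvg.
rewrite divr_gt0 ?exprn_gt0// => /(_ isT)[N _ Ne]; exists N.
have dist n k : (N <= n)%N -> (N <= k)%N -> (n <= k)%N ->
    hn (root_iter k u - root_iter n u) < e.
  move=> /Ne nN /Ne kN /a_dist nk; rewrite -ltr_sqr ?nnegrE ?hn_ge0 ?(ltW e0)//.
  apply: (le_lt_trans nk); move: nN kN => /=; rewrite !ltr_norml; lra.
move=> n k Nn Nk; have [nk|kn] := leqP n k; last by apply: dist => //; exact: ltnW.
by rewrite hnBC dist.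
Qed.

(** The strong limit [L] of the iterates satisfies L = (X + L^2) / 2, that is (1 - L)^2 = 1 - X, so
    Q = 1 - L. Commutation passes to the limit from the polynomials in [X]. *)
Lemma unit_sqrt : exists Q : {linear H -> H},
  [/\ symop Q, posop Q, forall u, hn (Q u) <= 2 * hn u, forall u, Q (Q u) = u - X u
    & forall B : {linear H -> H}, bop B -> (forall u, X (B u) = B (X u)) ->
      forall u, Q (B u) = B (Q u)].
Proof.
have /choice[L LP] := root_iter_cvg.
have LL : linear L.
  move=> a u v; apply: hlim_uniq (LP _) _.
  rewrite (_ : (fun n => _) = fun n => a *: root_iter n u + root_iter n v).
    by apply: hlimD => //; exact: hlimZ.
  by apply/funext => n; exact: (linearP (Y n)).
have L_lin : linear (fun u => u - L u).
  by move=> a u v; rewrite LL scalerBr opprD addrACA.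
have L_sym : symop L.
  move=> u v; have E : (fun n => ip (root_iter n u) v) = (fun n => ip u (root_iter n v)).
    by apply/funext => n; exact: (nonneg_poly_sym X_sym (root_iter_nonneg n)).
  apply: complexP.
    apply: (norm_cvg_unique (hlim_Re_ip (LP u) (hlim_cst v))) => /=.
    by under eq_fun do rewrite (congr1 (@^~ _) E); exact: hlim_Re_ip (hlim_cst u) (LP v).
  apply: (norm_cvg_unique (hlim_Im_ip (LP u) (hlim_cst v))) => /=.
  by under eq_fun do rewrite (congr1 (@^~ _) E); exact: hlim_Im_ip (hlim_cst u) (LP v).
have L_contr u : hn (L u) <= hn u.
  apply: ler_cvg_to (hlim_hn (LP u)) (cvg_cst _) _.
  by near=> n; exact: root_iter_contraction.
have L_fix u : L u = 2^-1%:C%C *: (X u + L (L u)).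
  have := LP u; rewrite /hlim -(cvg_shiftS _) -/(hlim (fun n => root_iter n.+1 u) _).
  move=> /hlim_uniq; apply; apply: hlimZ; apply: hlimD; first exact: hlim_cst.
  apply: (@hlim_squeeze _ _ _ _ (fun n => hn (root_iter n u - L u) +
                                          hn (root_iter n (L u) - L (L u)))).
    move=> n; rewrite (le_trans (hn_dist _ (root_iter n (L u)) _))// lerD2r.
    by rewrite -(linearB (Y n)) root_iter_contraction.
  rewrite -[X in _ --> X]addr0; apply: cvgD; exact: LP.
exists (mklin L_lin); split => /=.
- by move=> u v; rewrite ipBl ipBr L_sym.
- move=> u; rewrite ipBl ReB -sqr_hn subr_ge0 (le_trans (Re_CS _ _))//.
  by rewrite expr2 ler_wpM2r ?hn_ge0.
- by move=> u; rewrite mulr_natl mulr2n (le_trans (hnB _ _))// lerD2l.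
- move=> u; have LB v w : L (v - w) = L v - L w by exact: (linearB (mklin LL)).
  rewrite LB; have /(congr1 (fun x => 2%:R%:C%C *: x)) := L_fix u.
  rewrite scalerA -rmorphM/= mulfV ?pnatr_eq0// rmorph1 scale1r rmorph_nat.
  rewrite scaler_nat mulr2n => E; have -> : L (L u) = L u + L u - X u.
    by rewrite E addrC addKr.
  by rewrite opprB (addrAC (L u + L u)) addrK -addrA addKr.
- move=> B Bb XB u; rewrite linearB; congr (_ - _).
  apply: hlim_uniq (LP _) _.
  under eq_fun do rewrite (nonneg_poly_comm XB (root_iter_nonneg _)).
  exact: hlim_op.
Unshelve. all: end_near. Qed.

End UnitRoot.

(** Rescaling: X = 1 - T/M lies between 0 and 1, and sqrt(M) times the square root of 1 - X is the
    root of [T]. *)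
Lemma sqrt_operator (T : {linear H -> H}) (M : R) : 0 < M -> symop T -> posop T ->
  (forall u, Re (ip (T u) u) <= M * hn u ^+ 2) ->
  exists Q : {linear H -> H}, [/\ symop Q, posop Q, bop Q, forall u, Q (Q u) = T u
    & forall B : {linear H -> H}, bop B -> (forall u, T (B u) = B (T u)) ->
      forall u, Q (B u) = B (Q u)].
Proof.
move=> M0 Ts Tp TM.
have X_lin : linear (fun u => u - M^-1%:C%C *: T u).
  move=> a u v; rewrite linearP scalerDr opprD addrACA; congr (_ + _).
  by rewrite scalerBr !scalerA mulrC.
have TX u v : ip (u - M^-1%:C%C *: T u) v = ip u v - M^-1%:C%C * ip (T u) v.
  by rewrite ipBl ipZl.
have [|||Q [Qs Qp Qb QQ Qc]] := @unit_sqrt (mklin X_lin).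
- by move=> u v; rewrite /= TX ipBr ipZr conjc_real Ts.
- move=> u; rewrite /= TX ReB ReM/= mul0r subr0 -sqr_hn subr_ge0.
  by rewrite ler_pdivrMl.
- move=> u; rewrite /= TX ReB ReM/= mul0r subr0 -sqr_hn gerBl.
  by rewrite mulr_ge0 ?invr_ge0 ?(ltW M0).
have Q_lin : linear (fun u => (Num.sqrt M)%:C%C *: Q u).
  by move=> a u v; rewrite linearP scalerDr !scalerA mulrC.
exists (mklin Q_lin); split => /=.
- by move=> u v; rewrite ipZl ipZr conjc_real Qs.
- by move=> u; rewrite ipZl ReM/= mul0r subr0 mulr_ge0 ?sqrtr_ge0.
- exists (Num.sqrt M * 2); first by rewrite mulr_ge0 ?sqrtr_ge0.
  by move=> u; rewrite hnZ normcR ger0_norm ?sqrtr_ge0// -mulrA ler_wpM2l ?sqrtr_ge0.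
- move=> u; rewrite linearZ scalerA QQ /= opprB addrC subrK scalerA.
  by rewrite -!rmorphM/= -expr2 sqr_sqrtr ?(ltW M0)// mulfV ?gt_eqF// scale1r.
- move=> B Bb TB u; rewrite Qc ?linearZ// => v /=.
  by rewrite TB (linearB B) (linearZZ B).
Qed.

End SquareRoot.

(** * Self-adjoint operators, given by their graphs, and their resolvents *)

Section Resolvents.
Context {R : realType} {H : hilbertType R}.
Implicit Types (u v f g : H) (a w : R[i]).
Local Notation normc := (@Normc.normc R).
Local Notation Re := complex.Re.
Local Notation Im := complex.Im.

Lemma hlim_cauchy (x : nat -> H) l : hlim x l -> hcauchy x.
Proof.
move=> /cvgrPdist_lt xl e e0; have [|N _ Ne] := xl (e / 2); first exact: divr_gt0.
exists N => n k /Ne /= + /Ne /=; rewrite !sub0r !normrN !ger0_norm ?hn_ge0// => ne ke.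
by rewrite (le_lt_trans (hn_dist _ l _))// (hnBC l); lra.
Qed.

Lemma bop_comp (S T : H -> H) : bop S -> bop T -> bop (fun u => S (T u)).
Proof.
move=> [c c0 Sc] [d d0 Td]; exists (c * d); first exact: mulr_ge0.
by move=> u; rewrite (le_trans (Sc _))// -mulrA ler_wpM2l.
Qed.

Lemma bopDZ a (T : H -> H) : bop T -> bop (fun u => u + a *: T u).
Proof.
move=> [c c0 Tc]; exists (1 + normc a * c); first by rewrite addr_ge0 ?mulr_ge0 ?normc_ge0.
move=> u; rewrite (le_trans (hnD _ _))// mulrDl mul1r lerD2l hnZ -mulrA.
by rewrite ler_wpM2l ?normc_ge0.
Qed.

Definition form_dom (A : H -> H -> Prop) u := exists x y : nat -> H,
  [/\ forall n, A (x n) (y n), hlim x u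
    & forall e : R, 0 < e -> exists N, forall n k, (N <= n)%N -> (N <= k)%N ->
        normc (ip (y n - y k) (x n - x k)) < e].

Variable A : H -> H -> Prop.
Hypothesis A_lin : forall a f g f' g', A f g -> A f' g' ->
  A (f + a *: f') (g + a *: g').
Hypothesis A_dense : forall u (e : R), 0 < e -> exists f g, A f g /\ hn (u - f) < e.
Hypothesis A_sa : forall u v, A u v <-> forall f g, A f g -> ip g u = ip f v.

Lemma selfadj_sym f g f' g' : A f g -> A f' g' -> ip g f' = ip f g'.
Proof. by move=> Afg /A_sa; exact. Qed.

Lemma selfadj0 : A 0 0. Proof. by apply/A_sa => f g _; rewrite !ip0r. Qed.

Lemma selfadj_Im f g : A f g -> Im (ip g f) = 0.
Proof.
move=> Afg; have := congr1 (fun x : R[i] => Im x) (selfadj_sym Afg Afg).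
by rewrite [in RHS]ipC Im_conjc; lra.
Qed.

Lemma selfadj_closed x y l k : (forall n, A (x n) (y n)) -> hlim x l -> hlim y k ->
  A l k.
Proof.
move=> Axy xl yk; apply/A_sa => f g Afg.
have E : (fun n => ip g (x n)) = (fun n => ip f (y n)).
  by apply/funext => n; exact: selfadj_sym.
apply: complexP.
  apply: (norm_cvg_unique (hlim_Re_ip (hlim_cst g) xl)) => /=.
  by under eq_fun do rewrite (congr1 (@^~ _) E); exact: hlim_Re_ip (hlim_cst f) yk.
apply: (norm_cvg_unique (hlim_Im_ip (hlim_cst g) xl)) => /=.
by under eq_fun do rewrite (congr1 (@^~ _) E); exact: hlim_Im_ip (hlim_cst f) yk.
Qed.

Definition resolvent_of w (T : H -> H) := forall u f, A f (u + w *: f) <-> f = T u.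

(* The range of [A - w] is closed, and its orthogonal complement is the kernel
   of [A - w^*]. *)
Lemma exists_resolvent w (d : R) : 0 < d ->
  (forall f g, A f g -> hn f <= d * hn (g - w *: f)) ->
  (forall f, A f (conjc w *: f) -> f = 0) ->
  exists2 T : {linear H -> H}, bop T & resolvent_of w T.
Proof.
move=> d0 Ad Aker; have inj u f f' : A f (u + w *: f) -> A f' (u + w *: f') -> f = f'.
  move=> Af Af'; have := A_lin (-1) Af Af'; rewrite !scaleN1r => /Ad.
  rewrite scalerBr opprD addrACA subrr add0r subrr hn0 mulr0 => ff'.
  by apply/subr0_eq/hn_eq0/eqP; rewrite eq_le ff' hn_ge0.
pose M : set H := [set v | exists2 f, A f (v + w *: f) & True].
have proj : forall u, exists2 m, M m & forall k, M k -> ip (u - m) k = 0.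
  apply: orthogonal_projection.
  - by exists 0 => //; rewrite scaler0 addr0; exact: selfadj0.
  - move=> a u v [f Af _] [f' Af' _]; exists (f + a *: f') => //.
    have := A_lin a Af Af'; rewrite !scalerDr addrACA; congr (A _ (_ + (_ + _))).
    by rewrite !scalerA mulrC.
  - move=> x l xM xl; have /choice[f fP] n : exists f, A f (x n + w *: f) by have [f] := xM n; exists f.
    have [k fk] : exists k, hlim f k.
      apply: hcauchy_lim => e e0.
      have [|N Ne] := hlim_cauchy xl (e := e / d); first exact: divr_gt0.
      exists N => n j Nn Nj; have := A_lin (-1) (fP n) (fP j); rewrite !scaleN1r.
      move=> /Ad /le_lt_trans; apply; rewrite scalerBr.
      have -> (p q r s : H) : p + q - (r + s) - (q - s) = p - r.
        by rewrite opprD addrACA addrK.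
      by have := Ne n j Nn Nj; rewrite ltr_pdivlMr// mulrC.
    by exists k => //; exact: selfadj_closed fP fk (hlimD xl (hlimZ w fk)).
have /choice[T TP] u : exists f, A f (u + w *: f).
  have [m [f Af _] um] := proj u; exists f; suff -> : u = m by [].
  apply/subr0_eq/Aker/A_sa => f' g' A'; apply/subr0_eq.
  rewrite ipZr conjcK -ipZl -ipBl ipC um ?conjc0//.
  by exists f' => //; rewrite subrK.
have T_lin : linear T.
  move=> a u v; apply: inj (TP _) _.
  rewrite [a *: T u + T v]addrC.
  have -> : a *: u + v + w *: (T v + a *: T u) = v + w *: T v + a *: (u + w *: T u).
    rewrite !scalerDr !scalerA (mulrC w a) [RHS]addrACA; congr (_ + _).
    exact: addrC.
  exact: A_lin (TP v) (TP u).
exists (mklin T_lin).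
  exists d; first exact: ltW.
  by move=> u; have := Ad _ _ (TP u); rewrite addrK.
move=> u f; split => [Af|->]; last exact: TP.
exact: inj Af (TP u).
Qed.

Lemma resolvent_identity w w' (S T : H -> H) : resolvent_of w S -> resolvent_of w' T ->
  forall u, S u = T (u + (w - w') *: S u).
Proof.
move=> Sw Tw u; apply/Tw; have /Sw := erefl (S u).
by rewrite -addrA -scalerDl subrK.
Qed.

(** Read in either order, the resolvent identity shows that both products equal (S u - T u) / (w -
    w'). For w = w' the two resolvents coincide. *)
Lemma resolvent_comm w w' (S T : {linear H -> H}) :
  resolvent_of w S -> resolvent_of w' T -> forall u, S (T u) = T (S u).
Proof.
move=> Sw Tw u; have [E|ww'] := eqVneq w w'.
  have ST v : S v = T v by apply/Tw; rewrite -E; exact/Sw.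
  by rewrite !ST.
have := resolvent_identity Sw Tw u; have := resolvent_identity Tw Sw u.
rewrite (linearD S) (linearD T) (linearZZ S) (linearZZ T).
move: (S (T u)) (T (S u)) => b a h2 h1.
have E1 : (w - w') *: a = S u - T u by rewrite h1 addrAC subrr add0r.
have E2 : (w - w') *: b = S u - T u.
  by rewrite -[w - w']opprB scaleNr [in RHS]h2 opprD addrA subrr add0r.
have : (w - w') *: (a - b) = 0 by rewrite scalerBr E1 E2 subrr.
by move/eqP; rewrite scaler_eq0 subr_eq0 (negbTE ww') /= subr_eq0 => /eqP.
Qed.

Lemma resolvent_adj w (S T : H -> H) :
  resolvent_of w S -> resolvent_of (conjc w) T -> forall u v, ip (S u) v = ip u (T v).
Proof.
move=> Sw Tw u v; have /Sw AS := erefl (S u); have /Tw AT := erefl (T v).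
have := selfadj_sym AS AT; rewrite ipDl ipDr ipZl ipZr conjcK.
by move=> /addIr ->.
Qed.

Variables (c : R) (z : R[i]).
Hypothesis A_semi : forall f g, A f g -> c * hn f ^+ 2 <= Re (ip g f).
Hypothesis z_surj : forall u, exists f, A f (u + z *: f).
Hypothesis z_bound : exists K : R, forall u f, A f (u + z *: f) -> hn f <= K * hn u.

(** If A f = conj(z) f, pair [f] with a solution [g] of (A - z) g = f: symmetry leaves <f, f> = 0.
    The bound at z passes to conj(z) because <g, f> is real on the graph of [A], whence |g - z f| =
    |g - conj(z) f|. *)
Lemma exists_resolvent_z : exists Rz Rz' : {linear H -> H},
  [/\ bop Rz, bop Rz', resolvent_of z Rz & resolvent_of (conjc z) Rz'].
Proof.
(* [K] may be nonpositive, whereas [exists_resolvent] takes a positive constant. *)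
have [K zK] := z_bound; pose d := Num.max K 1.
have d0 : 0 < d by rewrite lt_max ltr01 orbT.
have Ad f g : A f g -> hn f <= d * hn (g - z *: f).
  move=> Afg; have /zK : A f (g - z *: f + z *: f) by rewrite subrK.
  move=> /le_trans; apply; apply: ler_wpM2r; first exact: hn_ge0.
  by rewrite le_max lexx.
have [f|Rz Rzb RzP] := exists_resolvent d0 Ad.
  move=> Af; have [g gP] := z_surj f.
  apply/hn_eq0/eqP; rewrite -sqrf_eq0 -[hn f ^+ 2]/(Re (hn f ^+ 2)%:C%C) -ip_hn.
  have := selfadj_sym gP Af; rewrite ipDl ipZl ipZr conjcK.
  by move=> /(congr1 (fun x => x - z * ip g f)); rewrite addrK subrr => ->.
have Ad' f g : A f g -> hn f <= d * hn (g - conjc z *: f).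
  move=> Afg; suff -> : hn (g - conjc z *: f) = hn (g - z *: f) by exact: Ad.
  apply/eqP; rewrite -(eqrXn2 (n := 2)) ?hn_ge0//; apply/eqP.
  rewrite !sqr_hnB !hnZ normc_conjc !ipZr !ReM (selfadj_Im Afg) !mulr0.
  by rewrite !Re_conjc.
have [f|Rz' Rzb' RzP'] := exists_resolvent d0 Ad'.
  rewrite conjcK -[z *: f]add0r => /zK; rewrite hn0 mulr0 => f0.
  by apply/hn_eq0/eqP; rewrite eq_le f0 hn_ge0.
by exists Rz, Rz'.
Qed.

(* With [P] the resolvent at [l = c - 1], [Q] is the square root of [P], [W] is
   [(A - l) (A - z)^-1], [W'] its adjoint and [S] is [Q |W| Q]. *)
Theorem selfadj_factor : exists (Q W W' S : {linear H -> H}),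
  [/\ [/\ symop Q, bop Q & forall u, form_dom A (Q u)],
      [/\ bop W, bop W' & forall u v, ip (W u) v = ip u (W' v)],
      resolvent_of z (fun u => Q (W (Q u))),
      [/\ bop S, symop S, posop S & forall u, S (S u) = Q (W' (Q (Q (W (Q u)))))]
    & exists2 M : R, 0 <= M & forall u, Re (ip (S u) u) <= M * hn (Q u) ^+ 2].
Proof.
(* One below the lower bound of [A], so that A - l >= 1 and its inverse [P] is a positive
   contraction. *)
pose l : R[i] := (c - 1)%:C%C.
have Al f g : A f g -> hn f ^+ 2 <= Re (ip (g - l *: f) f).
  move=> /A_semi; rewrite ipBl ipZl ip_hn ReB -rmorphM/=; lra.
have hnl f g : A f g -> hn f <= 1 * hn (g - l *: f).
  move=> /Al fl; rewrite mul1r; have := le_trans fl (Re_CS _ _).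
  have := hn_ge0 f; rewrite le_eqVlt => /predU1P[<- _|f0]; first exact: hn_ge0.
  by rewrite expr2 ler_pM2r.
have lJ : conjc l = l by exact: conjc_real.
clearbody l.
have [f|P Pb PP] := exists_resolvent ltr01 hnl.
  rewrite lJ => /hnl; rewrite subrr hn0 mulr0 => f0.
  by apply/hn_eq0/eqP; rewrite eq_le f0 hn_ge0.
have Ps : symop P by apply: (@resolvent_adj l); rewrite ?lJ.
have AP u : A (P u) (u + l *: P u) by exact/PP.
have Pp u : hn (P u) ^+ 2 <= Re (ip (P u) u).
  by have := Al _ _ (AP u); rewrite addrK Re_ipC.
have P1 u : Re (ip (P u) u) <= 1 * hn u ^+ 2.
  rewrite mul1r (le_trans (Re_CS _ _))// expr2 ler_wpM2r ?hn_ge0//.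
  by have := hnl _ _ (AP u); rewrite addrK mul1r.
have [|Q [Qs Qp Qb QQ Qc]] := sqrt_operator ltr01 Ps _ P1.
  by move=> u; rewrite (le_trans _ (Pp u))// sqr_ge0.
have [Rz [Rz' [Rzb Rzb' RzP RzP']]] := exists_resolvent_z.
have QRz u : Q (Rz u) = Rz (Q u) by apply: Qc => //; exact: resolvent_comm PP RzP.
have QRz' u : Q (Rz' u) = Rz' (Q u) by apply: Qc => //; exact: resolvent_comm PP RzP'.
have W_lin : linear (fun u => u + (z - l) *: Rz u).
  by move=> a u v; rewrite linearP !scalerDr !scalerA mulrC addrACA.
have W'_lin : linear (fun u => u + (conjc z - l) *: Rz' u).
  by move=> a u v; rewrite linearP !scalerDr !scalerA mulrC addrACA.
pose W := mklin W_lin; pose W' := mklin W'_lin.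
have Wb : bop W by exact: bopDZ.
have Wb' : bop W' by exact: bopDZ.
have WW' u v : ip (W u) v = ip u (W' v).
  rewrite /W /W' /= ipDl ipDr ipZl ipZr (resolvent_adj RzP RzP').
  by congr (_ + _ * _); rewrite conjcD conjcK conjcN lJ.
have QW u : Q (W u) = W (Q u) by rewrite /W /= (linearD Q) (linearZZ Q) QRz.
have QW' u : Q (W' u) = W' (Q u) by rewrite /W' /= (linearD Q) (linearZZ Q) QRz'.
have RzE u : Rz u = Q (W (Q u)).
  by rewrite -QW QQ; exact: resolvent_identity RzP PP u.
have T_lin : linear (fun u => W' (W u)) by move=> a u v; rewrite !linearP.
have [k k0 Wk] := Wb.
have W'W u v : ip (W' u) v = ip u (W v) by rewrite ipC -WW' -ipC.
have TT u : ip (W' (W u)) u = ip (W u) (W u) by exact: W'W.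
(* [N] is |W|, the root of W' W. The 1 added to k^2 keeps the bound positive when k = 0. *)
have [||||N [Ns Np [M M0 NM] NN Nc]] := @sqrt_operator _ _ (mklin T_lin) (k ^+ 2 + 1).
- by rewrite ltr_wpDl ?sqr_ge0.
- by move=> u v; rewrite /= W'W WW'.
- by move=> u; rewrite /= TT Re_ip_ge0.
- move=> u; rewrite /= TT -sqr_hn mulrDl mul1r (@le_trans _ _ (k ^+ 2 * hn u ^+ 2))//.
    by rewrite -exprMn lerXn2r ?nnegrE ?mulr_ge0 ?hn_ge0.
  by rewrite lerDl sqr_ge0.
have TQ v : W' (W (Q v)) = Q (W' (W v)) by rewrite -QW -QW'.
have {}NN u : N (N u) = W' (W u) := NN u.
have NQ u : N (Q u) = Q (N u) by apply: Nc => // v; exact: TQ.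
have S_lin : linear (fun u => Q (N (Q u))) by move=> a u v; rewrite !linearP.
exists Q, W, W', (mklin S_lin); split.
(* Approximate [u] by v_n = P y_n in the domain of [A]. Then Q v_n = P (Q y_n) lies in that domain
   too, and for a difference v = P y the form takes at Q v the value <Q y, Q v> + l |Q v|^2 = |v|^2
   + l |Q v|^2, which is controlled by |v|^2. *)
- split => // u; have /choice[v vP] n : exists v, exists g, A v g /\ hn (u - v) < n.+1%:R^-1.
    by apply: A_dense; rewrite invr_gt0.
  have {vP}/choice[g vP] n := vP n.
  have vu : hlim v u.
    apply: (@hlim_squeeze _ _ _ _ (fun n => n.+1%:R^-1)); last exact: cvg_harmonic.
    by move=> n; have [_ /ltW] := vP n; rewrite hnBC.
  pose y n := g n - l *: v n.
  have vE n : v n = P (y n) by apply/PP; rewrite subrK; have [] := vP n.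
  exists (fun n => Q (v n)), (fun n => Q (y n) + l *: Q (v n)); split.
  + by move=> n; apply/PP; rewrite vE -!QQ.
  + exact: hlim_op.
  + move=> e e0; have [q q0 Qq] := Qb.
    pose C := 1 + normc l * q ^+ 2.
    have C0 : 0 < C by rewrite ltr_pwDl// mulr_ge0 ?normc_ge0 ?sqr_ge0.
    have [|K Ke] := hlim_cauchy vu (e := Num.sqrt (e / C)).
      by rewrite sqrtr_gt0 divr_gt0.
    exists K => n j Kn Kj; rewrite opprD addrACA -scalerBr -!linearB ipDl ipZl.
    have -> : ip (Q (y n - y j)) (Q (v n - v j)) = ip (v n - v j) (v n - v j).
      by rewrite Qs QQ -Ps linearB -!vE.
    rewrite !ip_hn (le_lt_trans (normc_triangle _ _))// Normc.normcM !normcR.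
    rewrite !ger0_norm ?sqr_ge0//.
    have : hn (v n - v j) ^+ 2 < e / C.
      rewrite -[X in _ < X]sqr_sqrtr ?divr_ge0 ?(ltW e0) ?(ltW C0)//.
      by rewrite ltr_pXn2r ?nnegrE ?hn_ge0 ?sqrtr_ge0//; exact: Ke.
    rewrite ltr_pdivlMr// => /le_lt_trans; apply; rewrite mulrDr mulr1 lerD2l.
    rewrite [leRHS]mulrCA ler_wpM2l ?normc_ge0// mulrC -exprMn.
    by rewrite lerXn2r ?nnegrE ?mulr_ge0 ?hn_ge0.
- by split.
- by move=> u f; rewrite -RzE; exact: RzP.
- split.
  + by apply: bop_comp => //; apply: bop_comp => //; exists M.
  + by move=> u v; rewrite Qs Ns Qs.
  + by move=> u; rewrite Qs; exact: Np.
  (* [Q] commutes with [N], [W] and [W'], so (Q N Q)^2 and (Q W' Q)(Q W Q) both reduce to N^2 = W'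
     W. *)
  + by move=> u; rewrite -[LHS]/(Q (N (Q (Q (N (Q u)))))) -!NQ NN -!QW -!QW'.
- exists M => // u /=; rewrite Qs (le_trans (Re_CS _ _))// expr2 mulrA.
  by rewrite ler_wpM2r ?hn_ge0.
Qed.

End Resolvents.

(** * The space L^2(D) *)

Section L2Space.
Context {d : measure_display} {T : measurableType d} {R : realType}.
Variables (m : {measure set T -> \bar R}) (D : set T).
Hypothesis mD : measurable D.
Implicit Types (f g h : T -> R[i]) (a : R[i]).
Local Notation normc := (@Normc.normc R).
Local Notation Re := complex.Re.
Local Notation Im := complex.Im.

Lemma cmeasurableD f g : cmeasurable D f -> cmeasurable D g ->
  cmeasurable D (fun x => f x + g x).
Proof.
move=> [f1 f2] [g1 g2]; split.
  by under eq_fun do rewrite ReD; exact: measurable_funD.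
by under eq_fun do rewrite ImD; exact: measurable_funD.
Qed.

Lemma cmeasurableM f g : cmeasurable D f -> cmeasurable D g ->
  cmeasurable D (fun x => f x * g x).
Proof.
move=> [f1 f2] [g1 g2]; split.
  by under eq_fun do rewrite ReM; apply: measurable_funB; exact: measurable_funM.
by under eq_fun do rewrite ImM; apply: measurable_funD; exact: measurable_funM.
Qed.

Lemma cmeasurable_cst a : cmeasurable D (fun=> a).
Proof. by split; exact: measurable_cst. Qed.

Lemma cmeasurable_conjc f : cmeasurable D f -> cmeasurable D (fun x => conjc (f x)).
Proof.
move=> [f1 f2]; split; first by under eq_fun do rewrite Re_conjc.
by under eq_fun do rewrite Im_conjc; exact: measurable_funN.
Qed.

Lemma cmeasurableZ a f : cmeasurable D f -> cmeasurable D (fun x => a * f x).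
Proof. exact/cmeasurableM/cmeasurable_cst. Qed.

Lemma measurable_sqr_normc f : cmeasurable D f ->
  measurable_fun D (fun x => normc (f x) ^+ 2).
Proof.
move=> [f1 f2]; under eq_fun do rewrite sqr_normc_ReIm.
by apply: measurable_funD; exact: measurable_funX.
Qed.

Let sqr_int f : \bar R := (\int[m]_(x in D) (normc (f x) ^+ 2)%:E)%E.

Lemma measurable_sqr_normcE f : cmeasurable D f ->
  measurable_fun D (fun x => (normc (f x) ^+ 2)%:E).
Proof. by move=> /measurable_sqr_normc mf; exact/measurable_EFinP. Qed.

Lemma sqr_normcD_le (a b : R[i]) :
  normc (a + b) ^+ 2 <= 2 * normc a ^+ 2 + 2 * normc b ^+ 2.
Proof.
rewrite !sqr_normc_ReIm ReD ImD.
have := sqr_ge0 (Re a - Re b); have := sqr_ge0 (Im a - Im b); nra.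
Qed.

(** One domination for several uses: p = q = 2 for sums and distances, q = 0 for multiples. *)
Lemma sqr_int_le f g (h : T -> R[i]) (p q : R) : 0 <= p -> 0 <= q ->
  cmeasurable D f -> cmeasurable D g -> cmeasurable D h ->
  (forall x, D x -> normc (h x) ^+ 2 <= p * normc (f x) ^+ 2 + q * normc (g x) ^+ 2) ->
  (sqr_int h <= p%:E * sqr_int f + q%:E * sqr_int g)%E.
Proof.
move=> p0 q0 mf mg mh fgh.
have f0 x : D x -> (0 <= (normc (f x) ^+ 2)%:E)%E by rewrite lee_fin sqr_ge0.
have g0 x : D x -> (0 <= (normc (g x) ^+ 2)%:E)%E by rewrite lee_fin sqr_ge0.
have mf2 := measurable_sqr_normcE mf; have mg2 := measurable_sqr_normcE mg.
rewrite -!ge0_integralZl_EFin// -ge0_integralD//; last 4 first.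
- by move=> x _; apply: mule_ge0; rewrite lee_fin ?sqr_ge0.
- exact: measurable_funeM.
- by move=> x _; apply: mule_ge0; rewrite lee_fin ?sqr_ge0.
- exact: measurable_funeM.
apply: ge0_le_integral => //.
- by move=> x _; rewrite lee_fin sqr_ge0.
- exact: measurable_sqr_normcE.
- by apply: emeasurable_funD; exact: measurable_funeM.
Qed.

Lemma L2D f g : L2 m D f -> L2 m D g -> L2 m D (fun x => f x + g x).
Proof.
move=> [mf f2] [mg g2]; have mfg := cmeasurableD mf mg; split => //.
apply: le_lt_trans (@sqr_int_le f g _ 2 2 _ _ mf mg mfg _) _ => //.
  by move=> x _; exact: sqr_normcD_le.
by rewrite lte_add_pinfty// lte_mul_pinfty// lee_fin.
Qed.

Lemma L2Z a f : L2 m D f -> L2 m D (fun x => a * f x).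
Proof.
move=> [mf f2]; have mh := cmeasurableZ a mf; split => //.
apply: le_lt_trans (@sqr_int_le f f _ (normc a ^+ 2) 0 _ _ mf mf mh _) _ => //.
- exact: sqr_ge0.
- by move=> x _; rewrite mul0r addr0 Normc.normcM exprMn.
- by rewrite mul0e adde0 lte_mul_pinfty// lee_fin sqr_ge0.
Qed.

Lemma L2_0 : L2 m D (fun=> 0).
Proof.
split; first exact: cmeasurable_cst.
by under eq_integral do rewrite Normc.normc0 expr0n/=; rewrite integral0 ltry.
Qed.

Lemma L2DZ a f g : L2 m D f -> L2 m D g -> L2 m D (fun x => f x + a * g x).
Proof. by move=> Lf Lg; apply: L2D => //; exact: L2Z. Qed.

Lemma L2B f g : L2 m D f -> L2 m D g -> L2 m D (fun x => f x - g x).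
Proof.
move=> Lf Lg; rewrite (_ : (fun x => _) = fun x => f x + (-1) * g x).
  exact: L2DZ.
by apply/funext => x; rewrite mulN1r.
Qed.

Lemma L2_sqr_integrable f : L2 m D f ->
  m.-integrable D (fun x => (normc (f x) ^+ 2)%:E).
Proof.
move=> [mf f2]; apply/integrableP; split; first exact: measurable_sqr_normcE.
by under eq_integral do rewrite gee0_abs ?lee_fin ?sqr_ge0//.
Qed.

Lemma cintegrable_dominated f (g : T -> R) : cmeasurable D f ->
  m.-integrable D (EFin \o g) -> (forall x, D x -> normc (f x) <= g x) ->
  cintegrable m D f.
Proof.
move=> [f1 f2] gi fg; split.
  apply: le_integrable gi => //; first exact/measurable_EFinP.
  move=> x Dx; rewrite lee_fin (le_trans (Re_le_normc _))//.
  by rewrite (le_trans (fg x Dx))// ler_norm.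
apply: le_integrable gi => //; first exact/measurable_EFinP.
move=> x Dx; rewrite lee_fin (le_trans (Im_le_normc _))//.
by rewrite (le_trans (fg x Dx))// ler_norm.
Qed.

Lemma cintegrableM f g : L2 m D f -> L2 m D g -> cintegrable m D (fun x => f x * g x).
Proof.
move=> Lf Lg; apply: (@cintegrable_dominated _
  (fun x => normc (f x) ^+ 2 + normc (g x) ^+ 2)).
- by apply: cmeasurableM; [case: Lf|case: Lg].
- have := integrableD mD (L2_sqr_integrable Lf) (L2_sqr_integrable Lg).
  by apply: eq_integrable.
- move=> x _; rewrite Normc.normcM.
  have := normc_ge0 (f x); have := normc_ge0 (g x).
  by have := sqr_ge0 (normc (f x) - normc (g x)); nra.
Qed.

Lemma L2_conjc f : L2 m D f -> L2 m D (fun x => conjc (f x)).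
Proof.
move=> [mf f2]; split; first exact: cmeasurable_conjc.
by under eq_integral do rewrite normc_conjc.
Qed.

Lemma cintegrable_ip f g : L2 m D f -> L2 m D g ->
  cintegrable m D (fun x => f x * conjc (g x)).
Proof. by move=> Lf /L2_conjc; exact: cintegrableM. Qed.

Lemma eq_cintegral f g : (forall x, D x -> f x = g x) ->
  cintegral m D f = cintegral m D g.
Proof.
move=> fg; apply: complexP => /=.
  by apply: eq_Rintegral => x /set_mem /fg ->.
by apply: eq_Rintegral => x /set_mem /fg ->.
Qed.

Lemma cintegralD f g : cintegrable m D f -> cintegrable m D g ->
  cintegral m D (fun x => f x + g x) = cintegral m D f + cintegral m D g.
Proof.
move=> [f1 f2] [g1 g2]; apply: complexP; rewrite ?ReD ?ImD /=.
  by rewrite -RintegralD//; apply: eq_Rintegral => x _; rewrite ReD.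
by rewrite -RintegralD//; apply: eq_Rintegral => x _; rewrite ImD.
Qed.

Lemma cintegralZ a f : cintegrable m D f ->
  cintegral m D (fun x => a * f x) = a * cintegral m D f.
Proof.
move=> [f1 f2]; have I (r : R) (h : T -> R) : m.-integrable D (EFin \o h) ->
    m.-integrable D (EFin \o (fun x => r * h x)).
  by move=> hi; have := integrableZl mD r hi; apply: eq_integrable.
apply: complexP; rewrite ?ReM ?ImM /=.
  rewrite -!RintegralZl// -RintegralB//;
    [|exact: (I _ (fun x => Re (f x)))|exact: (I _ (fun x => Im (f x)))].
  by apply: eq_Rintegral => x _; rewrite ReM.
rewrite -!RintegralZl// -RintegralD//;
  [|exact: (I _ (fun x => Im (f x)))|exact: (I _ (fun x => Re (f x)))].
by apply: eq_Rintegral => x _; rewrite ImM.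
Qed.

Lemma cintegral_conjc f : cintegrable m D f ->
  cintegral m D (fun x => conjc (f x)) = conjc (cintegral m D f).
Proof.
move=> [f1 f2]; apply: complexP; rewrite ?Re_conjc ?Im_conjc /=.
  by apply: eq_Rintegral => x _; rewrite Re_conjc.
rewrite -mulN1r -RintegralZl//.
by apply: eq_Rintegral => x _; rewrite Im_conjc mulN1r.
Qed.

Lemma ae_eq_cintegral f g : cmeasurable D f -> cmeasurable D g -> ae_eq m D f g ->
  cintegral m D f = cintegral m D g.
Proof.
move=> [f1 f2] [g1 g2] fg; apply: complexP => /=; congr fine.
  apply: ae_eq_integral => //; try exact/measurable_EFinP.
  exact: (ae_eq_comp (fun z => (Re z)%:E)).
apply: ae_eq_integral => //; try exact/measurable_EFinP.
exact: (ae_eq_comp (fun z => (Im z)%:E)).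
Qed.

Lemma l2inner_ae f f' g g' : L2 m D f -> L2 m D f' -> L2 m D g -> L2 m D g' ->
  ae_eq m D f f' -> ae_eq m D g g' -> l2inner m D f g = l2inner m D f' g'.
Proof.
move=> [mf _] [mf' _] [mg _] [mg' _] ff gg.
apply: ae_eq_cintegral.
- by apply: cmeasurableM => //; exact: cmeasurable_conjc.
- by apply: cmeasurableM => //; exact: cmeasurable_conjc.
- by apply: filterS2 ff gg => x fx gx Dx; rewrite fx// gx.
Qed.

Lemma l2innerDl f g h : L2 m D f -> L2 m D g -> L2 m D h ->
  l2inner m D (fun x => f x + g x) h = l2inner m D f h + l2inner m D g h.
Proof.
move=> Lf Lg Lh; rewrite /l2inner -cintegralD; [|exact: cintegrable_ip..].
by apply: eq_cintegral => x _; rewrite mulrDl.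
Qed.

Lemma l2innerZl a f g : L2 m D f -> L2 m D g ->
  l2inner m D (fun x => a * f x) g = a * l2inner m D f g.
Proof.
move=> Lf Lg; rewrite /l2inner -cintegralZ; last exact: cintegrable_ip.
by apply: eq_cintegral => x _; rewrite mulrA.
Qed.

Lemma l2innerC f g : L2 m D f -> L2 m D g ->
  l2inner m D f g = conjc (l2inner m D g f).
Proof.
move=> Lf Lg; rewrite /l2inner -cintegral_conjc; last exact: cintegrable_ip.
by apply: eq_cintegral => x _; rewrite conjcM conjcK mulrC.
Qed.

Lemma Re_l2inner f : Re (l2inner m D f f) = fine (sqr_int f).
Proof. by congr fine; apply: eq_integral => x _; rewrite mul_conjc. Qed.

Lemma sqr_int_fin f : L2 m D f -> sqr_int f = (Re (l2inner m D f f))%:E.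
Proof.
move=> Lf; rewrite Re_l2inner fineK//.
exact/integrable_fin_num/L2_sqr_integrable.
Qed.

Lemma Re_l2inner_ge0 f : 0 <= Re (l2inner m D f f).
Proof.
by rewrite Re_l2inner fine_ge0// integral_ge0// => x _; rewrite lee_fin sqr_ge0.
Qed.

Lemma l2normE f : l2norm m D f = Num.sqrt (Re (l2inner m D f f)).
Proof. by rewrite Re_l2inner. Qed.

Lemma Re_l2inner_eq0 f : L2 m D f -> Re (l2inner m D f f) = 0 ->
  ae_eq m D f (fun=> 0).
Proof.
move=> Lf f0; have := sqr_int_fin Lf; rewrite f0 => if0.
have := (@ae_eq_integral_abs _ _ _ m D mD (fun x => (normc (f x) ^+ 2)%:E)
  (measurable_sqr_normcE Lf.1)).1.
under eq_integral do rewrite gee0_abs ?lee_fin ?sqr_ge0//.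
move=> /(_ if0); apply: filterS => x fx Dx; have /= := fx Dx.
by move=> [/eqP]; rewrite sqrf_eq0 normc_eq0 => /eqP.
Qed.

End L2Space.

(** Weighted Cauchy-Schwarz, one term at a time: a new term [a] of weight [p] adds 1/p to the sum
    [A] of inverse weights and p a^2 to the weighted sum [t]. With b = p a it amounts to 2 s b <= A
    b^2 + t, which follows from s^2 <= A t by completing the square. *)
Lemma sqr_telescope_step {R : realType} (s t a A p : R) : 0 <= A -> 0 <= t -> 0 < p ->
  s ^+ 2 <= A * t -> (s + a) ^+ 2 <= (A + p^-1) * (t + p * a ^+ 2).
Proof.
move=> A0 t0 p0 st; pose b := p * a.
suff h : 2 * s * b <= A * b ^+ 2 + t.
  have -> : (A + p^-1) * (t + p * a ^+ 2) =
      A * t + p^-1 * (A * b ^+ 2 + t) + a ^+ 2.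
    by rewrite /b; field; rewrite gt_eqF.
  have -> : (s + a) ^+ 2 = s ^+ 2 + p^-1 * (2 * s * b) + a ^+ 2.
    by rewrite /b; field; rewrite gt_eqF.
  by rewrite lerD2r lerD// ler_pM2l ?invr_gt0.
move: A0; rewrite le_eqVlt => /predU1P[A0|A0].
  have s0 : s = 0 by apply/eqP; rewrite -sqrf_eq0 eq_le sqr_ge0 andbT (le_trans st)// -A0 mul0r.
  by rewrite -A0 s0; lra.
rewrite -(ler_pM2l A0) -subr_ge0.
have -> : A * (A * b ^+ 2 + t) - A * (2 * s * b) =
  (A * b - s) ^+ 2 + (A * t - s ^+ 2) by ring.
by rewrite addr_ge0 ?sqr_ge0 ?subr_ge0.
Qed.

Lemma pow2V_lt {R : realType} (e : R) : 0 < e -> exists k, 2 ^- k < e.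
Proof.
move=> e0; have : (fun n => 2 ^- n) @ \oo --> (0:R).
  under eq_fun do rewrite -exprVn.
  by apply: cvg_expr; rewrite ger0_norm; lra.
move=> /cvgrPdist_lt/(_ _ e0)[N _ Ne]; exists N; have := Ne N (leqnn N).
by rewrite /= sub0r normrN ger0_norm ?invr_ge0 ?exprn_ge0.
Qed.

(** * Completeness of L^2(D) *)

Section RieszFischer.
Context {d : measure_display} {T : measurableType d} {R : realType}.
Variables (m : {measure set T -> \bar R}) (D : set T).
Hypothesis mD : measurable D.
Implicit Types (f g h : T -> R[i]) (a : R[i]).
Local Notation normc := (@Normc.normc R).
Local Notation Re := complex.Re.
Local Notation Im := complex.Im.
Local Notation N2 f := (Re (l2inner m D f f)).
Local Notation sqr_int f := (\int[m]_(x in D) (normc (f x) ^+ 2)%:E)%E.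

Lemma real_cauchy_cvg (u : nat -> R) :
  (forall e, 0 < e -> exists N, forall n, (N <= n)%N -> `|u N - u n| < e) -> cvgn u.
Proof.
move=> uc; apply/cauchy_cvgP/cauchy_exP => _/posnumP[e].
have [N Ne] := uc _ (gt0 e); exists (u N).
by exists N => // n; exact: Ne.
Qed.

Section FastCauchy.
Variable F : nat -> T -> R[i].
Hypothesis LF : forall n, L2 m D (F n).
Let dF k x := F k.+1 x - F k x.
(** The factor 2^-k cancels the weight in [G] below; the remaining 1 / 2^(k+1) has the form summed
    by [epsilon_trick0], so that [G] has integral at most 1. *)
Hypothesis F_fast : forall k, N2 (dF k) <= 2 ^- k * (1 / (2 ^ k.+1)%:R).

(* By Cauchy-Schwarz, the weights [2 ^ k] yield the pointwise bound
   [|F (k + i) - F k|^2 <= 2 * 2^-k * G]. *)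
Let G x : \bar R := (\sum_(k <oo) (2 ^+ k * normc (dF k x) ^+ 2)%:E)%E.

Let G_ge0 x : (0 <= G x)%E.
Proof.
apply: nneseries_ge0 => k _ _.
by rewrite lee_fin mulr_ge0 ?sqr_ge0 ?exprn_ge0.
Qed.

Let LdF k : L2 m D (dF k). Proof. exact: (L2B mD (LF k.+1) (LF k)). Qed.

Let mG_term k : measurable_fun D (fun x => (2 ^+ k * normc (dF k x) ^+ 2)%:E).
Proof.
apply/measurable_EFinP/measurable_funM => //.
by apply: measurable_sqr_normc; case: (LdF k).
Qed.

Let mG : measurable_fun D G.
Proof.
apply: ge0_emeasurable_sum => // k x _ _.
by rewrite lee_fin mulr_ge0 ?sqr_ge0 ?exprn_ge0.
Qed.

Let int_G : (\int[m]_(x in D) G x <= 1%:E)%E.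
Proof.
rewrite integral_nneseries//; last first.
  by move=> k x _; rewrite lee_fin mulr_ge0 ?sqr_ge0 ?exprn_ge0.
apply: le_trans (epsilon_trick0 xpredT ler01).
apply: lee_nneseries => [k _ _|k _].
  by apply: integral_ge0 => x _; rewrite lee_fin mulr_ge0 ?sqr_ge0 ?exprn_ge0.
under eq_integral do rewrite EFinM.
rewrite ge0_integralZl_EFin ?exprn_ge0//; last 2 first.
- by move=> x _; rewrite lee_fin sqr_ge0.
- by apply: measurable_sqr_normcE; case: (LdF k).
rewrite sqr_int_fin// -EFinM lee_fin.
by have := F_fast k; rewrite ler_pdivlMl ?exprn_gt0.
Qed.

Let dist_le x k i : ((normc (F (k + i)%N x - F k x) ^+ 2)%:E <= (2 * 2 ^- k)%:E * G x)%E.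
Proof.
pose t i := \sum_(k <= j < k + i) 2 ^+ j * normc (dF j x) ^+ 2.
have t0 j : 0 <= t j.
  by apply: sumr_ge0 => l _; rewrite mulr_ge0 ?sqr_ge0 ?exprn_ge0.
have E (n : nat) : 2 ^- n.+1 = 2 ^- n / 2 :> R by rewrite exprS invfM mulrC.
have ge0 (n : nat) : 0 < 2 ^- n :> R by rewrite invr_gt0 exprn_gt0.
have dec j : 2 ^- (k + j) <= 2 ^- k :> R.
  by elim: j => [|j ih]; rewrite ?addn0// addnS E; have := ge0 (k + j)%N; lra.
(* The coefficient of [t i] is the sum of the inverse weights 2^-j over k <= j < k + i. *)
have s_le : normc (F (k + i)%N x - F k x) ^+ 2 <= (2 * 2 ^- k - 2 * 2 ^- (k + i)) * t i.
  elim: i => [|i ih].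
    by rewrite addn0 !subrr Normc.normc0 mul0r expr0n.
  rewrite addnS; set n := (k + i)%N.
  have -> : F n.+1 x - F k x = (F n x - F k x) + dF n x.
    by rewrite /dF; ring.
  apply: le_trans (_ : (normc (F n x - F k x) + normc (dF n x)) ^+ 2 <= _).
    by rewrite lerXn2r ?nnegrE ?addr_ge0 ?normc_ge0// normc_triangle.
  have -> : t i.+1 = t i + 2 ^+ n * normc (dF n x) ^+ 2.
    by rewrite /t addnS big_nat_recr//= leq_addr.
  have -> : 2 * 2 ^- k - 2 * 2 ^- n.+1 = (2 * 2 ^- k - 2 * 2 ^- n) + (2 ^+ n)^-1 :> R.
    by rewrite E; field; rewrite !expf_neq0.
  apply: sqr_telescope_step => //.
    by rewrite subr_ge0 ler_pM2l// dec.
apply: (@le_trans _ _ ((2 * 2 ^- k)%:E * (t i)%:E)%E).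
  rewrite -EFinM lee_fin (le_trans s_le)// ler_wpM2r//.
  by have := ge0 (k + i)%N; lra.
apply: lee_pmul => //.
- by rewrite lee_fin.
- rewrite /t /G -sumEFin.
  apply: (@le_trans _ _ (\sum_(0 <= j < k + i) (2 ^+ j * normc (dF j x) ^+ 2)%:E)%E).
    rewrite [leRHS](big_cat_nat (n := k)) ?leq_addr//= leeDr//.
    by apply: sume_ge0 => l _; rewrite lee_fin mulr_ge0 ?sqr_ge0 ?exprn_ge0.
  apply: nneseries_lim_ge => l _ _.
  by rewrite lee_fin mulr_ge0 ?sqr_ge0 ?exprn_ge0.
Qed.

(** [p] stands for the real or the imaginary part. The 1 in the threshold below avoids a division by
    zero when [G x] vanishes. *)
Let F_cvg (p : R[i] -> R) x : (forall a, `|p a| <= normc a) ->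
  (forall a b, p (a - b) = p a - p b) -> (G x < +oo)%E -> cvgn (fun n => p (F n x)).
Proof.
move=> p1 pB Goo; apply: real_cauchy_cvg => e e0.
have Gf : G x = (fine (G x))%:E by rewrite fineK// ge0_fin_numE.
have [|k ke] := @pow2V_lt R (e ^+ 2 / (2 * fine (G x) + 1)).
  by rewrite divr_gt0 ?exprn_gt0// ltr_wpDl// mulr_ge0// fine_ge0.
exists k => n /subnKC <-; rewrite distrC -pB (le_lt_trans (p1 _))//.
rewrite -ltr_sqr ?nnegrE ?normc_ge0 ?(ltW e0)//.
have := dist_le x k (n - k); rewrite Gf -EFinM lee_fin => /le_lt_trans; apply.
have g0 : 0 <= fine (G x) by exact: fine_ge0.
have p0 : 0 < 2 ^- k :> R by rewrite invr_gt0 exprn_gt0.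
by move: ke; rewrite ltr_pdivlMr; lra.
Qed.

Lemma fast_cauchy_cvg : exists2 g, L2 m D g &
  (fun n => N2 (fun x => F n x - g x)) @ \oo --> (0 : R).
Proof.
pose b x := (G x < +oo)%E.
pose g x : R[i] := if b x then Complex (limn (fun n => Re (F n x)))
  (limn (fun n => Im (F n x))) else 0.
have mb : measurable_fun D b.
  have := @measurable_fun_lte _ _ _ D G (cst +oo%E) mG (measurable_cst _).
  by [].
have mp (p : R[i] -> R) : (forall a, `|p a| <= normc a) ->
  (forall a b, p (a - b) = p a - p b) -> (forall n, measurable_fun D (fun x => p (F n x))) ->
  measurable_fun D (fun x => if b x then limn (fun n => p (F n x)) else 0).
  move=> p1 pB mpF.
  apply: (@measurable_fun_cvg _ _ _ D (fun n x => if b x then p (F n x) else 0)).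
    move=> n; apply: measurable_fun_if => //.
    exact: (measurable_funS mD (@subIsetl _ _ _) (mpF n)).
  move=> x Dx; case: (boolP (b x)) => bx; last exact: cvg_cst.
  exact: F_cvg.
have mg : cmeasurable D g.
  split.
    rewrite (_ : (fun x => _) = (fun x => if b x then limn (fun n => Re (F n x)) else 0)).
      by apply: mp => [a|a c|n]; [exact: Re_le_normc|exact: ReB|case: (LF n) => -[]].
    by apply/funext => x; rewrite /g; case: ifP.
  rewrite (_ : (fun x => _) = (fun x => if b x then limn (fun n => Im (F n x)) else 0)).
    by apply: mp => [a|a c|n]; [exact: Im_le_normc|exact: ImB|case: (LF n) => -[]].
  by apply/funext => x; rewrite /g; case: ifP.
(* Where [G] is infinite, [g] has the default value 0 and the bound is trivial, so no null set has
   to be tracked; elsewhere it is the limit of [dist_le] as i grows. *)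
have Fg k x : ((normc (F k x - g x) ^+ 2)%:E <= (2 * 2 ^- k)%:E * G x)%E.
  have k0 : 0 < 2 * 2 ^- k :> R by rewrite mulr_gt0// invr_gt0 exprn_gt0.
  case: (boolP (b x)) => bx; last first.
    have -> : G x = +oo%E by apply/eqP; move: bx; rewrite /b -leNgt leye_eq.
    by rewrite gt0_muley ?leey ?lte_fin.
  have Gf : G x = (fine (G x))%:E by rewrite fineK// ge0_fin_numE.
  have cR := F_cvg (@Re_le_normc R) (@ReB R) bx.
  have cI := F_cvg (@Im_le_normc R) (@ImB R) bx.
  rewrite Gf -EFinM lee_fin.
  have cv : (fun i => normc (F (i + k)%N x - F k x) ^+ 2) @ \oo --> normc (F k x - g x) ^+ 2.
    rewrite (_ : (fun i => _) = fun i => (Re (F (i + k)%N x) - Re (F k x)) ^+ 2 +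
        (Im (F (i + k)%N x) - Im (F k x)) ^+ 2); last first.
      by apply/funext => i; rewrite sqr_normc_ReIm ReB ImB.
    rewrite normcBC sqr_normc_ReIm ReB ImB /g bx /=.
    have sq (u : nat -> R) l c : u @ \oo --> l ->
        (fun i => (u (i + k)%N - c) ^+ 2) @ \oo --> (l - c) ^+ 2.
      move=> ul; under eq_fun do rewrite expr2; rewrite expr2.
      by apply: cvgM; apply: cvgB; try exact: cvg_cst;
        rewrite (cvg_shiftn k u).
    by apply: cvgD; [exact: (sq _ _ _ cR)|exact: (sq _ _ _ cI)].
  apply: ler_cvg_to cv (cvg_cst _) _; near=> i.
  by have := dist_le x k i; rewrite Gf -EFinM lee_fin addnC.
have int_le k : (sqr_int (fun x => (F k x - g x)) <= (2 * 2 ^- k)%:E)%E.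
  have k0 : 0 <= 2 * 2 ^- k :> R by rewrite mulr_ge0// invr_ge0 exprn_ge0.
  apply: (@le_trans _ _ (\int[m]_(x in D) ((2 * 2 ^- k)%:E * G x))%E).
    apply: ge0_le_integral => //.
    - by move=> x _; rewrite lee_fin sqr_ge0.
    - apply: measurable_sqr_normcE.
      have := cmeasurableD (LF k).1 (cmeasurableZ (-1) mg).
      by under eq_fun do rewrite mulN1r.
    - exact: measurable_funeM.
  rewrite ge0_integralZl_EFin// -[leRHS]mule1.
  by apply: lee_wpmul2l => //; rewrite lee_fin.
have LFg k : L2 m D (fun x => F k x - g x).
  split.
    have := cmeasurableD (LF k).1 (cmeasurableZ (-1) mg).
    by under eq_fun do rewrite mulN1r.
  by rewrite (le_lt_trans (int_le k))// ltry.
exists g.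
  have := L2B mD (LF 0%N) (LFg 0%N).
  by under eq_fun do rewrite opprB addrC subrK.
have k0 : (fun k => 2 * 2 ^- k) @ \oo --> (0 : R).
  rewrite -[X in _ --> X](mulr0 2); apply: cvgM; first exact: cvg_cst.
  under eq_fun do rewrite -exprVn.
  by apply: cvg_expr; rewrite ger0_norm; lra.
apply: (squeeze_cvgr _ (cvg_cst 0) k0); near=> k.
by rewrite Re_l2inner_ge0/= -lee_fin -sqr_int_fin.
Unshelve. all: end_near. Qed.

End FastCauchy.

Lemma N2_dist_le f g h : L2 m D f -> L2 m D g -> L2 m D h ->
  N2 (fun x => f x - h x) <=
    2 * N2 (fun x => f x - g x) + 2 * N2 (fun x => g x - h x).
Proof.
move=> Lf Lg Lh; have Lfg := L2B mD Lf Lg; have Lgh := L2B mD Lg Lh.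
have Lfh := L2B mD Lf Lh; rewrite -lee_fin EFinD !EFinM -!sqr_int_fin//.
apply: sqr_int_le => //; [exact: Lfg.1|exact: Lgh.1|exact: Lfh.1|].
move=> x _; have -> : f x - h x = (f x - g x) + (g x - h x) by rewrite addrA subrK.
exact: sqr_normcD_le.
Qed.

Theorem L2_complete (f : nat -> T -> R[i]) : (forall n, L2 m D (f n)) ->
  (forall e : R, 0 < e -> exists N, forall n k, (N <= n)%N -> (N <= k)%N ->
     N2 (fun x => f n x - f k x) < e) ->
  exists2 g, L2 m D g & (fun n => N2 (fun x => f n x - g x)) @ \oo --> (0 : R).
Proof.
move=> Lf fc; have /choice[N NP] (k : nat) : exists N, forall n j, (N <= n)%N -> (N <= j)%N ->
    N2 (fun x => f n x - f j x) < 2 ^- k * (1 / (2 ^ k.+1)%:R).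
  by apply: fc; rewrite mulr_gt0 ?invr_gt0 ?exprn_gt0// divr_gt0// ltr0n expn_gt0.
(* Cumulated sums give indices that increase and dominate both [N k] and k: the subsequence is fast,
   and it still reaches arbitrarily far into the full sequence. *)
pose phi k := (\sum_(i < k.+1) (N i).+1)%N.
have phiE k : phi k.+1 = (phi k + (N k.+1).+1)%N by rewrite /phi big_ord_recr.
have Nphi k : (N k <= phi k)%N.
  by rewrite /phi big_ord_recr/= (leq_trans (leqnSn _))// leq_addl.
have phiS k : (phi k <= phi k.+1)%N by rewrite phiE leq_addr.
have phi_ge k : (k <= phi k)%N.
  by elim: k => [//|k ih]; rewrite phiE addnS ltnS (leq_trans ih)// leq_addr.
have [||g Lg Fg] := @fast_cauchy_cvg (fun k => f (phi k)).
- by move=> k; exact: Lf.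
- by move=> k; apply/ltW/NP => //; exact: leq_trans (Nphi k) (phiS k).
exists g => //; apply/cvgrPdist_lt => e e0.
have [|K1 K1e] := fc (e / 4); first by rewrite divr_gt0.
have /cvgrPdist_lt Fg4 := Fg; have [|K2 _ K2e] := Fg4 (e / 4); first by rewrite divr_gt0.
exists K1 => // n /= K1n; rewrite sub0r normrN ger0_norm ?Re_l2inner_ge0//.
pose j := maxn K1 K2.
have := N2_dist_le (Lf n) (Lf (phi j)) Lg => /le_lt_trans; apply.
have := K1e n (phi j) K1n (leq_trans (leq_maxl _ _) (phi_ge j)).
have := K2e j (leq_maxr _ _); rewrite /= sub0r normrN ger0_norm ?Re_l2inner_ge0//.
lra.
Qed.

End RieszFischer.

(** * The Hilbert space of classes of L^2 functions *)

Section L2Class.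
Context {d : measure_display} {T : measurableType d} {R : realType}.
Variables (m : {measure set T -> \bar R}) (D : set T).
Implicit Types (f g h : T -> R[i]) (a : R[i]).
Local Notation Re := complex.Re.

(** The choice is made on the set of all representatives, hence depends on the class alone; equal
    classes thereby become equal functions. *)
Definition l2canon f : T -> R[i] := xget (fun=> 0) [set g | L2 m D g /\ ae_eq m D f g].

Lemma l2canonP f : L2 m D f -> L2 m D (l2canon f) /\ ae_eq m D f (l2canon f).
Proof.
move=> Lf; rewrite /l2canon; case: xgetP => [g _ []//|/(_ f)[]].
by split => //; exact: ae_eq_refl.
Qed.

Lemma l2canon_ae f g : ae_eq m D f g -> l2canon f = l2canon g.
Proof.
move=> fg; congr xget; apply/seteqP; split => h [Lh fh]; split => //.
  exact: ae_eq_trans (ae_eq_sym fg) fh.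
exact: ae_eq_trans fg fh.
Qed.

(* [L^2(D)] modulo almost everywhere equality: a class is encoded by its
   canonical representative. *)
Definition l2class (mD : measurable D) : Type :=
  {f : T -> R[i] | L2 m D f /\ l2canon f = f}.

Variable mD : measurable D.
Local Notation V := (l2class mD).
Implicit Types u v w : V.

HB.instance Definition _ := gen_eqMixin V.
HB.instance Definition _ := gen_choiceMixin V.

Lemma l2canon_idem f : L2 m D f ->
  L2 m D (l2canon f) /\ l2canon (l2canon f) = l2canon f.
Proof. by move=> /l2canonP[Lf fe]; split => //; exact/esym/l2canon_ae.
Qed.

(** Total on functions: outside L^2 the value is the class of 0. *)
Definition cls f : V := match pselect (L2 m D f) with
  | left Lf => exist (fun f => L2 m D f /\ l2canon f = f) _ (l2canon_idem Lf)
  | right _ => exist (fun f => L2 m D f /\ l2canon f = f) _ (l2canon_idem (L2_0 m D))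
  end.

Definition rep u : T -> R[i] := sval u.

Lemma rep_L2 u : L2 m D (rep u).
Proof. by case: u => f []. Qed.

Lemma rep_cls f : L2 m D f -> ae_eq m D (rep (cls f)) f.
Proof.
move=> Lf; rewrite /cls; case: pselect => // Lf'.
by apply: ae_eq_sym; case: (l2canonP Lf).
Qed.

Lemma rep_inj u v : ae_eq m D (rep u) (rep v) -> u = v.
Proof.
move=> uv; have := l2canon_ae uv; case: u v {uv} => [f fP] [g gP] /=.
rewrite fP.2 gP.2 => fg; rewrite fg in fP *.
by congr exist; exact: Prop_irrelevance.
Qed.

Lemma cls_rep u : cls (rep u) = u.
Proof. exact/rep_inj/rep_cls/rep_L2. Qed.

Lemma eq_cls f g : L2 m D f -> L2 m D g -> ae_eq m D f g -> cls f = cls g.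
Proof.
move=> Lf Lg fg; apply: rep_inj; apply: ae_eq_trans (rep_cls Lf) _.
by apply: ae_eq_trans fg _; apply: ae_eq_sym; exact: rep_cls.
Qed.

Lemma cls_inj f g : L2 m D f -> L2 m D g -> cls f = cls g -> ae_eq m D f g.
Proof.
move=> Lf Lg fg; apply: ae_eq_trans (ae_eq_sym (rep_cls Lf)) _.
by rewrite fg; exact: rep_cls.
Qed.

Definition l2add u v := cls (fun x => rep u x + rep v x).
Definition l2scale a u := cls (fun x => a * rep u x).
Definition l2opp u := l2scale (-1) u.
Definition l2zero := cls (fun=> 0).

Lemma clsD f g : L2 m D f -> L2 m D g ->
  l2add (cls f) (cls g) = cls (fun x => f x + g x).
Proof.
move=> Lf Lg; apply: eq_cls.
- by apply: L2D => //; exact: rep_L2.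
- exact: L2D.
- by apply: filterS2 (rep_cls Lf) (rep_cls Lg) => x fx gx Dx; rewrite fx// gx.
Qed.

Lemma clsZ a f : L2 m D f -> l2scale a (cls f) = cls (fun x => a * f x).
Proof.
move=> Lf; apply: eq_cls; [exact/L2Z/rep_L2|exact: L2Z|].
by apply: filterS (rep_cls Lf) => x fx Dx; rewrite fx.
Qed.

Lemma l2addA : associative l2add.
Proof.
move=> u v w; rewrite -(cls_rep u) -(cls_rep v) -(cls_rep w).
have Lu := rep_L2 u; have Lv := rep_L2 v; have Lw := rep_L2 w.
rewrite (clsD Lv Lw) (clsD Lu Lv) (clsD Lu (L2D mD Lv Lw)).
rewrite (clsD (L2D mD Lu Lv) Lw).
by congr cls; apply/funext => x; rewrite addrA.
Qed.

Lemma l2addC : commutative l2add.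
Proof. by move=> u v; congr cls; apply/funext => x; rewrite addrC. Qed.

Lemma l2add0 : left_id l2zero l2add.
Proof.
move=> u; rewrite -(cls_rep u) clsD; [|exact: L2_0|exact: rep_L2].
by congr cls; apply/funext => x; rewrite add0r.
Qed.

Lemma l2addN : left_inverse l2zero l2opp l2add.
Proof.
move=> u; rewrite -(cls_rep u) /l2opp; have Lu := rep_L2 u.
rewrite clsZ// clsD//; last exact: L2Z.
by congr cls; apply/funext => x; rewrite mulN1r addNr.
Qed.

HB.instance Definition _ := GRing.isZmodule.Build V l2addA l2addC l2add0 l2addN.

Lemma cls_add f g : L2 m D f -> L2 m D g -> cls (fun x => f x + g x) = cls f + cls g.
Proof. by move=> Lf Lg; rewrite -clsD. Qed.

Lemma l2scaleA a b u : l2scale a (l2scale b u) = l2scale (a * b) u.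
Proof.
rewrite -(cls_rep u); have Lu := rep_L2 u.
rewrite !clsZ//; last exact: L2Z.
by congr cls; apply/funext => x; rewrite mulrA.
Qed.

Lemma l2scale1 : left_id 1 l2scale.
Proof.
move=> u; rewrite -[RHS](cls_rep u); congr cls.
by apply/funext => x; rewrite mul1r.
Qed.

Lemma l2scaleDr : right_distributive l2scale +%R.
Proof.
move=> a u v; rewrite -(cls_rep u) -(cls_rep v).
have Lu := rep_L2 u; have Lv := rep_L2 v.
rewrite -cls_add// (clsZ a (L2D mD Lu Lv)) (clsZ a Lu) (clsZ a Lv).
rewrite -(cls_add (L2Z mD a Lu) (L2Z mD a Lv)).
by congr cls; apply/funext => x; rewrite mulrDr.
Qed.

Lemma l2scaleDl u : {morph l2scale^~ u : a b / a + b}.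
Proof.
move=> a b; rewrite -(cls_rep u); have Lu := rep_L2 u.
rewrite !clsZ// -(cls_add (L2Z mD a Lu) (L2Z mD b Lu)).
by congr cls; apply/funext => x; rewrite mulrDl.
Qed.

HB.instance Definition _ := GRing.Zmodule_isLmodule.Build R[i] V
  l2scaleA l2scale1 l2scaleDr l2scaleDl.

Lemma cls_scale a f : L2 m D f -> cls (fun x => a * f x) = a *: cls f.
Proof. by move=> Lf; rewrite -clsZ. Qed.

Lemma cls_sub f g : L2 m D f -> L2 m D g -> cls (fun x => f x - g x) = cls f - cls g.
Proof.
move=> Lf Lg; rewrite -scaleN1r -cls_scale// -cls_add//; last exact: L2Z.
by congr cls; apply/funext => x; rewrite mulN1r.
Qed.

Definition l2ip u v := l2inner m D (rep u) (rep v).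

Lemma l2ip_cls f g : L2 m D f -> L2 m D g -> l2ip (cls f) (cls g) = l2inner m D f g.
Proof.
by move=> Lf Lg; apply: l2inner_ae => //; try exact: rep_L2; exact: rep_cls.
Qed.

Lemma l2ipDl u v w : l2ip (u + v) w = l2ip u w + l2ip v w.
Proof.
rewrite -(cls_rep u) -(cls_rep v) -(cls_rep w).
have Lu := rep_L2 u; have Lv := rep_L2 v; have Lw := rep_L2 w.
rewrite -cls_add// !l2ip_cls//; last exact: L2D.
exact: l2innerDl.
Qed.

Lemma l2ipZl a u v : l2ip (a *: u) v = a * l2ip u v.
Proof.
rewrite -(cls_rep u) -(cls_rep v); have Lu := rep_L2 u; have Lv := rep_L2 v.
rewrite -cls_scale// !l2ip_cls//; last exact: L2Z.
exact: l2innerZl.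
Qed.

Lemma l2ipC u v : l2ip u v = conjc (l2ip v u).
Proof. by apply: l2innerC => //; exact: rep_L2. Qed.

Lemma l2ip_ge0 u : 0 <= Re (l2ip u u). Proof. exact: Re_l2inner_ge0. Qed.

Lemma l2ip_eq0 u : Re (l2ip u u) = 0 -> u = 0.
Proof.
move=> u0; rewrite -(cls_rep u); apply: eq_cls; [exact: rep_L2|exact: L2_0|].
by apply: Re_l2inner_eq0 => //; exact: rep_L2.
Qed.

Lemma l2class_complete (x : nat -> V) :
  (forall e : R, 0 < e -> exists N, forall n k, (N <= n)%N -> (N <= k)%N ->
     Re (l2ip (x n - x k) (x n - x k)) < e) ->
  exists l, (fun n => Re (l2ip (x n - l) (x n - l))) @ \oo --> (0 : R).
Proof.
have ipB u f : L2 m D f -> l2ip (u - cls f) (u - cls f) =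
    l2inner m D (fun t => rep u t - f t) (fun t => rep u t - f t).
  move=> Lf; rewrite -{1 2}(cls_rep u) -cls_sub//; last exact: rep_L2.
  by have Lu := rep_L2 u; have Luf := L2B mD Lu Lf; rewrite l2ip_cls.
move=> xc; have [||g Lg xg] := @L2_complete _ _ _ m D mD (fun n => rep (x n)).
- by move=> n; exact: rep_L2.
- move=> e /xc[N Ne]; exists N => n k Nn Nk; have := Ne n k Nn Nk.
  by rewrite -{1 2}(cls_rep (x k)) ipB//; exact: rep_L2.
- by exists (cls g); under eq_fun do rewrite ipB//.
Qed.

HB.instance Definition _ := isHilbert.Build R V
  l2ipDl l2ipZl l2ipC l2ip_ge0 l2ip_eq0 l2class_complete.

Lemma ip_cls f g : L2 m D f -> L2 m D g -> ip (cls f) (cls g) = l2inner m D f g.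
Proof. exact: l2ip_cls. Qed.

Lemma hn_cls f : L2 m D f -> hn (cls f) = l2norm m D f.
Proof. by move=> Lf; rewrite /hn ip_cls// l2normE. Qed.

Lemma cls0 : cls (fun=> 0) = 0. Proof. by []. Qed.

End L2Class.

(** * Operators in L^2(D) *)

Lemma symop_Im {R : realType} {H : hilbertType R} (S : H -> H) (u : H) : symop S ->
  complex.Im (ip (S u) u) = 0.
Proof.
move=> Ss; have E : ip (S u) u = conjc (ip (S u) u) by rewrite {1}Ss ipC.
have {E} := congr1 (fun x : R[i] => complex.Im x) E; rewrite Im_conjc; lra.
Qed.

Section OperatorGraphs.
Context {d : measure_display} {T : measurableType d} {R : realType}.
Variables (m : {sigma_finite_measure set T -> \bar R}) (D : set T).
Hypothesis mD : measurable D.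
Local Notation fn := (T -> R[i]).
Local Notation V := (l2class m mD).
Local Notation cls := (cls m mD).
Implicit Types (f g : fn) (u v w : V) (a : R[i]).
Local Notation Re := complex.Re.

Definition op_graph (S : V -> V) f g := [/\ L2 m D f, L2 m D g & cls g = S (cls f)].

Lemma ip_rep u v : ip u v = l2inner m D (rep u) (rep v). Proof. by []. Qed.

Lemma hn_rep u : hn u = l2norm m D (rep u).
Proof. by rewrite -{1}(cls_rep u) hn_cls//; exact: rep_L2. Qed.

Lemma op_graph_ex S f : L2 m D f -> exists g, op_graph S f g.
Proof.
by move=> Lf; exists (rep (S (cls f))); split; rewrite ?cls_rep//; exact: rep_L2.
Qed.

Lemma op_graph_linear (S : {linear V -> V}) : linear_operator m D (op_graph S).
Proof.
split.
- by move=> f g [].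
- move=> f f' g g' [Lf Lg fg] Lf' Lg' ff' gg'; split => //.
  by rewrite -(eq_cls mD Lf Lf' ff') -(eq_cls mD Lg Lg' gg').
- move=> f f' g g' [Lf Lg fg] [Lf' Lg' fg'] ff'; apply: cls_inj => //.
  by rewrite fg fg' (eq_cls mD Lf Lf' ff').
- by split; [exact: L2_0|exact: L2_0|rewrite cls0 linear0].
- move=> a f f' g g' [Lf Lg fg] [Lf' Lg' fg'].
  split; [exact: L2DZ|exact: L2DZ|].
  rewrite (cls_add mD Lf (L2Z mD a Lf')) (cls_add mD Lg (L2Z mD a Lg')).
  by rewrite !cls_scale// fg fg' linearD linearZ.
Qed.

Lemma op_graph_bounded (S : {linear V -> V}) : bop S -> bounded_operator m D (op_graph S).
Proof.
move=> [c c0 Sc]; split; [exact: op_graph_linear|exact: op_graph_ex|exists c].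
by move=> f g [Lf Lg fg]; rewrite -!(hn_cls mD)// fg.
Qed.

Lemma op_graph_adjoint (S S' : V -> V) : (forall u v, ip (S u) v = ip u (S' v)) ->
  forall f g, adjoint m D (op_graph S) f g <-> op_graph S' f g.
Proof.
move=> SS' f g; split => [[Lf Lg fg]|[Lf Lg fg]]; split => //.
  apply: eq_ip => w; rewrite ipC [RHS]ipC; congr conjc.
  rewrite -SS' -(cls_rep w) -[in RHS](cls_rep (S _)) !ip_cls//; try exact: rep_L2.
  apply/esym/fg; split; rewrite ?cls_rep//; exact: rep_L2.
move=> h k [Lh Lk hk]; rewrite -(ip_cls mD Lk Lf) -(ip_cls mD Lh Lg) hk fg.
exact: SS'.
Qed.

Lemma eq_graph_adjoint (B B' : fn -> fn -> Prop) : (forall f g, B f g <-> B' f g) ->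
  forall f g, adjoint m D B f g <-> adjoint m D B' f g.
Proof. by move=> BB f g; split => -[Lf Lg h]; split => // k l /BB; exact: h. Qed.

Lemma eq_graph_bounded (B B' : fn -> fn -> Prop) : (forall f g, B f g <-> B' f g) ->
  bounded_operator m D B' -> bounded_operator m D B.
Proof. by move=> BB; suff -> : B = B' by []; apply/funext => f; apply/funext => g; exact/propext. Qed.

(** [S] plays |T0|. Its trace in a basis is dominated termwise by [M] times the sum of |Q e_n|^2,
    and bounded partial sums suffice since all terms are nonnegative; the bound [C] may depend on
    the basis. *)
Lemma trace_class_of_HS (B : fn -> fn -> Prop) (T0 T1 S Q : {linear V -> V}) :
  (forall f g, B f g <-> op_graph T0 f g) -> bop T0 ->
  (forall u v, ip (T0 u) v = ip u (T1 v)) ->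
  bop S -> symop S -> posop S -> (forall u, S (S u) = T1 (T0 u)) ->
  (exists2 M : R, 0 <= M & forall u, Re (ip (S u) u) <= M * hn (Q u) ^+ 2) ->
  (forall e, orthonormal_basis m D e -> exists C : R, forall N,
     \sum_(n < N) hn (Q (cls (e n))) ^+ 2 <= C) ->
  trace_class m D B.
Proof.
move=> BT T0b T01 Sb Ss Sp SS [M M0 SM] HS.
split; first exact: eq_graph_bounded BT (op_graph_bounded T0b).
exists (op_graph S); split.
  split; first exact: op_graph_bounded.
    move=> f g [Lf Lg fg]; rewrite -(ip_cls mD)// fg lecE.
    by rewrite (Sp (cls f)) andbT symop_Im ?eqxx.
  move=> f h; split.
    move=> [g [[Lf Lg fg] [_ Lh gh]]]; exists (rep (T0 (cls f))); split.
      by apply/BT; split; rewrite ?cls_rep//; exact: rep_L2.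
    apply: (eq_graph_adjoint BT _ _).2; apply: (op_graph_adjoint T01 _ _).2.
    by split; [exact: rep_L2|exact: Lh|rewrite gh fg SS cls_rep].
  move=> [g [/BT[Lf Lg fg]]].
  move=> /((eq_graph_adjoint BT _ _).1)/((op_graph_adjoint T01 _ _).1)[_ Lh gh].
  exists (rep (S (cls f))); split; split; rewrite ?cls_rep//; try exact: rep_L2.
  by rewrite gh fg SS.
move=> e s eb es; have [C eC] := HS e eb.
apply: (@le_lt_trans _ _ (M * C)%:E); last exact: ltry.
apply: lime_le.
  apply: is_cvg_nneseries => n _ _.
  have [Le Ls sE] := es n; rewrite -(ip_cls mD)// sE lee_fin.
  exact: Sp.
near=> N; rewrite big_mkord sumEFin lee_fin (@le_trans _ _ (M * \sum_(n < N) hn (Q (cls (e n))) ^+ 2))//.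
  rewrite mulr_sumr; apply: ler_sum => n _.
  by have [Le Ls sE] := es n; rewrite -(ip_cls mD)// sE.
by rewrite ler_wpM2l.
Unshelve. all: end_near. Qed.

Variables (A : fn -> fn -> Prop) (z : R[i]).
Hypotheses (A_sa : self_adjoint m D A) (A_semi : lower_semibounded m D A)
  (z_res : resolvent_set m D A z).

Let AH u v := A (rep u) (rep v).

Let A_L2 f g : A f g -> L2 m D f /\ L2 m D g.
Proof. by case: A_sa => lA _ _; exact: (linop_L2 lA). Qed.

Lemma AH_cls f g : L2 m D f -> L2 m D g -> A f g <-> AH (cls f) (cls g).
Proof.
case: A_sa => lA _ _ Lf Lg; have [Lcf Lcg] := (rep_L2 (cls f), rep_L2 (cls g)).
split => H; apply: (linop_ae lA H) => //; try exact: rep_cls.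
- exact/ae_eq_sym/rep_cls.
- exact/ae_eq_sym/rep_cls.
Qed.

(** [selfadj_factor] applied to the operator [AH] induced on classes; [AH_cls] carries hypotheses
    and conclusions between classes and representatives. *)
Theorem resolvent_factor : exists Q W W' S : {linear V -> V},
  [/\ [/\ symop Q, bop Q & forall u, form_domain m D A (rep (Q u))],
      [/\ bop W, bop W' & forall u v, ip (W u) v = ip u (W' v)],
      forall f g, resolvent A z f g <-> op_graph (fun u => Q (W (Q u))) f g,
      [/\ bop S, symop S, posop S & forall u, S (S u) = Q (W' (Q (Q (W (Q u)))))]
    & exists2 M : R, 0 <= M & forall u, Re (ip (S u) u) <= M * hn (Q u) ^+ 2].
Proof.
have [lA dA AA] := A_sa; have [c cA] := A_semi; have [_ zs [K zK]] := z_res.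
have AHD a (u v : V) g : L2 m D g -> A (fun x => rep u x + a * rep v x) g ->
    AH (u + a *: v) (cls g).
  move=> Lg; have Lu := rep_L2 u; have Lv := rep_L2 v.
  move=> /AH_cls; rewrite (cls_add mD Lu (L2Z mD a Lv)) cls_scale// !cls_rep.
  by apply => //; exact: L2DZ.
have [||||||Q [W [W' [S [[Qs Qb Qf] WW res SS SM]]]]] :=
    @selfadj_factor R V AH _ _ _ c z.
- move=> a f g f' g' fg fg'; have := linop_linear lA a fg fg'.
  have Lg := rep_L2 g; have Lg' := rep_L2 g'.
  move=> /AHD; rewrite (cls_add mD Lg (L2Z mD a Lg')) cls_scale// !cls_rep.
  by apply; exact: L2DZ.
- move=> u e e0; have [f [g [fg fe]]] := dA (rep u) (rep_L2 u) e e0.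
  have [Lf Lg] := A_L2 fg; exists (cls f), (cls g); split; first exact: (AH_cls Lf Lg).1.
  have Lu := rep_L2 u; rewrite -(cls_rep u) -(cls_sub mD)// hn_cls//.
  exact: L2B.
- move=> u v; split=> [/AA[_ _ uv] f g fg|uv]; first exact: uv.
  apply/AA; split; [exact: rep_L2|exact: rep_L2|] => f g fg.
  have [Lf Lg] := A_L2 fg; have := uv (cls f) (cls g); rewrite -(AH_cls Lf Lg).
  by move=> /(_ fg); rewrite -{1}(cls_rep u) -{1}(cls_rep v) !ip_cls//; exact: rep_L2.
- move=> f g fg; have := cA _ _ fg; rewrite -ip_rep -hn_rep lecE.
  by move=> /andP[].
- move=> u; have Lu := rep_L2 u; have [f fu] := zs (rep u) Lu.
  have [Lf Luf] := A_L2 fu; exists (cls f); move: fu => /(AH_cls Lf Luf).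
  by rewrite (cls_add mD Lu (L2Z mD z Lf)) cls_scale// cls_rep.
- exists K => u f; have Lu := rep_L2 u; have Lf := rep_L2 f.
  rewrite !hn_rep => uf; apply: zK; rewrite /resolvent; apply/AH_cls => //.
    exact: L2DZ.
  by rewrite (cls_add mD Lu (L2Z mD z Lf)) (cls_scale mD z Lf) (cls_rep u) (cls_rep f).
exists Q, W, W', S; split => //.
- split => // u; split; first exact: rep_L2.
  have [x [y [xy xu yc]]] := Qf u.
  exists (fun n => rep (x n)), (fun n => rep (y n)); split.
  + by move=> n; exact: xy.
  + rewrite (_ : (fun n => _) = (fun n => hn (x n - Q u)))//.
    apply/funext => n; have Lx := rep_L2 (x n); have LQ := rep_L2 (Q u).
    rewrite -[in RHS](cls_rep (x n)) -[in RHS](cls_rep (Q u)) -cls_sub// hn_cls//.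
    exact: L2B.
  + move=> e /yc[N Ne]; exists N => n k Nn Nk; have := Ne n k Nn Nk.
    have [Lxn Lxk] := (rep_L2 (x n), rep_L2 (x k)).
    have [Lyn Lyk] := (rep_L2 (y n), rep_L2 (y k)).
    rewrite -{1}(cls_rep (x n)) -{1}(cls_rep (x k)) -{1}(cls_rep (y n)).
    by rewrite -{1}(cls_rep (y k)) -!cls_sub// ip_cls//; exact: L2B.
- move=> f g; split.
    move=> fg; have [Lg Lfg] := A_L2 fg.
    (* The graph of [A] yields L^2 only for [g] and f + z g; [f] is a combination of the two. *)
    have Lf : L2 m D f.
      have := L2DZ mD (- z) Lfg Lg; rewrite (_ : (fun x => _) = f)//.
      by apply/funext => x; rewrite mulNr addrK.
    split => //; apply/res; move: fg => /(AH_cls Lg Lfg).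
    by rewrite (cls_add mD Lf (L2Z mD z Lg)) cls_scale.
  move=> [Lf Lg /res fg]; apply/(AH_cls Lg (L2DZ mD z Lf Lg)).
  by rewrite (cls_add mD Lf (L2Z mD z Lg)) cls_scale.
Qed.

End OperatorGraphs.

(** * Functions on the metric graph *)

Section GraphMeasure.
Context {R : realType}.
Variable G : metric_graph R.
Local Notation point := (edge G * measurableTypeR R)%type.
Local Notation mu := (graph_measure G).
Local Notation leb := (@lebesgue_measure R).
Local Notation normc := (@Normc.normc R).
Local Notation Re := complex.Re.
Local Notation Im := complex.Im.
Implicit Types (e : edge G) (I : set (measurableTypeR R)) (f : point -> R[i]).

Lemma edge_set_measurable (B : set (edge G)) : measurable B.
Proof. by []. Qed.

Lemma measurable_edge_fun {d : measure_display} {T : measurableType d} (f : edge G -> T) :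
  measurable_fun setT f.
Proof. by move=> _ Y _; exact: edge_set_measurable. Qed.

Lemma measurable_points : measurable (points G).
Proof.
have m1 : measurable_fun setT (fun x : point => len x.1).
  by apply: measurableT_comp (measurable_edge_fun _) _; exact: measurable_fst.
have m2 : measurable_fun setT (fun x : point => x.2 : R) by exact: measurable_snd.
rewrite (_ : points G = [set x : point | 0 <= (x.2 : R)] `&` [set x : point | (x.2 : R) <= len x.1]).
  by apply: measurableI; rewrite -preimage_true -[X in measurable X]setTI;
    apply: measurable_fun_ler.
apply/seteqP; split => x /=; first by move=> /andP[].
by move=> [? ?]; apply/andP.
Qed.

Definition edge_part e I : set point := [set e] `*` I.

Lemma measurable_edge_part e I : measurable I -> measurable (edge_part e I).
Proof. by move=> mI; apply: measurableX => //; exact: edge_set_measurable. Qed.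

Lemma edge_counting1 e : @edge_counting R G [set e] = 1%E.
Proof.
by rewrite /edge_counting /counting asboolT// fset_set1 finmap.cardfs1.
Qed.

(** Tonelli: the inner integral vanishes off the edge [e], which has counting measure 1. *)
Lemma ge0_integral_edge e I (F : point -> \bar R) : measurable I ->
  measurable_fun (edge_part e I) F -> (forall x, edge_part e I x -> 0 <= F x)%E ->
  (\int[mu]_(x in edge_part e I) F x = \int[leb]_(t in I) F (e, t))%E.
Proof.
move=> mI mF F0; rewrite integral_mkcond.
have mE := measurable_edge_part e mI.
rewrite [LHS](fubini_tonelli1 (F \_ (edge_part e I))); last 2 first.
- exact: ((measurable_restrictT F mE).1 mF).
- exact: erestrict_ge0.
rewrite (_ : fubini_F _ _ = (cst (\int[leb]_(t in I) F (e, t))%E) \_ [set e]); last first.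
  apply/funext => e'; rewrite /fubini_F patchE; case: ifPn => [|ee'].
    rewrite inE => -> /=; rewrite [RHS]integral_mkcond; apply: eq_integral => t _.
    rewrite !patchE; congr (if _ then _ else _).
    by apply/idP/idP; rewrite !inE /edge_part /=; [case|split].
  apply: integral0_eq => t _; rewrite patchE; case: ifPn => //.
  by rewrite inE => -[/= E _]; move: ee'; rewrite E => /negP[]; rewrite inE.
rewrite -integral_mkcond integral_cst; last exact: edge_set_measurable.
by rewrite [X in (_ * X)%E](edge_counting1 e) mule1.
Qed.

Lemma integral_edge e I (F : point -> \bar R) : measurable I ->
  measurable_fun (edge_part e I) F ->
  (\int[mu]_(x in edge_part e I) F x = \int[leb]_(t in I) F (e, t))%E.
Proof.
move=> mI mF; rewrite integralE [RHS]integralE; congr (_ - _)%E.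
  have := @ge0_integral_edge e I F^\+%E mI (measurable_funepos mF).
  move=> /(_ (fun _ _ => funepos_ge0 _ _)) E; apply: etrans E _.
  by apply: eq_integral => t _; rewrite !funeposE.
have := @ge0_integral_edge e I F^\-%E mI (measurable_funeneg mF).
move=> /(_ (fun _ _ => funeneg_ge0 _ _)) E; apply: etrans E _.
by apply: eq_integral => t _; rewrite !funenegE.
Qed.

Lemma cintegral_edge e I (f : point -> R[i]) : measurable I ->
  cmeasurable (edge_part e I) f ->
  cintegral mu (edge_part e I) f = cintegral leb I (fun t => f (e, t)).
Proof.
move=> mI [f1 f2]; apply: complexP => /=; congr fine.
  by apply: integral_edge => //; exact/measurable_EFinP.
by apply: integral_edge => //; exact/measurable_EFinP.
Qed.

Lemma edge_partS e I : I `<=` `[0, len e] -> edge_part e I `<=` points G.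
Proof. by move=> Ie [e' t] /= [/= -> /Ie]; rewrite /points/= in_itv. Qed.

Lemma measurable_fun_edge {d : measure_display} {T : measurableType d} e I (f : point -> T) :
  measurable I -> measurable_fun (edge_part e I) f ->
  measurable_fun I (fun t => f (e, t)).
Proof.
move=> mI mf _ Y mY; have := mf (measurable_edge_part e mI) Y mY.
move=> /(measurable_xsection e); rewrite (_ : xsection _ _ = I `&` (fun t => f (e, t)) @^-1` Y)//.
apply/seteqP; split => t; rewrite /xsection/= inE/=; first by case=> -[].
by case=> It Yt; split.
Qed.

Lemma cmeasurable_edge e I f : measurable I -> cmeasurable (edge_part e I) f ->
  cmeasurable I (fun t => f (e, t)).
Proof.
move=> mI [f1 f2]; split.
  exact: (measurable_fun_edge mI f1).
exact: (measurable_fun_edge mI f2).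
Qed.

Lemma cmeasurableS (B C : set point) f : measurable C -> B `<=` C ->
  cmeasurable C f -> cmeasurable B f.
Proof. by move=> mC BC [f1 f2]; split; exact: measurable_funS mC BC _. Qed.

Lemma sqr_int_edges (s : seq (edge G)) (f : point -> R[i]) : uniq s ->
  L2 mu (points G) f ->
  (\sum_(e <- s) \int[leb]_(t in `[0%R, len e]) (normc (f (e, t)) ^+ 2)%:E <=
    \int[mu]_(x in points G) (normc (f x) ^+ 2)%:E)%E.
Proof.
move=> us [mf _]; have mp := measurable_points.
pose P e := edge_part e `[0, len e].
have mP e : measurable (P e) by exact: measurable_edge_part.
have PS e : P e `<=` points G by exact: edge_partS.
have mf2 := measurable_sqr_normcE mf.
rewrite (eq_bigr (fun e => \int[mu]_(x in P e) (normc (f x) ^+ 2)%:E)%E); last first.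
  move=> e _; rewrite ge0_integral_edge//.
  - exact: measurable_funS mp (PS e) mf2.
  - by move=> x _; rewrite lee_fin sqr_ge0.
have US : \big[setU/set0]_(e <- s) P e `<=` points G.
  by rewrite -bigcup_seq => x [e _ /PS].
rewrite -(ge0_integral_bigsetU mu mP us).
- apply: ge0_subset_integral => //.
  + by apply: bigsetU_measurable.
  + by move=> x _; rewrite lee_fin sqr_ge0.
- by move=> e e' _ _ [[x t] [[/= <- _] [/= <- _]]].
- exact: measurable_funS mp US mf2.
- by move=> x _; rewrite lee_fin sqr_ge0.
Qed.

Lemma L2_edge e I f : measurable I -> I `<=` `[0, len e] -> L2 mu (points G) f ->
  L2 leb I (fun t => f (e, t)).
Proof.
move=> mI Ie Lf; have mp := measurable_points.
have mfe : cmeasurable `[0, len e] (fun t => f (e, t)).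
  apply: cmeasurable_edge => //; apply: cmeasurableS mp _ Lf.1.
  exact: edge_partS.
split.
  apply: cmeasurable_edge => //; apply: cmeasurableS mp _ Lf.1.
  exact: edge_partS.
apply: le_lt_trans Lf.2; apply: le_trans (sqr_int_edges (s := [:: e]) isT Lf).
rewrite big_seq1; apply: ge0_subset_integral => //.
- exact: measurable_sqr_normcE.
- by move=> x _; rewrite lee_fin sqr_ge0.
Qed.

(** An injective numbering of the edges cuts [points] into pieces, each an edge or empty. By
    countable subadditivity the measure is at most the sum of their measures, whose partial sums are
    sums of lengths over finitely many distinct edges. *)
Lemma graph_measure_points_le : (mu (points G) <= total_volume G)%E.
Proof.
have /pcard_injP[f fi] := edge_countable G.
have finj : injective f by move=> x y; apply: fi; rewrite inE.
have mp := measurable_points.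
pose P k : set point := points G `&` [set x | f x.1 = k].
have mP k : measurable (P k).
  apply: measurableI => //; rewrite (_ : mkset _ = [set e | f e = k] `*` setT).
    by apply: measurableX => //; exact: edge_set_measurable.
  by apply/seteqP; split => x //= [].
have PE e : mu (P (f e)) = (len e)%:E.
  rewrite (_ : P (f e) = edge_part e `[0, len e]); last first.
    apply/seteqP; split => [[e1 t] [/= pt /finj <-]|[e' t] [/= -> te]].
      by split => //=; rewrite in_itv.
    by split => //; move: te; rewrite /= in_itv.
  rewrite [LHS]product_measure1E//.
  have lebe : @lebesgue_measure R `[0, len e] = (len e)%:E.
    by rewrite lebesgue_measure_itv/= lte_fin len_gt0 sube0.
  by rewrite [X in (X * _)%E](edge_counting1 e) mul1e; exact: lebe.
apply: le_trans (measure_sigma_subadditive mu mP mp _) _.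
  by move=> x px; exists (f x.1).
apply: lime_le; first by apply: is_cvg_nneseries.
near=> n; have [s [us _ ->]] : exists s, [/\ uniq s, forall e, e \in s -> (f e < n)%N &
    (\sum_(0 <= k < n) mu (P k) = \sum_(e <- s) (len e)%:E)%E].
  elim: (n) => [|k [s [us sk sE]]]; first by exists [::]; split => //; rewrite big_geq// big_nil.
  rewrite big_nat_recr//= sE; have [[e ek]|nk] := pselect (exists e, f e = k).
    exists (e :: s); split.
    - by rewrite /= us andbT; apply/negP => /sk; rewrite ek ltnn.
    - by move=> e'; rewrite inE => /predU1P[->|/sk/ltnW//]; rewrite ek.
    - by rewrite big_cons -ek PE addeC.
  exists s; split => //; first by move=> e /sk/ltnW.
  rewrite (_ : P k = set0) ?measure0 ?adde0//.
  by apply/seteqP; split => // x [_ fx]; apply: nk; exists x.1.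
apply: esum_ge; exists [set` s]; last by rewrite fsbig_seq.
by split => //; exact: finite_seq.
Unshelve. all: end_near. Qed.

End GraphMeasure.

Section CauchySchwarzIntegral.
Context {d : measure_display} {T : measurableType d} {R : realType}.
Variables (m : {measure set T -> \bar R}) (D : set T).
Hypothesis mD : measurable D.
Implicit Types f g : T -> R[i].

Lemma normc_l2inner_le f g : L2 m D f -> L2 m D g ->
  Normc.normc (l2inner m D f g) <= l2norm m D f * l2norm m D g.
Proof. by move=> Lf Lg; rewrite -(ip_cls mD)// -!(hn_cls mD)//; exact: CS. Qed.

Lemma L2_cst (a : R[i]) : (m D < +oo)%E -> L2 m D (fun=> a).
Proof.
move=> mDoo; split; first exact: cmeasurable_cst.
by rewrite (integral_cst m mD) lte_mul_pinfty// lee_fin sqr_ge0.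
Qed.

Lemma normc_cintegral_le f (r : R) : m D = r%:E -> L2 m D f ->
  Normc.normc (cintegral m D f) <= Num.sqrt r * l2norm m D f.
Proof.
move=> mDr Lf; have L1 : L2 m D (fun=> 1) by apply: L2_cst; rewrite mDr ltry.
have := normc_l2inner_le Lf L1; rewrite mulrC; congr (Normc.normc _ <= _ * _).
  by apply: eq_cintegral => x _; rewrite conjc1 mulr1.
by rewrite /l2norm Normc.normc1 expr1n /Rintegral (integral_cst m mD) mDr mul1e.
Qed.

End CauchySchwarzIntegral.

Lemma itv_measurable {R : realType} (i : interval R) :
  @measurable _ (measurableTypeR R) [set` i].
Proof. by []. Qed.

Lemma lebesgue_measure_itvE {R : realType} (b0 b1 : bool) (a b : R) : a <= b ->
  @lebesgue_measure R [set` Interval (BSide b0 a) (BSide b1 b)] = (b - a)%:E.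
Proof.
rewrite lebesgue_measure_itv/= lte_fin; case: ltP => // ba ab.
by rewrite (_ : a = b) ?subrr//; apply/eqP; rewrite eq_le ab.
Qed.

(** * Sobolev estimates on a single edge *)

Section EdgeEstimates.
Context {R : realType}.
Variable G : metric_graph R.
Local Notation point := (edge G * measurableTypeR R)%type.
Local Notation mu := (graph_measure G).
Local Notation leb := (@lebesgue_measure R).
Local Notation normc := (@Normc.normc R).
Local Notation Re := complex.Re.
Local Notation Im := complex.Im.
Implicit Types (e : edge G) (f h : point -> R[i]) (s t : R) (v w : vertex G).

Definition edge_norm2 e f : R :=
  Re (l2inner leb `[0, len e] (fun t => f (e, t)) (fun t => f (e, t))).

Definition graph_norm2 f : R := Re (l2inner mu (points G) f f).

Lemma edge_norm2_ge0 e f : 0 <= edge_norm2 e f. Proof. exact: Re_l2inner_ge0. Qed.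

Lemma graph_norm2_ge0 f : 0 <= graph_norm2 f. Proof. exact: Re_l2inner_ge0. Qed.

Lemma sum_edge_norm2_le (r : seq (edge G)) f : uniq r -> L2 mu (points G) f ->
  \sum_(e <- r) edge_norm2 e f <= graph_norm2 f.
Proof.
move=> ur Lf; rewrite -lee_fin -(sqr_int_fin (@measurable_points _ G))// -sumEFin.
apply: le_trans (sqr_int_edges ur Lf); apply: lee_sum => e _.
by rewrite -sqr_int_fin//; exact: L2_edge.
Qed.

Lemma edge_norm2_le e f : L2 mu (points G) f -> edge_norm2 e f <= graph_norm2 f.
Proof. by move=> /(sum_edge_norm2_le (r := [:: e]) isT); rewrite big_seq1. Qed.

Section Edge.
Variables (e : edge G) (h h' : point -> R[i]).
Hypotheses (hh' : edge_derivative h h') (Lh : L2 mu (points G) h).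

Lemma edge_diff s t : 0 <= s <= t -> t <= len e ->
  h (e, t) - h (e, s) = cintegral leb `]s, t] (fun u => h' (e, u)).
Proof.
move=> /andP[s0 st] tl; have [Lh' hE] := hh' e.
have It : cintegrable leb `[0, t] (fun u => h' (e, u)).
  have L1 : L2 leb `[0, len e] (fun=> 1).
    apply: L2_cst => //.
    by rewrite [X in (X < _)%E](lebesgue_measure_itvE _ _ (ltW (len_gt0 e))) ltry.
  have [I1 I2] : cintegrable leb `[0, len e] (fun u => h' (e, u)).
    have := cintegrableM (itv_measurable _) Lh' L1.
    congr (cintegrable _ _ _); apply/funext => u.
    exact: mulr1.
  have sub : `[0, t] `<=` `[0, len e] by apply: subset_itvl; rewrite bnd_simp.
  by split; [exact: (integrableS (itv_measurable _) (itv_measurable _) sub I1)|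
    exact: (integrableS (itv_measurable _) (itv_measurable _) sub I2)].
rewrite (hE t) ?(le_trans s0 st)// (hE s) ?s0 ?(le_trans st tl)//.
rewrite opprD addrACA subrr add0r; apply: complexP; rewrite ?ReB ?ImB /=.
  by apply: Rintegral_itvB; rewrite ?bnd_simp//; case: It.
by apply: Rintegral_itvB; rewrite ?bnd_simp//; case: It.
Qed.

(** Cauchy-Schwarz on the integral of the derivative. The squared form lets lengths and energies be
    added separately along a walk. *)
Lemma edge_diff_le s t : 0 <= s <= len e -> 0 <= t <= len e ->
  normc (h (e, t) - h (e, s)) ^+ 2 <= `|t - s| * edge_norm2 e h'.
Proof.
wlog st : s t / s <= t.
  move=> H sl tl; have [st|/ltW ts] := leP s t; first exact: H.
  by rewrite normcBC distrC; exact: H.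
move=> /andP[s0 sl] /andP[t0 tl]; rewrite edge_diff ?s0//.
have [Lh' _] := hh' e; have sub : `]s, t] `<=` `[0, len e].
  by apply: subset_itv; rewrite bnd_simp.
have Lst : L2 leb `]s, t] (fun u => h' (e, u)).
  case: Lh' => [[m1 m2] i2]; split; first by split; exact: measurable_funS sub _.
  apply: le_lt_trans i2; apply: ge0_subset_integral => //.
    exact: measurable_sqr_normcE.
  by move=> x _; rewrite lee_fin sqr_ge0.
have lst : leb `]s, t] = (t - s)%:E by exact: lebesgue_measure_itvE.
have st0 : 0 <= t - s by rewrite subr_ge0.
have CSst := normc_cintegral_le (itv_measurable _) lst Lst.
apply: (@le_trans _ _ ((Num.sqrt (t - s) * l2norm leb `]s, t] (fun u => h' (e, u))) ^+ 2)).
  by rewrite lerXn2r ?nnegrE ?normc_ge0 ?mulr_ge0 ?sqrtr_ge0.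
rewrite exprMn sqr_sqrtr// ger0_norm//; apply: ler_wpM2l => //; rewrite l2normE.
rewrite sqr_sqrtr ?Re_l2inner_ge0// -lee_fin -!sqr_int_fin//.
apply: ge0_subset_integral => //.
  by apply: measurable_sqr_normcE; case: Lh'.
by move=> x _; rewrite lee_fin sqr_ge0.
Qed.

(** Integrate |h(p)|^2 <= 2 |h(t)|^2 + 2 |h(p) - h(t)|^2 over t in [a, b]. *)
Lemma edge_interval_bound (a b p : R) : 0 <= a -> a <= p <= b -> b <= len e -> a < b ->
  (b - a) * normc (h (e, p)) ^+ 2 <=
    2 * edge_norm2 e h + 2 * (b - a) ^+ 2 * edge_norm2 e h'.
Proof.
move=> a0 /andP[ap pb] bl ab; have sub : `[a, b] `<=` `[0, len e].
  by apply: subset_itv; rewrite bnd_simp.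
have Lab := L2_edge (itv_measurable `[a, b]) sub Lh.
have leab : leb `[a, b] = (b - a)%:E by apply: lebesgue_measure_itvE; exact: ltW.
set K := 2 * (b - a) * edge_norm2 e h'.
have ab0 : 0 <= b - a by lra.
have K0 : 0 <= K by rewrite !mulr_ge0 ?edge_norm2_ge0.
have pt t : a <= t <= b -> normc (h (e, p)) ^+ 2 <= 2 * normc (h (e, t)) ^+ 2 + K.
  move=> /andP[at_ tb]; have := sqr_normcD_le (h (e, t)) (h (e, p) - h (e, t)).
  rewrite addrC subrK => /le_trans; apply; rewrite lerD2l /K -mulrA ler_pM2l//.
  have : normc (h (e, p) - h (e, t)) ^+ 2 <= `|p - t| * edge_norm2 e h'.
    by apply: edge_diff_le; lra.
  move=> /le_trans; apply; rewrite ler_wpM2r ?edge_norm2_ge0//.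
  by rewrite ler_norml; lra.
have mab := measurable_sqr_normcE Lab.1.
rewrite -lee_fin EFinM -leab muleC -(integral_cst leb (itv_measurable `[a, b])).
apply: (@le_trans _ _ (\int[leb]_(t in `[a, b]) (2%:E * (normc (h (e, t)) ^+ 2)%:E + K%:E))%E).
  apply: ge0_le_integral => //.
  - by move=> t _; rewrite lee_fin sqr_ge0.
  - by apply: emeasurable_funD => //; exact: measurable_funeM.
rewrite ge0_integralD//; last 2 first.
- by move=> t _; rewrite -EFinM lee_fin mulr_ge0 ?sqr_ge0.
- exact: measurable_funeM.
rewrite ge0_integralZl_EFin//; last by move=> t _; rewrite lee_fin sqr_ge0.
have cK : (\int[leb]_(_ in `[a, b]) K%:E = K%:E * (b - a)%:E)%E.
  by rewrite -leab; exact: (integral_cst leb (itv_measurable `[a, b]) K%:E).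
rewrite [X in (_ + X <= _)%E]cK [leRHS]EFinD.
apply: leeD; last by rewrite -EFinM lee_fin /K; lra.
rewrite [leRHS]EFinM lee_wpmul2l//; rewrite -sqr_int_fin//; last exact: L2_edge.
apply: ge0_subset_integral => //.
  by apply: measurable_sqr_normcE; case: (L2_edge (itv_measurable _) (@subset_refl _ `[0, len e]) Lh).
by move=> x _; rewrite lee_fin sqr_ge0.
Qed.

(** Made to telescope along walks: the coefficient of |h(t)|^2 is exactly 1, and the error is the
    edge's own share of the H^1 norm times a constant free of the edge length, however short the
    edge is. *)
Lemma edge_sqr_le s t : 0 <= s <= len e -> 0 <= t <= len e ->
  normc (h (e, s)) ^+ 2 <=
    normc (h (e, t)) ^+ 2 + 5 * (edge_norm2 e h + edge_norm2 e h').
Proof.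
move=> sl tl; have B0 := edge_norm2_ge0 e h; have N0 := edge_norm2_ge0 e h'.
have ht0 := sqr_ge0 (normc (h (e, t))).
pose a := Num.min s t; pose b := Num.max s t.
have [sa sb ta tb] : [/\ a <= s, s <= b, a <= t & t <= b].
  by rewrite /a /b !ge_min !le_max !lexx !orbT.
have a0 : 0 <= a by rewrite le_min; lra.
have bl : b <= len e by rewrite ge_max; lra.
have ba : b - a = `|t - s|.
  rewrite /a /b; case: leP => st; first by rewrite ger0_norm; lra.
  by rewrite ltr0_norm; lra.
(* Beyond distance 1, a unit interval around [s] inside the edge bounds |h(s)|^2 by the norms
   alone. *)
have [st1|st1] := leP (b - a) 1; last first.
  have [c [c0 cl cs]] : exists c, [/\ 0 <= c, c + 1 <= len e & c <= s <= c + 1].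
    have [ss|ts] := leP (s + 1) b; [exists s|exists (b - 1)]; split; lra.
  have := edge_interval_bound c0 cs cl; rewrite ltrDl ltr01 => /(_ isT).
  by rewrite addrAC subrr add0r; lra.
have [ab|ab] := leP b a.
  have <- : s = t by lra.
  lra.
have hs := edge_interval_bound a0 (introT andP (conj sa sb)) bl ab.
have ht := edge_interval_bound a0 (introT andP (conj ta tb)) bl ab.
have := edge_diff_le sl tl; rewrite -ba; move: hs ht ht0.
set l := b - a in ab st1 *; set x := normc (h (e, s)); set y := normc (h (e, t)).
set B := edge_norm2 e h in B0 *; set N := edge_norm2 e h' in N0 *.
have l0 : 0 < l by rewrite subr_gt0.
move=> hs ht ht0; set z := normc _ => zl.
have xyz : x <= y + z.
  have := normc_triangleB (h (e, t)) (h (e, t) - h (e, s)).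
  by rewrite opprB addrC subrK.
have [x0 y0 z0] : [/\ 0 <= x, 0 <= y & 0 <= z] by rewrite !normc_ge0.
have l2 : l ^+ 2 <= 1 by rewrite expr_le1// ltW.
have hs' : l * x ^+ 2 <= 2 * B + 2 * N.
  apply: le_trans hs _; rewrite lerD2l -mulrA ler_pM2l//.
  by rewrite -[leRHS]mul1r ler_wpM2r.
have ht' : l * y ^+ 2 <= 2 * B + 2 * N.
  apply: le_trans ht _; rewrite lerD2l -mulrA ler_pM2l//.
  by rewrite -[leRHS]mul1r ler_wpM2r.
have [xy|yx] := leP x y.
  have : x ^+ 2 <= y ^+ 2 by rewrite lerXn2r ?nnegrE.
  lra.
have xz : x ^+ 2 - y ^+ 2 <= z * (x + y) by nra.
(* Young's inequality weighted by [l]: the energy bound z^2 <= l N absorbs 1/l, and the factor l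
   compensates the 1/l in the bounds of x^2 and y^2. In total x^2 - y^2 <= (N + 8 (B + N)) / 2,
   below 5 (B + N). *)
have zxy : 2 * (z * (x + y)) <= z ^+ 2 / l + l * (x + y) ^+ 2.
  have := sqr_ge0 (z / l - (x + y)) => q.
  have -> : z ^+ 2 / l + l * (x + y) ^+ 2 =
      2 * (z * (x + y)) + l * (z / l - (x + y)) ^+ 2.
    by field; rewrite gt_eqF.
  by rewrite lerDl mulr_ge0// ltW.
have zN : z ^+ 2 / l <= N by rewrite ler_pdivrMr// mulrC.
have lxy : l * (x + y) ^+ 2 <= 2 * (l * x ^+ 2) + 2 * (l * y ^+ 2).
  have : 0 <= l * (x - y) ^+ 2 by rewrite mulr_ge0 ?sqr_ge0 ?ltW.
  nra.
lra.
Qed.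

End Edge.
End EdgeEstimates.

(** * Walks, paths and the global bounds for H^1 functions *)

Section Walks.
Context {R : realType}.
Variable G : metric_graph R.
Local Notation point := (edge G * measurableTypeR R)%type.
Local Notation mu := (graph_measure G).
Local Notation normc := (@Normc.normc R).
Implicit Types (e : edge G) (f h : point -> R[i]) (v w : vertex G) (r : seq (edge G)).
Implicit Types x y z : point.

Fixpoint walk v r w : Prop :=
  if r is e :: r' then exists2 v', joined (@src R G) (@tgt R G) v v' e & walk v' r' w
  else v = w.

Definition walk_length r : R := \sum_(e <- r) len e.

Lemma walk_length_ge0 r : 0 <= walk_length r.
Proof. by apply: sumr_ge0 => e _; exact/ltW/len_gt0. Qed.

Lemma walk_length_cons e r : walk_length (e :: r) = len e + walk_length r.
Proof. by rewrite /walk_length big_cons. Qed.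

Lemma walk_length_cat r1 r2 :
  walk_length (r1 ++ r2) = walk_length r1 + walk_length r2.
Proof. by rewrite /walk_length big_cat. Qed.

Lemma walk_cat v r1 r2 w : walk v (r1 ++ r2) w <-> exists2 u, walk v r1 u & walk u r2 w.
Proof.
elim: r1 v => [|e r1 ih] v /=; first by split => [|[u ->]//]; exists v.
split => [[v' vv' /ih[u r1u r2w]]|[u [v' vv' r1u] r2w]].
  by exists u => //; exists v'.
by exists v' => //; apply/ih; exists u.
Qed.

(* A second passage through [e] is removed together with the loop between the
   two, or together with both passages when their directions differ. *)
Lemma walk_uniq v r w : walk v r w ->
  exists r', [/\ walk v r' w, uniq r' & walk_length r' <= walk_length r].
Proof.
elim: r v => [|e r ih] v /=; first by move=> vw; exists [::].
move=> [v' vv' /ih[r' [r'w ur' lr']]]; have le0 := len_gt0 e.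
have [er'|er'] := boolP (e \in r'); last first.
  exists (e :: r'); split => /=; [by exists v'|by rewrite er'|].
  by rewrite !walk_length_cons lerD2l.
move: er' r'w ur' lr' => /splitPr[r1 r2] /walk_cat[u _ [u' uu' r2w]].
rewrite cat_uniq => /and3P[_ _ ur2].
rewrite walk_length_cat !walk_length_cons => lr'; have := walk_length_ge0 r1 => l1.
have [E|E] : u' = v \/ u' = v'.
  by case: uu' vv' => -[? ?] [] [? ?]; [right|left|left|right]; congruence.
  exists r2; split; [by rewrite -E|by case/andP: ur2|lra].
exists (e :: r2); split => //; last by rewrite walk_length_cons; lra.
by exists v' => //; rewrite -E.
Qed.

Lemma exists_walk v w : exists r, walk v r w.
Proof.
elim: (graph_connected v w) => {v w} [v w [e vw]|v|u v w _ [r1 r1v] _ [r2 r2w]].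
- by exists [:: e], w.
- by exists [::].
- by exists (r1 ++ r2); apply/walk_cat; exists v.
Qed.

Definition leg x v (a : R) := exists2 t : R, at_vertex (x.1, t) v & `|x.2 - t| = a.

(** Induction on the path: it stays on one edge, or it dominates a leg to a vertex, a walk and a
    last leg. When a gluing precedes a leg starting at a vertex, that leg either returns to the same
    vertex and is dropped, or crosses the whole edge, which then joins the walk. *)
Lemma path_decomposition x y (l : R) : path_length x y l ->
  (x.1 = y.1 /\ `|x.2 - y.2| <= l) \/
  exists v w r a c, [/\ leg x v a, walk v r w, leg y w c & a + walk_length r + c <= l].
Proof.
elim=> {x y l} [x px|x x' y l [v0 [xv x'v]] _ ih|e s t y l ps pt _ ih].
- by left; rewrite subrr normr0.
- right; have lx : leg x v0 0 by exists (x.2 : R); rewrite ?subrr ?normr0; case: x xv.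
  case: ih => [[E d]|[v [w [r [a [c [[t tv ta] vw yw le]]]]]]].
    exists v0, v0, [::], 0, `|x'.2 - y.2|; split => //.
    + by exists (x'.2 : R); [rewrite -E; case: x' x'v {E d}|rewrite distrC].
    + by rewrite /walk_length big_nil !add0r.
  have lenx := len_gt0 x'.1; have ww := walk_length_ge0 r.
  have a0 : 0 <= a by rewrite -ta.
  have same : v0 = v -> exists v w r a c,
      [/\ leg x v a, walk v r w, leg y w c & a + walk_length r + c <= l].
    by move=> E; exists v0, w, r, 0, c; split => //; [rewrite E|lra].
  have step : joined (@src R G) (@tgt R G) v0 v x'.1 -> a = len x'.1 ->
     exists v w r a c,
      [/\ leg x v a, walk v r w, leg y w c & a + walk_length r + c <= l].
    move=> J E; exists v0, w, (x'.1 :: r), 0, c; split => //; first by exists v.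
    by rewrite walk_length_cons -E; lra.
  case: x'v tv => -[/= x'2 v0E] [] /= [t2 vE].
  + by apply: same; rewrite -v0E -vE.
  + apply: step; first by left.
    by rewrite -ta x'2 t2 sub0r normrN gtr0_norm.
  + apply: step; first by right.
    by rewrite -ta x'2 t2 subr0 gtr0_norm.
  + by apply: same; rewrite -v0E -vE.
- case: ih => /= [[E d]|[v [w [r [a [c [[t0 tv ta] vw yw le]]]]]]].
    by left; split => //; rewrite (le_trans (ler_distD t _ _))// lerD2l.
  right; exists v, w, r, `|s - t0|, c; split => //; first by exists t0.
  have := ler_distD t s t0; rewrite /= in ta; lra.
Qed.

Lemma points_at_vertex e t v : at_vertex ((e, t) : point) v -> points G (e, t).
Proof.
have := len_gt0 e => l0.
by case=> -[/= -> _]; rewrite /points /= lexx ?(ltW l0).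
Qed.

Lemma walk_path v r w x y : walk v r w -> points G x -> points G y ->
  at_vertex x v -> at_vertex y w -> exists l, path_length x y l.
Proof.
move=> + + py + yw; elim: r v x => [|e r ih] v x /=.
  by move=> -> px xw; exists 0; apply: path_glue (path_nil py); exists w.
move=> [v' vv' r'w] px xv.
have [s [t [sv tv']]] : exists s t, at_vertex ((e, s) : point) v /\ at_vertex ((e, t) : point) v'.
  case: vv' => -[<- <-].
    by exists 0, (len e); split; [left|right].
  by exists (len e), 0; split; [right|left].
have [l tl] := ih _ _ r'w (points_at_vertex tv') tv'.
exists (`|s - t| + l); apply: (@path_glue _ _ _ (e, s)); first by exists v.
by apply: path_edge tl; [exact: points_at_vertex sv|exact: points_at_vertex tv'].
Qed.

(** The infimum in [path_metric] is thus over a nonempty set, so lower bounds on path lengths pass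
    to it. *)
Lemma exists_path x y : points G x -> points G y -> exists l, path_length x y l.
Proof.
move: x y => [e s] [e' s'] ps ps'.
have p0 (i : edge G) : points G (i, 0).
  by rewrite /points/= lexx ltW ?len_gt0.
have v0 (i : edge G) : at_vertex ((i, 0) : point) (src i) by left.
have le0 (i : edge G) (t : R) : points G (i, t) -> exists l, path_length ((i, 0) : point) (i, t) l.
  by move=> pt; exists (`|0 - t| + 0); apply: path_edge (path_nil pt).
have [r rw] := exists_walk (src e) (src e').
have cat x y z (k l : R) : path_length x y k -> path_length y z l -> exists n, path_length x z n.
  elim=> {x y k} [x _|x x' y k xx' _ ih /ih[n nP]|i a b y k pa pb _ ih /ih[n nP]].
  - by exists l.
  - by exists n; exact: path_glue nP.
  - by exists (`|a - b| + n); exact: path_edge nP.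
have [k1 P1] := walk_path rw (p0 e) (p0 e') (v0 e) (v0 e').
have [k2 P2] := le0 e' s' ps'; have [k3 P3] := cat _ _ _ _ _ P1 P2.
by exists (`|s - 0| + k3); exact: path_edge P3.
Qed.

Lemma path_length_ge0 x y (l : R) : path_length x y l -> 0 <= l.
Proof. by elim=> // *; rewrite addr_ge0. Qed.

Lemma path_metric_ge (b : R) x y : points G x -> points G y ->
  (forall l, path_length x y l -> b <= l) -> b <= path_metric G x y.
Proof.
move=> px py bl; apply: lb_le_inf; first exact: exists_path.
by move=> l /bl.
Qed.

Lemma path_metric_ge0 x y : points G x -> points G y -> 0 <= path_metric G x y.
Proof. by move=> px py; apply: path_metric_ge => // l /path_length_ge0. Qed.

Lemma path_metricxx x : points G x -> path_metric G x x = 0.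
Proof.
move=> px; apply/eqP; rewrite eq_le path_metric_ge0// andbT.
apply: ge_inf; last exact: path_nil.
by exists 0 => l /path_length_ge0.
Qed.

Section Bounds.
Variables h h' : point -> R[i].
Hypotheses (hh' : edge_derivative h h') (h_glued : continuous_at_vertices h).
Hypotheses (Lh : L2 mu (points G) h) (Lh' : L2 mu (points G) h').

(** Two-term Cauchy-Schwarz, used with lengths as first factors and energies as second ones; it
    rests on (s a)^2 <= (A q) (p t) and the inequality between geometric and arithmetic means. *)
Lemma sqrD_le (s a A t p q : R) : 0 <= A -> 0 <= t -> 0 <= p -> 0 <= q ->
  s ^+ 2 <= A * t -> a ^+ 2 <= p * q -> (s + a) ^+ 2 <= (A + p) * (t + q).
Proof.
move=> A0 t0 p0 q0 sA ap.
suff : s * a *+ 2 <= A * q + p * t by rewrite sqrrD; lra.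
have Aq0 : 0 <= A * q by rewrite mulr_ge0.
have pt0 : 0 <= p * t by rewrite mulr_ge0.
have [sa|/ltW sa] := leP (s * a) 0.
  by rewrite (@le_trans _ _ 0)// ?mulrn_wle0// addr_ge0.
rewrite -ler_sqr ?nnegrE ?mulrn_wge0 ?addr_ge0//.
apply: (@le_trans _ _ (4 * ((A * q) * (p * t)))).
  rewrite mulr2n; have -> : (s * a + s * a) ^+ 2 = 4 * (s ^+ 2 * a ^+ 2) by ring.
  have -> : (A * q) * (p * t) = (A * t) * (p * q) by ring.
  by rewrite ler_pM2l// ler_pM ?sqr_ge0.
have := sqr_ge0 (A * q - p * t); lra.
Qed.

Lemma walk_diff_le v r w x y : walk v r w -> at_vertex x v -> at_vertex y w ->
  normc (h x - h y) ^+ 2 <= walk_length r * \sum_(e <- r) edge_norm2 e h'.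
Proof.
move=> + + yw; elim: r v x => [|e r ih] v x /=.
  move=> -> xw; rewrite (h_glued (y := y)); last by exists w.
  by rewrite subrr Normc.normc0 expr0n /walk_length !big_nil mul0r.
move=> [v' vv' r'w] xv.
have [s [t [sv tv']]] : exists s t, at_vertex ((e, s) : point) v /\ at_vertex ((e, t) : point) v'.
  case: vv' => -[<- <-].
    by exists 0, (len e); split; [left|right].
  by exists (len e), 0; split; [right|left].
rewrite (h_glued (y := (e, s))); last by exists v.
rewrite walk_length_cons big_cons.
have -> : h (e, s) - h y = (h (e, s) - h (e, t)) + (h (e, t) - h y) by rewrite addrA subrK.
apply: (@le_trans _ _ ((normc (h (e, s) - h (e, t)) + normc (h (e, t) - h y)) ^+ 2)).
  by rewrite lerXn2r ?nnegrE ?addr_ge0 ?normc_ge0 ?normc_triangle.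
have l0 := len_gt0 e; apply: sqrD_le.
- exact: ltW.
- exact: edge_norm2_ge0.
- exact: walk_length_ge0.
- by apply: sumr_ge0 => i _; exact: edge_norm2_ge0.
- have := edge_diff_le hh' (points_at_vertex tv') (points_at_vertex sv).
  move=> /le_trans; apply; rewrite ler_wpM2r ?edge_norm2_ge0//.
  have /andP[/= ? ?] := points_at_vertex tv'; have /andP[/= ? ?] := points_at_vertex sv.
  by rewrite ler_norml; apply/andP; split; lra.
- exact: ih r'w tv'.
Qed.

Lemma walk_sqr_le v r w x y : walk v r w -> at_vertex x v -> at_vertex y w ->
  normc (h x) ^+ 2 <= normc (h y) ^+ 2 +
    5 * \sum_(e <- r) (edge_norm2 e h + edge_norm2 e h').
Proof.
move=> + + yw; elim: r v x => [|e r ih] v x /=.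
  move=> -> xw; rewrite (h_glued (y := y)); last by exists w.
  by rewrite big_nil mulr0 addr0.
move=> [v' vv' r'w] xv.
have [s [t [sv tv']]] : exists s t, at_vertex ((e, s) : point) v /\ at_vertex ((e, t) : point) v'.
  case: vv' => -[<- <-].
    by exists 0, (len e); split; [left|right].
  by exists (len e), 0; split; [right|left].
rewrite (h_glued (y := (e, s))); last by exists v.
rewrite big_cons mulrDr.
have := edge_sqr_le hh' Lh (points_at_vertex sv) (points_at_vertex tv').
have := ih _ _ r'w tv'; lra.
Qed.

(** Compare with one reference vertex along a walk that repeats no edge: the errors of [edge_sqr_le]
    then add up to at most the H^1 norm, however long the walk is. *)
Lemma H1_bounded : exists M, forall x, points G x -> normc (h x) <= M.
Proof.
have [e0 _] := edge_inhabited G.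
pose N := graph_norm2 h + graph_norm2 h'.
have N0 : 0 <= N by rewrite addr_ge0 ?graph_norm2_ge0.
(* 5 N for the walk and 5 N for the edge carrying the point. *)
pose M2 := normc (h (e0, 0)) ^+ 2 + 10 * N.
have M20 : 0 <= M2 by rewrite addr_ge0 ?sqr_ge0 ?mulr_ge0.
exists (Num.sqrt M2) => -[e s] ps.
rewrite -ler_sqr ?nnegrE ?normc_ge0 ?sqrtr_ge0// sqr_sqrtr//.
have p0 (i : edge G) : points G (i, 0).
  by rewrite /points/= lexx ltW ?len_gt0.
have [r0 r0w] := exists_walk (src e) (src e0).
have [r [rw ur _]] := walk_uniq r0w.
have sum_le : \sum_(e <- r) (edge_norm2 e h + edge_norm2 e h') <= N.
  by rewrite big_split/= lerD ?sum_edge_norm2_le.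
have := edge_sqr_le hh' Lh ps (p0 e).
have x0 : at_vertex ((e, 0) : point) (src e) by left.
have y0 : at_vertex ((e0, 0) : point) (src e0) by left.
have := walk_sqr_le rw x0 y0; have := edge_norm2_le e Lh; have := edge_norm2_le e Lh'.
rewrite /M2; move: sum_le; rewrite /N; lra.
Qed.

Lemma H1_holder : exists2 M, 0 <= M & forall x y, points G x -> points G y ->
  normc (h x - h y) <= M * Num.sqrt (path_metric G x y).
Proof.
pose N := graph_norm2 h'; have N0 : 0 <= N by exact: graph_norm2_ge0.
(* One sqrt(l N) for each of the two legs and one for the walk between them. *)
exists (3 * Num.sqrt N) => [|x y px py]; first by rewrite mulr_ge0 ?sqrtr_ge0.
have sq (a l : R) : 0 <= l -> a ^+ 2 <= l * N -> a <= Num.sqrt l * Num.sqrt N.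
  by move=> l0 al; rewrite -sqrtrM// (le_trans (ler_norm _))// -sqrtr_sqr ler_wsqrtr.
have edge_le (e : edge G) (s t l : R) : points G (e, s) -> points G (e, t) -> `|s - t| <= l ->
    normc (h (e, s) - h (e, t)) <= Num.sqrt l * Num.sqrt N.
  move=> ps pt stl; apply: sq; first exact: le_trans stl.
  apply: le_trans (edge_diff_le hh' pt ps) _.
  by rewrite ler_pM ?edge_norm2_ge0 ?edge_norm2_le.
have hl l : path_length x y l -> normc (h x - h y) <= 3 * (Num.sqrt l * Num.sqrt N).
  move=> xyl; have l0 := path_length_ge0 xyl.
  have lN0 : 0 <= Num.sqrt l * Num.sqrt N by rewrite mulr_ge0 ?sqrtr_ge0.
  case: (path_decomposition xyl) => [[]|].
    move: x y px py {xyl} => [e s] [e' t] /= ps pt E; rewrite -E in pt *.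
    by move=> /(edge_le _ _ _ _ ps pt); lra.
  move=> [v [w [r0 [a [c [[s sv sa] r0w [t tw tc] le]]]]]].
  have [r [rw ur rr0]] := walk_uniq r0w.
  have [a0 c0] : 0 <= a /\ 0 <= c by rewrite -sa -tc.
  have r0l := walk_length_ge0 r.
  have h1 : normc (h x - h (x.1, s)) <= Num.sqrt l * Num.sqrt N.
    move: (x) px sv sa => [e u] /= pe sv sa; apply: edge_le => //.
      exact: points_at_vertex sv.
    by rewrite sa; lra.
  have h2 : normc (h (x.1, s) - h (y.1, t)) <= Num.sqrt l * Num.sqrt N.
    apply: sq => //; apply: le_trans (walk_diff_le rw sv tw) _.
    rewrite ler_pM ?sum_edge_norm2_le//; [|lra].
    by apply: sumr_ge0 => i _; exact: edge_norm2_ge0.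
  have h3 : normc (h (y.1, t) - h y) <= Num.sqrt l * Num.sqrt N.
    move: (y) py tw tc => [e u] /= pe tw tc; rewrite normcBC; apply: edge_le => //.
      exact: points_at_vertex tw.
    by rewrite tc; lra.
  have := normc_triangle (h x - h (x.1, s)) (h (x.1, s) - h (y.1, t)).
  rewrite addrA subrK => t1.
  have := normc_triangle (h x - h (y.1, t)) (h (y.1, t) - h y).
  rewrite addrA subrK => t2; lra.
(* For N = 0, any path shows that h x = h y. Otherwise the square of |h x - h y| / (3 sqrt(N)) is a
   lower bound of all path lengths, hence of their infimum. *)
move: N0; rewrite le_eqVlt => /predU1P[N0|N0].
  have [l xyl] := exists_path px py.
  by have := hl l xyl; rewrite -N0 sqrtr0 !mulr0 mul0r.
have sN : 0 < 3 * Num.sqrt N by rewrite mulr_gt0 ?sqrtr_gt0.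
rewrite -ler_pdivrMl//.
rewrite -(ger0_norm (normc_ge0 _)) -sqrtr_sqr -[X in X * _]ger0_norm ?invr_ge0 ?(ltW sN)//.
rewrite -sqrtr_sqr -sqrtrM ?sqr_ge0// ler_wsqrtr//.
apply: path_metric_ge => // l xyl; have l0 := path_length_ge0 xyl.
rewrite -exprMn -[leRHS]sqr_sqrtr// lerXn2r ?nnegrE ?sqrtr_ge0//.
  by rewrite mulr_ge0 ?invr_ge0 ?normc_ge0 ?(ltW sN).
rewrite ler_pdivrMl//; have := hl l xyl; lra.
Qed.

End Bounds.
End Walks.

Lemma H1_estimates {R : realType} (G : metric_graph R) h : H1 (G := G) h ->
  exists2 M : R, 0 <= M &
  [/\ forall x, points G x -> Normc.normc (h x) <= M,
      forall e s t, points G (e, s) -> points G (e, t) ->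
        Normc.normc (h (e, s) - h (e, t)) <= M * Num.sqrt `|s - t|
    & forall x y, points G x -> points G y ->
        Normc.normc (h x - h y) <= M * Num.sqrt (path_metric G x y)].
Proof.
move=> [Lh [hg _] [h' [hh' Lh']]].
have [M1 hM1] := H1_bounded hh' hg Lh Lh'; have [M2 M20 hM2] := H1_holder hh' hg Lh'.
pose N := Num.sqrt (graph_norm2 h'); have N0 : 0 <= N by exact: sqrtr_ge0.
exists (`|M1| + M2 + N); first by rewrite !addr_ge0.
split=> [x px|e s t ps pt|x y px py].
- by apply: le_trans (hM1 x px) _; have := ler_norm M1; lra.
- apply: (@le_trans _ _ (N * Num.sqrt `|s - t|)); last first.
    by rewrite ler_wpM2r ?sqrtr_ge0// lerDr addr_ge0.
  rewrite mulrC -sqrtrM// -[leLHS]ger0_norm ?normc_ge0// -sqrtr_sqr ler_wsqrtr//.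
  rewrite (le_trans (edge_diff_le hh' pt ps))// ler_wpM2l//.
  exact: edge_norm2_le.
- apply: le_trans (hM2 x y px py) _; rewrite ler_wpM2r ?sqrtr_ge0//.
  by have := normr_ge0 M1; lra.
Qed.

(** * Averages over small intervals at a point *)

Section Averages.
Context {R : realType}.
Variable G : metric_graph R.
Local Notation point := (edge G * measurableTypeR R)%type.
Local Notation mu := (graph_measure G).
Local Notation leb := (@lebesgue_measure R).
Local Notation normc := (@Normc.normc R).
Local Notation Re := complex.Re.
Local Notation Im := complex.Im.
Local Notation mp := (@measurable_points R G).
Implicit Types (x y : point) (h : point -> R[i]).

(** At most half the edge, so that an interval of this length fits on one side of the point, and at
    most 1, so that its square root does not exceed 1. *)
Definition radius x (n : nat) : R := Num.min (len x.1) 1 / 2 / n.+1%:R.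

Lemma radius_gt0 x n : 0 < radius x n.
Proof. by rewrite !divr_gt0// lt_min len_gt0 ltr01. Qed.

Lemma radius_le x n : radius x n <= len x.1 / 2 /\ radius x n <= 1.
Proof.
have m0 : 0 < Num.min (len x.1) 1 by rewrite lt_min len_gt0 ltr01.
have [ml m1] : Num.min (len x.1) 1 <= len x.1 /\ Num.min (len x.1) 1 <= 1.
  by rewrite !ge_min !lexx orbT.
have : radius x n <= Num.min (len x.1) 1 / 2.
  by rewrite ler_pdivrMr// ler_peMr ?ler1n// divr_ge0// ltW.
by split; lra.
Qed.

Lemma radius_cvg x : radius x @ \oo --> (0 : R).
Proof.
rewrite /radius -[X in _ --> X](mulr0 (Num.min (len x.1) 1 / 2)).
by apply: cvgM; [exact: cvg_cst|exact: cvg_harmonic].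
Qed.

(** The interval extends to the right of points in the first half of the edge and to the left of the
    others, so it never leaves the edge, even at a vertex. *)
Definition left_end x n : R := if x.2 <= len x.1 / 2 :> R then x.2 else x.2 - radius x n.

Definition near_itv x n : set (measurableTypeR R) :=
  `[left_end x n, left_end x n + radius x n].

Lemma near_itvP x n : points G x ->
  [/\ 0 <= left_end x n, left_end x n + radius x n <= len x.1 &
      left_end x n <= x.2 <= left_end x n + radius x n].
Proof.
rewrite /points/= => /andP[x0 xl]; have [rl _] := radius_le x n.
have := radius_gt0 x n; rewrite /left_end; case: ifPn; rewrite -?ltNge => ? ?; split; lra.
Qed.

Lemma near_itv_sub x n : points G x -> near_itv x n `<=` `[0, len x.1].
Proof.
by move=> /(near_itvP n)[? ? _]; apply: subset_itv; rewrite bnd_simp.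
Qed.

Definition average x n : point -> R[i] :=
  fun y => ((radius x n)^-1 * \1_(edge_part x.1 (near_itv x n)) y)%:C%C.

Lemma measurable_near x n : measurable (edge_part x.1 (near_itv x n)).
Proof. by apply: measurable_edge_part; exact: itv_measurable. Qed.

Lemma average_L2 x n : L2 mu (points G) (average x n).
Proof.
have mE := measurable_near x n.
have cm : cmeasurable (points G) (average x n).
  split => /=; last exact: measurable_cst.
  by apply: measurable_funM => //; exact: measurable_indic.
split => //.
have le1 : leb (near_itv x n) = (radius x n)%:E.
  rewrite lebesgue_measure_itvE ?lerDl ?(ltW (radius_gt0 _ _))//.
  by rewrite addrAC subrr add0r.
rewrite (eq_integral (fun y => (((radius x n)^-1 ^+ 2)%:E *
    (\1_(edge_part x.1 (near_itv x n)) y)%:E)%E)); last first.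
  move=> y _; rewrite /average normcR real_normK ?num_real// exprMn EFinM.
  by congr (_ * _)%E; rewrite indicE; case: (_ \in _); rewrite ?expr1n ?expr0n.
rewrite ge0_integralZl_EFin ?sqr_ge0//; last 2 first.
- exact: mp.
- by apply/measurable_EFinP; exact: measurable_indic.
rewrite integral_indic//; last exact: mp.
rewrite lte_mul_pinfty ?lee_fin ?sqr_ge0//.
apply: (@le_lt_trans _ _ (mu (edge_part x.1 (near_itv x n)))).
  apply: le_measure; rewrite ?inE//.
  by apply: measurableI => //; exact: mp.
rewrite [X in (X < _)%E]product_measure1E//; last exact: itv_measurable.
by rewrite [X in (X * _)%E](edge_counting1 x.1) mul1e [X in (X < _)%E]le1 ltry.
Qed.

Lemma l2inner_average x n h : points G x -> L2 mu (points G) h ->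
  l2inner mu (points G) h (average x n) =
    (radius x n)^-1%:C%C * cintegral leb (near_itv x n) (fun t => h (x.1, t)).
Proof.
move=> px Lh; set S := edge_part x.1 (near_itv x n).
have SP : S `<=` points G by apply: edge_partS; exact: near_itv_sub.
have mS : measurable S by exact: measurable_near.
have LS : L2 leb (near_itv x n) (fun t => h (x.1, t)).
  by apply: L2_edge => //; [exact: itv_measurable|exact: near_itv_sub].
have cS : cmeasurable S h by apply: cmeasurableS SP Lh.1; exact: mp.
rewrite -cintegral_edge//; last exact: itv_measurable.
have -> : cintegral mu S h = cintegral mu (points G) (fun y => h y * (\1_S y)%:C%C).
  rewrite -[in LHS](setIidr SP); apply: complexP => /=.
    rewrite Rintegral_mkcondr; apply: eq_Rintegral => y _.
    by rewrite patchE indicE ReM/= mulr0 subr0; case: (y \in S); rewrite ?mulr1 ?mulr0.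
  rewrite Rintegral_mkcondr; apply: eq_Rintegral => y _.
  by rewrite patchE indicE ImM/= mulr0 add0r; case: (y \in S); rewrite ?mulr1 ?mulr0.
rewrite -cintegralZ; last 2 first.
- exact: mp.
- have := cintegrable_ip mp Lh (L2Z mp (radius x n)%:C%C (average_L2 x n)).
  congr (cintegrable _ _ _); apply/funext => y.
  rewrite /average -rmorphM/= mulrA mulfV ?gt_eqF ?radius_gt0// mul1r.
  by congr (_ * _); exact: conjc_real.
apply: eq_cintegral => y _; rewrite /average conjc_real rmorphM/=.
by rewrite mulrCA.
Qed.

Lemma normc_cintegral_bound (I : set (measurableTypeR R)) (g : R -> R[i]) (r K : R) :
  measurable I -> leb I = r%:E -> 0 <= r -> 0 <= K -> L2 leb I g ->
  (forall t, I t -> normc (g t) <= K) -> normc (cintegral leb I g) <= K * r.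
Proof.
move=> mI lI r0 K0 Lg gK; apply: le_trans (normc_cintegral_le mI lI Lg) _.
have -> : K * r = Num.sqrt r * Num.sqrt (K ^+ 2 * r).
  by rewrite -sqrtrM// mulrCA -expr2 -exprMn sqrtr_sqr ger0_norm// mulr_ge0.
rewrite ler_wpM2l ?sqrtr_ge0// l2normE ler_wsqrtr//.
rewrite -lee_fin -sqr_int_fin//.
apply: (@le_trans _ _ (\int[leb]_(t in I) (cst (K ^+ 2)%:E t))%E); last first.
  by rewrite (integral_cst leb mI) [X in (_ * X <= _)%E]lI -EFinM.
apply: ge0_le_integral => //.
- by move=> t _; rewrite lee_fin sqr_ge0.
- by apply: measurable_sqr_normcE; case: Lg.
- by move=> t It; rewrite lee_fin lerXn2r ?nnegrE ?normc_ge0// gK.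
Qed.

Lemma average_close x n h (M : R) : points G x -> L2 mu (points G) h -> 0 <= M ->
  (forall s t, points G (x.1, s) -> points G (x.1, t) ->
     normc (h (x.1, s) - h (x.1, t)) <= M * Num.sqrt `|s - t|) ->
  normc (l2inner mu (points G) h (average x n) - h x) <= M * Num.sqrt (radius x n).
Proof.
move=> px Lh M0 hM; have r0 := radius_gt0 x n; have [a0 al ax] := near_itvP n px.
have mI := itv_measurable `[left_end x n, left_end x n + radius x n].
have lI : leb (near_itv x n) = (radius x n)%:E.
  rewrite lebesgue_measure_itvE ?lerDl ?(ltW r0)//.
  by rewrite addrAC subrr add0r.
have LI : L2 leb (near_itv x n) (fun t => h (x.1, t)).
  by apply: L2_edge => //; exact: near_itv_sub.
have LIoo : (leb (near_itv x n) < +oo)%E by rewrite lI ltry.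
have Lc (a : R[i]) : L2 leb (near_itv x n) (fun=> a) by exact: L2_cst.
have ci (f : R -> R[i]) : L2 leb (near_itv x n) f -> cintegrable leb (near_itv x n) f.
  move=> Lf; have := cintegrableM mI Lf (Lc 1).
  by congr (cintegrable _ _ _); apply/funext => t; exact: mulr1.
have cc (a : R[i]) : cintegral leb (near_itv x n) (fun=> a) = (radius x n)%:C%C * a.
  apply: complexP; rewrite ?ReM ?ImM /= ?mul0r ?subr0 ?addr0.
    by rewrite (Rintegral_cst _ mI) [X in fine X]lI mulrC.
  by rewrite (Rintegral_cst _ mI) [X in fine X]lI mulrC.
rewrite l2inner_average//.
have -> : h x = (radius x n)^-1%:C%C * cintegral leb (near_itv x n) (fun=> h x).
  by rewrite cc mulrA -rmorphM/= mulVf ?gt_eqF// mul1r.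
rewrite -mulrBr -mulN1r -cintegralZ//; last exact: ci.
rewrite -cintegralD//; [|exact: ci|exact/ci/L2Z].
rewrite Normc.normcM normcR gtr0_norm ?invr_gt0// ler_pdivrMl// [leRHS]mulrC.
apply: normc_cintegral_bound => //.
- exact: ltW.
- by rewrite mulr_ge0 ?sqrtr_ge0.
- by apply: L2D => //; exact: L2Z.
- move=> t; rewrite /near_itv/= in_itv/= => /andP[t1 t2].
  have pt : points G (x.1, t) by rewrite /points/=; lra.
  have px' : points G (x.1, x.2) by rewrite -surjective_pairing.
  rewrite mulN1r; have -> : h x = h (x.1, x.2) by rewrite -surjective_pairing.
  apply: le_trans (hM _ _ pt px') _; rewrite ler_wpM2l// ler_wsqrtr//.
  by rewrite ler_norml; lra.
Qed.

End Averages.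

(** * The kernel of the resolvent *)

Section Bessel.
Context {R : realType} {H : hilbertType R}.
Implicit Types (u v : H) (e : nat -> H).

Lemma ip_suml I (r : seq I) (F : I -> H) v :
  ip (\sum_(i <- r) F i) v = \sum_(i <- r) ip (F i) v.
Proof. by elim/big_rec2: _ => [|i a u _ <-]; rewrite ?ip0l ?ipDl. Qed.

Lemma bessel e u N : (forall n k, ip (e n) (e k) = (n == k)%:R) ->
  \sum_(n < N) Normc.normc (ip (e n) u) ^+ 2 <= hn u ^+ 2.
Proof.
move=> eo; pose p k := \sum_(i < k) ip u (e i) *: e i.
(* The defect in Bessel's inequality is exactly the squared distance to the partial expansion; this
   equality is what the induction proves. *)
suff -> : \sum_(n < N) Normc.normc (ip (e n) u) ^+ 2 = hn u ^+ 2 - hn (u - p N) ^+ 2.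
  by rewrite gerBl sqr_ge0.
elim: N => [|N ih]; first by rewrite big_ord0 /p big_ord0 subr0 subrr.
rewrite big_ord_recr/= ih.
have pe : ip (p N) (e N) = 0.
  by rewrite /p ip_suml big1// => i _; rewrite ipZl eo ltn_eqF ?mulr0.
have -> : u - p N.+1 = (u - p N) - ip u (e N) *: e N.
  by rewrite /p big_ord_recr/= opprD addrA.
rewrite [in RHS]sqr_hnB hnZ ipZr ipBl pe subr0 [conjc _ * _]mulrC mul_conjc /=.
rewrite exprMn -[Normc.normc (ip u (e N))]normc_conjc -ipC [hn (e N) ^+ 2]sqr_hn eo eqxx /=.
ring.
Qed.

End Bessel.

(** * Vectors representing point evaluations *)

Section PointVectors.
Context {R : realType}.
Variable G : metric_graph R.
Local Notation point := (edge G * measurableTypeR R)%type.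
Local Notation mu := (graph_measure G).
Local Notation normc := (@Normc.normc R).
Local Notation mp := (@measurable_points R G).
Local Notation V := (l2class mu mp).
Implicit Types (x y : point) (h : point -> R[i]) (u v : V).

(* [s x] represents the evaluation of [Q u] at [x]; it is the limit of the images
   under [Q] of the averages over intervals shrinking to [x]. *)
Theorem point_vectors (Q : {linear V -> V}) : symop Q ->
  (forall u, exists2 h, ae_eq mu (points G) (rep (Q u)) h & H1 h) ->
  exists (s : point -> V) (C : R), [/\ 0 <= C,
    forall x, points G x -> hn (s x) <= C,
    forall x y, points G x -> points G y ->
      hn (s x - s y) <= C * Num.sqrt (path_metric G x y)
    & forall u, exists h, [/\ L2 mu (points G) h, cls mu mp h = Q u
        & forall x, points G x -> h x = ip u (s x)]].
Proof.
move=> Qs QH; pose a x n := Q (cls mu mp (average x n)).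
pose rho x y := Num.sqrt (path_metric G x y).
(* Bounds, up to a factor depending on [u], the difference of two averages of [Q u]: the Hölder
   distance of the points plus the two averaging errors. The radii also keep it positive when x =
   y. *)
pose w x n y k := Num.sqrt (radius x n) + rho x y + Num.sqrt (radius y k).
have w0 x n y k : 0 < w x n y k.
  by rewrite addr_gt0 ?ltr_pwDl ?sqrtr_gt0 ?radius_gt0 ?sqrtr_ge0.
have ipa u h x n : ae_eq mu (points G) (rep (Q u)) h -> L2 mu (points G) h ->
    ip u (a x n) = l2inner mu (points G) h (average x n).
  move=> Qh Lh; have -> : ip u (a x n) = ip (Q u) (cls mu mp (average x n)).
    by rewrite Qs.
  have -> : Q u = cls mu mp h.
    by rewrite -[LHS]cls_rep; apply: eq_cls => //; exact: rep_L2.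
  by rewrite ip_cls//; exact: average_L2.
(* The averages themselves will give the bound on [s], their normalized differences its Hölder
   continuity. *)
pose F : set V := [set v | (exists x n, points G x /\ v = a x n) \/
  (exists x n y k, [/\ points G x, points G y &
     v = (w x n y k)^-1%:C%C *: (a x n - a y k)])].
have [|C C0 FC] := @uniform_boundedness R V F.
  move=> u; have [h Qh Hh] := QH u; have [Lh _ _] := Hh.
  have [M M0 [hM hMe hMr]] := H1_estimates Hh; exists (2 * M).
  have close x n : points G x ->
      normc (ip u (a x n) - h x) <= M * Num.sqrt (radius x n).
    move=> px; rewrite (ipa u h)//; apply: average_close => // s t.
    exact: hMe.
  move=> v [[x [n [px ->]]]|[x [n [y [k [px py ->]]]]]].
    have := normc_triangle (ip u (a x n) - h x) (h x); rewrite subrK.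
    have := close x n px; have := hM x px.
    have : M * Num.sqrt (radius x n) <= M * 1.
      by rewrite ler_wpM2l// -[leRHS]sqrtr1 ler_wsqrtr//; case: (radius_le x n).
    lra.
  rewrite ipZr conjc_real Normc.normcM normcR gtr0_norm ?invr_gt0//.
  rewrite ler_pdivrMl// ipBr; have cx := close x n px; have cy := close y k py.
  have xy := hMr x y px py.
  apply: (@le_trans _ _ (M * w x n y k)); last first.
    by rewrite mulrC; apply: ler_wpM2l; [exact: ltW|rewrite mulr_natl mulr2n lerDl].
  have split4 (p q r t : R[i]) : p - t = (p - q) + (q - r) + (r - t) by ring.
  rewrite (split4 _ (h x) (h y)) /w !mulrDr; apply: le_trans (normc_triangle _ _) (lerD _ _); last by rewrite normcBC.
  exact: le_trans (normc_triangle _ _) (lerD cx xy).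
have aC x n : points G x -> hn (a x n) <= C.
  by move=> px; apply: FC; left; exists x, n.
have aw x n y k : points G x -> points G y -> hn (a x n - a y k) <= C * w x n y k.
  move=> px py; have : hn ((w x n y k)^-1%:C%C *: (a x n - a y k)) <= C.
    by apply: FC; right; exists x, n, y, k.
  by rewrite hnZ normcR gtr0_norm ?invr_gt0// ler_pdivrMl// mulrC.
have sqrt_radius x : (fun n => Num.sqrt (radius x n)) @ \oo --> (0 : R).
  rewrite -[X in _ --> X]sqrtr0; apply: (@continuous_cvg _ _ _ _ _ _ Num.sqrt).
    exact: sqrt_continuous.
  exact: radius_cvg.
(* For y = x, the bound [aw] involves the radii only and makes the averages at x a Cauchy sequence;
   outside [points] the value is 0. *)
have /choice[s sP] x : exists l, points G x -> hlim (a x) l.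
  have [px|npx] := pselect (points G x); last by exists 0.
  suff [l al] : exists l, hlim (a x) l by exists l.
  apply: hcauchy_lim => e e0.
  have /cvgrPdist_lt/(_ (e / (2 * (C + 1)))) := sqrt_radius x.
  rewrite divr_gt0 ?mulr_gt0 ?ltr_wpDl// => /(_ isT)[N _ Ne].
  exists N => n k /Ne + /Ne; rewrite /= !sub0r !normrN !ger0_norm ?sqrtr_ge0// => ne ke.
  apply: le_lt_trans (aw x n x k px px) _.
  rewrite /w /rho path_metricxx// sqrtr0 addr0.
  apply: (@le_lt_trans _ _ ((C + 1) * (Num.sqrt (radius x n) + Num.sqrt (radius x k)))).
    by rewrite ler_wpM2r ?addr_ge0 ?sqrtr_ge0// lerDl.
  have C1 : 0 < C + 1 by rewrite ltr_wpDl.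
  have -> : e = (C + 1) * (e / (2 * (C + 1)) + e / (2 * (C + 1))).
    by field; rewrite gt_eqF.
  by rewrite ltr_pM2l// ltrD.
exists s, C; split => //.
- move=> x px; apply: ler_cvg_to (hlim_hn (sP x px)) (cvg_cst _) _.
  by near=> n; exact: aC.
- move=> x y px py.
  have l1 : (fun n => hn (a x n - a y n)) @ \oo --> hn (s x - s y).
    by apply: hlim_hn; apply: hlimB; exact: sP.
  have l2 : (fun n => C * w x n y n) @ \oo --> C * rho x y.
    apply: cvgM; first exact: cvg_cst.
    rewrite /w -[X in _ --> X]add0r -[X in _ --> X]addr0.
    by apply: cvgD => //; apply: cvgD => //; exact: cvg_cst.
  by apply: ler_cvg_to l1 l2 _; near=> n; exact: aw.
- move=> u; have [h Qh Hh] := QH u; have [Lh _ _] := Hh.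
  exists h; split => //; first by rewrite -(cls_rep (Q u)); apply/esym/eq_cls => //; exact: rep_L2.
  (* The averages of [h] at x tend to h x and also to <u, s x>, so the identity holds at every point
     of the graph and not just almost everywhere. *)
  move=> x px; have [M M0 [_ hMe _]] := H1_estimates Hh.
  apply/subr0_eq/eqP; rewrite -normc_eq0 eq_le normc_ge0 andbT.
  have lim0 : (fun n => M * Num.sqrt (radius x n) + hn u * hn (a x n - s x)) @ \oo --> (0 : R).
    rewrite -[X in _ --> X]addr0; apply: cvgD.
      by rewrite -[X in _ --> X](mulr0 M); apply: cvgM => //; exact: cvg_cst.
    rewrite -[X in _ --> X](mulr0 (hn u)); apply: cvgM; first exact: cvg_cst.
    exact: sP.
  apply: ler_cvg_to (cvg_cst _) lim0 _; near=> n.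
  have -> : h x - ip u (s x) = (h x - ip u (a x n)) + ip u (a x n - s x).
    by rewrite ipBr addrA subrK.
  apply: le_trans (normc_triangle _ _) _; apply: lerD; last exact: CS.
  rewrite normcBC (ipa u h)//; apply: average_close => // p q.
  exact: hMe.
Unshelve. all: end_near. Qed.

End PointVectors.

(** Every preimage is a countable union of fibers of [f]. *)
Lemma measurable_countable_fibers {d d' : measure_display} {T : measurableType d}
    {T' : measurableType d'} {I : Type} (D : set T) (f : T -> I) (g : I -> T') :
  countable [set: I] -> (forall i, measurable (D `&` [set x | f x = i])) ->
  measurable_fun D (fun x => g (f x)).
Proof.
move=> cI mf _ Y _.
rewrite (_ : _ `&` _ = \bigcup_i (if pselect (Y (g i)) then D `&` [set x | f x = i] else set0)).
  by apply: countable_bigcupT_measurable => // i; case: pselect => [?|?]; [exact: mf|exact: measurable0].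
apply/seteqP; split => [x [Dx Yx]|x [i _]].
  by exists (f x) => //; case: pselect.
by case: pselect => //= Yi [Dx fx]; split => //; rewrite /= fx.
Qed.

Section KernelMeasurability.
Context {R : realType}.
Variable G : metric_graph R.
Local Notation point := (edge G * measurableTypeR R)%type.
Implicit Types (x y : point).

(** Rounds down, towards [src], to the grid of mesh 1/(n+1), so that the grid point stays on the
    edge. *)
Definition grid_index (n : nat) (x : point) : edge G * nat :=
  (x.1, Num.truncn (n.+1%:R * (x.2 : R))).

Definition grid_point (n : nat) (i : edge G * nat) : point := (i.1, i.2%:R / n.+1%:R).

Lemma grid_fiber_measurable n i : measurable [set x | grid_index n x = i].
Proof.
case: i => e k; rewrite (_ : [set x | _] = [set e] `*`
    [set t : measurableTypeR R | Num.truncn (n.+1%:R * (t : R)) = k]); last first.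
  by apply/seteqP; split => [[e' t] [/= -> ->]|[e' t] [/= -> <-]].
apply: measurableX; first exact: edge_set_measurable.
have mle j : measurable [set t : measurableTypeR R | (Num.truncn (n.+1%:R * (t : R)) <= j)%N].
  rewrite (_ : [set t | _] = `]-oo, j.+1%:R / n.+1%:R[%classic); first exact: itv_measurable.
  apply/seteqP; split => t /=; rewrite in_itv/= truncn_le_nat ltr_pdivlMr ?ltr0n//.
    by rewrite mulrC.
  by rewrite mulrC.
case: k => [|k].
  rewrite (_ : [set t | _] = [set t : measurableTypeR R | (Num.truncn (n.+1%:R * (t : R)) <= 0)%N])//.
  by apply/seteqP; split => t /=; [move=> ->|rewrite leqn0 => /eqP].
rewrite (_ : [set t | _] = [set t : measurableTypeR R | (Num.truncn (n.+1%:R * (t : R)) <= k.+1)%N]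
   `\` [set t : measurableTypeR R | (Num.truncn (n.+1%:R * (t : R)) <= k)%N]).
  exact: measurableD.
apply/seteqP; split => t /=; first by move=> ->; rewrite leqnn ltnn.
by move=> [tk /negP]; rewrite -ltnNge => kt; apply/eqP; rewrite eqn_leq tk.
Qed.

Lemma grid_point_close n x : points G x ->
  points G (grid_point n (grid_index n x)) /\
  `|x.2 - (grid_point n (grid_index n x)).2| <= n.+1%:R^-1.
Proof.
rewrite /points/= => /andP[x0 xl].
have c0 : (0 : R) < n.+1%:R by rewrite ltr0n.
have /truncn_itv/andP[t1 t2] : 0 <= n.+1%:R * x.2 :> R by rewrite mulr_ge0// ltW.
set k := Num.truncn _ in t1 t2 *.
have kx : k%:R / n.+1%:R <= x.2 :> R by rewrite ler_pdivrMr// mulrC.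
have xk : x.2 <= k%:R / n.+1%:R + n.+1%:R^-1 :> R.
  rewrite -[X in _ + X]mul1r -mulrDl natr1 ler_pdivlMr// mulrC.
  exact: ltW.
have k0 : 0 <= k%:R / n.+1%:R :> R by rewrite divr_ge0.
by split; [rewrite k0 (le_trans kx)|rewrite ger0_norm ?subr_ge0// lerBlDl].
Qed.

Lemma path_metric_edge (e : edge G) (s t : R) : points G (e, s) -> points G (e, t) ->
  path_metric G (e, s) (e, t) <= `|s - t|.
Proof.
move=> ps pt; apply: ge_inf; first by exists 0 => l /path_length_ge0.
by have := path_edge ps pt (path_nil pt); rewrite addr0.
Qed.

(* [K] is the pointwise limit of its values at the nearest grid points, which
   depend on countably many indices only. *)
Lemma holder_kernel_measurable (K : point -> point -> R[i]) :
  holder_half_kernel K -> cmeasurable (points G `*` points G) (fun p => K p.1 p.2).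
Proof.
move=> [c c0 KH]; have mp := @measurable_points R G.
pose K' n (p : point * point) := K (grid_point n (grid_index n p.1)) (grid_point n (grid_index n p.2)).
have cI : countable [set: (edge G * nat) * (edge G * nat)].
  have cE : countable [set: edge G * nat].
    by rewrite -setXTT; apply: countableX => //; exact: edge_countable.
  by rewrite -setXTT; exact: countableX.
have mK' (q : R[i] -> R) n : measurable_fun (points G `*` points G) (fun p => q (K' n p)).
  apply: (@measurable_countable_fibers _ _ _ _ _ _
    (fun p : point * point => (grid_index n p.1, grid_index n p.2))
    (fun i => q (K (grid_point n i.1) (grid_point n i.2)))) => // -[i j].
  apply: measurableI; first exact: measurableX.
  rewrite (_ : mkset _ = [set x | grid_index n x = i] `*` [set x | grid_index n x = j]).
    by apply: measurableX; exact: grid_fiber_measurable.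
  by apply/seteqP; split => [[x y] [/= -> ->]|[x y] [/= -> ->]].
have bound n p : (points G `*` points G) p ->
    Normc.normc (K' n p - K p.1 p.2) <= c * (Num.sqrt n.+1%:R^-1 + Num.sqrt n.+1%:R^-1).
  move=> [p1 p2]; have [g1 d1] := grid_point_close n p1; have [g2 d2] := grid_point_close n p2.
  apply: le_trans (KH _ _ _ _ g1 p1 g2 p2) _; rewrite ler_pM2l//.
  have close x : points G x -> points G (grid_point n (grid_index n x)) ->
      `|x.2 - (grid_point n (grid_index n x)).2| <= n.+1%:R^-1 ->
      Num.sqrt (path_metric G (grid_point n (grid_index n x)) x) <= Num.sqrt n.+1%:R^-1.
    case: x => e t pt gt dt; apply: ler_wsqrtr; apply: le_trans dt.
    by rewrite distrC; exact: path_metric_edge.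
  by apply: lerD; exact: close.
have lim0 : (fun n => c * (Num.sqrt n.+1%:R^-1 + Num.sqrt n.+1%:R^-1)) @ \oo --> (0 : R).
  have s0 : (fun n => Num.sqrt (n.+1%:R^-1 : R)) @ \oo --> (0 : R).
    rewrite -[X in _ --> X]sqrtr0; apply: (@continuous_cvg _ _ _ _ _ _ Num.sqrt).
      exact: sqrt_continuous.
    exact: cvg_harmonic.
  rewrite -[X in _ --> X](mulr0 c) -[X in c * X]addr0.
  by apply: cvgM; [exact: cvg_cst|exact: cvgD].
have mq (q : R[i] -> R) : (forall a, `|q a| <= Normc.normc a) ->
    (forall a b, q (a - b) = q a - q b) ->
    measurable_fun (points G `*` points G) (fun p => q (K p.1 p.2)).
  move=> q1 qB; apply: (@measurable_fun_cvg _ _ _ _ (fun n p => q (K' n p))).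
  - by move=> n; exact: mK'.
  - move=> p Dp; apply/subr_cvg0; apply: norm_cvg0.
    apply: (squeeze_cvgr _ (cvg_cst 0) lim0); near=> n.
    by rewrite normr_ge0/= -qB (le_trans (q1 _))// bound.
split; first by apply: mq => [a|a b]; [exact: Re_le_normc|exact: ReB].
by apply: mq => [a|a b]; [exact: Im_le_normc|exact: ImB].
Unshelve. all: end_near. Qed.

End KernelMeasurability.

Lemma eq_cintegrable {d : measure_display} {T : measurableType d} {R : realType}
    (m : {measure set T -> \bar R}) (D : set T) (f g : T -> R[i]) : measurable D ->
  (forall x, D x -> f x = g x) -> cintegrable m D f -> cintegrable m D g.
Proof.
move=> mD fg [f1 f2]; split; [apply: eq_integrable f1|apply: eq_integrable f2] => //.
  by move=> x /set_mem /fg ->.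
by move=> x /set_mem /fg ->.
Qed.

(** * The kernel and the Hilbert-Schmidt bound *)

Section MainTheorem.
Context {R : realType}.
Variable G : metric_graph R.
Local Notation point := (edge G * measurableTypeR R)%type.
Local Notation mu := (graph_measure G).
Local Notation normc := (@Normc.normc R).
Local Notation mp := (@measurable_points R G).
Local Notation V := (l2class mu mp).

Variables (Q W W' : {linear V -> V}) (s : point -> V) (C : R).
Hypotheses (Q_sym : symop Q) (W_bop : bop W) (W'_bop : bop W').
Hypothesis WW' : forall u v, ip (W u) v = ip u (W' v).
Hypotheses (C_ge0 : 0 <= C) (s_le : forall x, points G x -> hn (s x) <= C).
Hypothesis s_holder : forall x y, points G x -> points G y ->
  hn (s x - s y) <= C * Num.sqrt (path_metric G x y).
Hypothesis s_eval : forall u, exists h, [/\ L2 mu (points G) h, cls mu mp h = Q u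
  & forall x, points G x -> h x = ip u (s x)].

(** Equal to <W (s y), s x>. It is written with [W'] because, for fixed x, the function sending y to
    <W' (s x), s y> is the representative of Q W' (s x) given by [s_eval]. *)
Definition factor_kernel (x y : point) : R[i] := conjc (ip (W' (s x)) (s y)).

Lemma factor_kernel_bounded : exists c : R, forall x y, points G x -> points G y ->
  normc (factor_kernel x y) <= c.
Proof.
have [k k0 Wk] := W'_bop; exists (k * C * C) => x y px py.
rewrite /factor_kernel normc_conjc; apply: le_trans (CS _ _) _.
apply: ler_pM; [exact: hn_ge0|exact: hn_ge0| |exact: s_le].
by apply: le_trans (Wk _) _; apply: ler_wpM2l => //; exact: s_le.
Qed.

Lemma factor_kernel_holder : holder_half_kernel factor_kernel.
Proof.
have [k k0 Wk] := W'_bop; exists (k * C * C + 1); first by rewrite ltr_wpDl ?mulr_ge0.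
move=> x x' y y' px px' py py'; rewrite /factor_kernel -conjcN -conjcD normc_conjc.
have -> : ip (W' (s x)) (s y) - ip (W' (s x')) (s y') =
    ip (W' (s x - s x')) (s y) + ip (W' (s x')) (s y - s y').
  by rewrite linearB ipBl ipBr addrA subrK.
have rx := sqrtr_ge0 (path_metric G x x'); have ry := sqrtr_ge0 (path_metric G y y').
have h1 : normc (ip (W' (s x - s x')) (s y)) <= k * C * C * Num.sqrt (path_metric G x x').
  apply: le_trans (CS _ _) _; rewrite mulrAC.
  apply: ler_pM; [exact: hn_ge0|exact: hn_ge0| |exact: s_le].
  by apply: le_trans (Wk _) _; rewrite -mulrA; apply: ler_wpM2l => //; exact: s_holder.
have h2 : normc (ip (W' (s x')) (s y - s y')) <= k * C * C * Num.sqrt (path_metric G y y').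
  apply: le_trans (CS _ _) _; rewrite -mulrA.
  apply: ler_pM; [exact: hn_ge0|exact: hn_ge0| |exact: s_holder].
  by apply: le_trans (Wk _) _; apply: ler_wpM2l => //; exact: s_le.
by apply: le_trans (normc_triangle _ _) _; lra.
Qed.

Lemma factor_kernel_Linfty : Linfty_kernel mu (points G) factor_kernel.
Proof.
split; first exact/holder_kernel_measurable/factor_kernel_holder.
have [c cK] := factor_kernel_bounded; exists c; apply/aeW => -[x y] [px py].
exact: cK.
Qed.

(** Wherever [g] agrees with the representative that [s_eval] evaluates, g x = <W Q f, s x> = <f, Q
    W' (s x)>, and this scalar product is the integral against the kernel. *)
Lemma factor_kernel_integral (B : (point -> R[i]) -> (point -> R[i]) -> Prop) :
  (forall f g, B f g -> op_graph (fun u : V => Q (W (Q u))) f g) ->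
  integral_operator mu (points G) B factor_kernel.
Proof.
move=> BQ f g /BQ[Lf Lg gE]; have [h [Lh hE hs]] := s_eval (W (Q (cls mu mp f))).
have gh : ae_eq mu (points G) g h by apply: (@cls_inj _ _ _ _ _ mp) => //; rewrite gE hE.
apply: filterS gh => x gx px.
have [k [Lk kE ks]] := s_eval (W' (s x)).
have fk y : points G y -> f y * conjc (k y) = factor_kernel x y * f y.
  by move=> py; rewrite ks// mulrC.
split.
  have := cintegrable_ip mp Lf Lk.
  exact: (@eq_cintegrable _ _ _ mu _ _ (fun y => factor_kernel x y * f y) mp fk).
rewrite gx// hs// -(eq_cintegral mu fk) -[RHS](ip_cls mp Lf Lk) kE.
by rewrite WW' Q_sym.
Qed.

(** Since (Q e_n)(x) = <e_n, s x>, the sum may be taken under the integral and Bessel's inequality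
    applied to [s x] at each x; the result is at most C^2 times the volume. *)
Lemma factor_HS e : (total_volume G < +oo)%E -> orthonormal_basis mu (points G) e ->
  exists c : R, forall N, \sum_(n < N) hn (Q (cls mu mp (e n))) ^+ 2 <= c.
Proof.
move=> vol [Le eo _]; have volp := le_lt_trans (graph_measure_points_le G) vol.
have ipe n k : ip (cls mu mp (e n)) (cls mu mp (e k)) = (n == k)%:R.
  by rewrite ip_cls.
have /choice[h hP] n := s_eval (cls mu mp (e n)).
exists (fine ((C ^+ 2)%:E * mu (points G))) => N.
rewrite -lee_fin fineK; last first.
  by rewrite ge0_fin_numE ?mule_ge0 ?lee_fin ?sqr_ge0// lte_mul_pinfty ?lee_fin ?sqr_ge0.
rewrite -sumEFin.
have -> : (\sum_(n < N) (hn (Q (cls mu mp (e n))) ^+ 2)%:E =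
    \int[mu]_(x in points G) \sum_(n < N) (normc (h n x) ^+ 2)%:E)%E.
  rewrite ge0_integral_sum//; last 3 first.
  - exact: mp.
  - by move=> n; apply: measurable_sqr_normcE; have [[]] := hP n.
  - by move=> n x _; rewrite lee_fin sqr_ge0.
  apply: eq_bigr => n _; have [Lh <- _] := hP n.
  by rewrite sqr_hn ip_cls// sqr_int_fin//; exact: mp.
rewrite -(integral_cst mu mp); apply: ge0_le_integral => //.
- exact: mp.
- by move=> x _; apply: sume_ge0 => n _; rewrite lee_fin sqr_ge0.
- apply: emeasurable_sum => n; apply: measurable_sqr_normcE.
  by have [[]] := hP n.
- move=> x px; rewrite sumEFin lee_fin.
  rewrite (eq_bigr (fun n : 'I_N => normc (ip (cls mu mp (e n)) (s x)) ^+ 2)); last first.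
    by move=> n _; have [_ _ ->] := hP n.
  apply: le_trans (bessel (s x) N ipe) _.
  by rewrite lerXn2r ?nnegrE ?hn_ge0// s_le.
Qed.

End MainTheorem.

Theorem theorem5p1 (R : realType) (G : metric_graph R)
    (A : (edge G * measurableTypeR R -> R[i]) ->
         (edge G * measurableTypeR R -> R[i]) -> Prop) (z : R[i])
    (A_extends : extends A (minimal_laplacian G))
    (A_self_adjoint : self_adjoint (graph_measure G) (points G) A)
    (A_semibounded : lower_semibounded (graph_measure G) (points G) A)
    (z_resolvent : resolvent_set (graph_measure G) (points G) A z)
    (form_domain_H1 : forall f,
       form_domain (graph_measure G) (points G) A f ->
       exists2 h, ae_eq (graph_measure G) (points G) f h & H1 h) :
  (exists K, [/\ integral_operator (graph_measure G) (points G)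
                   (resolvent A z) K,
                 Linfty_kernel (graph_measure G) (points G) K
               & holder_half_kernel K]) /\
  ((total_volume G < +oo)%E ->
     trace_class (graph_measure G) (points G) (resolvent A z)).
Proof.
have [Q [W [W' [S [[Qs Qb Qf] [Wb Wb' WW'] res [Sb Ss Sp SS] SM]]]]] :=
  resolvent_factor (@measurable_points R G) A_self_adjoint A_semibounded z_resolvent.
have [s [C [C0 sC sH sE]]] := point_vectors Qs (fun u => form_domain_H1 _ (Qf u)).
split.
  exists (factor_kernel W' s); split.
  - by apply: (factor_kernel_integral Qs WW' sE) => f g /res.
  - exact: factor_kernel_Linfty Wb' C0 sC sH.
  - exact: factor_kernel_holder Wb' C0 sC sH.
move=> vol.
have T_lin : linear (fun u => Q (W (Q u))) by move=> a u v; rewrite !linearP.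
have T'_lin : linear (fun u => Q (W' (Q u))) by move=> a u v; rewrite !linearP.
apply: (@trace_class_of_HS _ _ _ _ _ (@measurable_points R G) _ (mklin T_lin) (mklin T'_lin) S Q) => //.
- by apply: bop_comp => //; exact: bop_comp.
- by move=> u v /=; rewrite Qs WW' Qs.
- move=> e eb; have [c hc] := factor_HS C0 sC sE vol eb; exists c => N.
  exact: hc.
Qed.
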